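(* Assume the setting and conditions $\mathscr R_1$–$\mathscr R_4$ of the context and let $\vartheta_0\in\Theta$ be the true position, $\tau_0=(\tau_1(\vartheta_0),\dots,\tau_k(\vartheta_0))$. Let $\hat\tau_n=(\hat\tau_{1,n},\dots,\hat\tau_{k,n})$, where $\hat\tau_{j,n}$ maximizes $\tau\mapsto L_j(\tau,X_j)$ over $[\alpha_j,\beta_j]$. Then $\hat\tau_n$ is consistent and asymptotically normal, $$\sqrt n(\hat\tau_n-\tau_0)\Rightarrow\xi\sim\mathcal N\big(0,\mathbb I_\tau(\vartheta_0)^{-1}\big),$$ all polynomial moments of $\sqrt n(\hat\tau_n-\tau_0)$ converge to those of $\xi$, and $\hat\tau_n$ is asymptotically efficient (in the minimax Hájek–Le Cam sense: $\lim_{\delta\to0}\lim_{n\to\infty}\sup_{\|\tau-\tau_0\|\le\delta}n\mathbf E_\tau\|\hat\tau_n-\tau\|^2=\mathbf E\|\xi\|^2$).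
   Context: Setting. $\Theta\subset\mathbb R^2$ is a bounded open convex set; $T>0$, $\nu>0$, $\lambda_0>0$ are known; $k\ge3$ detectors at known points $\vartheta_j=(x_j,y_j)$. $\tau_j(\vartheta)=\nu^{-1}\|\vartheta_j-\vartheta\|$, $\alpha_j=\inf_\Theta\tau_j$, $\beta_j=\sup_\Theta\tau_j$, with $0<\alpha_j$, $\beta_j<T$; $\lambda_j$ is defined on $[-\beta_j,T-\alpha_j]$. The observations $X_j=(X_j(t),0\le t\le T)$, $j=1,\dots,k$, are independent inhomogeneous Poisson processes with intensities $n\lambda_j(t-\tau_j)+n\lambda_0$, where $\tau_j=\tau_j(\vartheta_0)$. For each $j$, the likelihood ratio in the delay $\tau$ is $$L_j(\tau,X_j)=\exp\Big\{\int_\tau^T\ln\Big(1+\frac{\lambda_j(t-\tau)}{\lambda_0}\Big)dX_j(t)-n\int_\tau^T\lambda_j(t-\tau)dt\Big\}.$$ $\mathbb I_\tau(\vartheta_0)$ is the $k\times k$ diagonal matrix with entries $\mathbb I_\tau(\vartheta_0)_{jj}=\int_{\tau_j(\vartheta_0)}^T\frac{\lambda_j'(t-\tau_j(\vartheta_0))^2}{\lambda_j(t-\tau_j(\vartheta_0))+\lambda_0}dt$. Fisher information for the position: $J_j(\vartheta)=\frac{1}{\nu^2\|\vartheta_j-\vartheta\|^2}\mathbb I_\tau(\vartheta)_{jj}$ and $\mathbb I(\vartheta)=\sum_jJ_j(\vartheta)(\vartheta_j-\vartheta)(\vartheta_j-\vartheta)^\top$. Conditions: ($\mathscr R_1$)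 $\lambda_j(t)=0$ on $[-\beta_j,0]$ and $\lambda_j(t)>0$ on $(0,T-\alpha_j]$; ($\mathscr R_2$) each $\lambda_j$ has two continuous derivatives; ($\mathscr R_3$) $\inf_{\vartheta\in\Theta}\inf_{|e|=1}e^\top\mathbb I(\vartheta)e>0$; ($\mathscr R_4$) at least three detector points are not collinear. *)

(* Defs.v *)
From HB Require Import structures.
From mathcomp Require Import all_boot all_order all_algebra.
From mathcomp Require Import all_classical all_reals all_analysis.

Set Implicit Arguments.
Unset Strict Implicit.
Unset Printing Implicit Defensive.

Import Order.TTheory GRing.Theory Num.Theory.
Import numFieldNormedType.Exports.
Local Open Scope classical_set_scope.
Local Open Scope ring_scope.

Section defs.
Variable R : realType.

Definition dist2 (p q : R * R) : R :=
  Num.sqrt ((p.1 - q.1) ^+ 2 + (p.2 - q.2) ^+ 2).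

Definition delay (nu : R) (thj th : R * R) : R := (dist2 thj th) / nu.

Definition bounded2 (Th : set (R * R)) : Prop :=
  exists M : R, forall p, Th p -> `|p.1| <= M /\ `|p.2| <= M.
Definition convex2 (Th : set (R * R)) : Prop :=
  forall p q, Th p -> Th q -> forall s : R, 0 <= s <= 1 ->
    Th ((1 - s) * p.1 + s * q.1, (1 - s) * p.2 + s * q.2).

Definition alpha (nu : R) (Th : set (R * R)) (thj : R * R) : R :=
  inf [set delay nu thj th | th in Th].
Definition beta (nu : R) (Th : set (R * R)) (thj : R * R) : R :=
  sup [set delay nu thj th | th in Th].

(* A realisation of a point (counting) process on [0,T] is represented by the
   finite list of its event times; X(t) = number of events in (0,t]. *)
Definition count (x : seq R) (a b : R) : nat :=
  size [seq t <- x | (a < t) && (t <= b)].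

Definition pois (m : R) (c : nat) : R := m ^+ c / (c`!)%:R * expR (- m).

(* Under P, the processes X_j (j < k) are independent inhomogeneous Poisson
   processes on [0,T] with intensities mu_j: for any finite family of
   intervals (a_i,b_i] in [0,T], attached to processes J i, with intervals
   attached to the same process pairwise disjoint, the joint law of the
   counts is the product of Poisson laws with means int_{a_i}^{b_i} mu. *)
Definition poisson_model {d} {Om : measurableType d} (P : probability Om R)
    (k : nat) (X : 'I_k -> Om -> seq R) (mu : 'I_k -> R -> R) (T : R) : Prop :=
  (forall (j : 'I_k) (a b : R),
      measurable_fun setT (fun w => ((count (X j w) a b)%:R : R))) /\
  (forall (m : nat) (J : 'I_m -> 'I_k) (a b : 'I_m -> R) (c : 'I_m -> nat),
      (forall i, 0 <= a i /\ a i <= b i /\ b i <= T) ->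
      (forall i i', i != i' -> J i = J i' -> b i <= a i' \/ b i' <= a i) ->
      fine (P [set w | forall i, count (X (J i) w) (a i) (b i) = c i]) =
      \prod_(i < m) pois (Rintegral lebesgue_measure `]a i, b i] (mu (J i)))
                         (c i)).

Definition lik (n : nat) (lam : R -> R) (lam0 T tau : R) (x : seq R) : R :=
  expR (\sum_(t <- x | (tau < t) && (t <= T)) ln (1 + lam (t - tau) / lam0)
        - n%:R * Rintegral lebesgue_measure `[tau, T] (fun t => lam (t - tau))).

(* Diagonal entry I_tau(theta_0)_{jj}, written as a function of tau_j. *)
Definition fisher_tau (lam : R -> R) (lam0 T tauj : R) : R :=
  Rintegral lebesgue_measure `[tauj, T]
    (fun t => (derive1 lam (t - tauj)) ^+ 2 / (lam (t - tauj) + lam0)).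

(* e^T I(theta) e with I(theta) = sum_j J_j(theta) (theta_j-theta)(theta_j-theta)^T *)
Definition fisher_pos_quad (k : nat) (nu lam0 T : R) (lam : 'I_k -> R -> R)
    (det : 'I_k -> R * R) (th e : R * R) : R :=
  \sum_(j < k)
    (fisher_tau (lam j) lam0 T (delay nu (det j) th)
       / (nu ^+ 2 * (dist2 (det j) th) ^+ 2))
    * (((det j).1 - th.1) * e.1 + ((det j).2 - th.2) * e.2) ^+ 2.

End defs.

(* Main.v *)
(* The likelihood factorises over the detectors, and the joint Laplace functional
   of the observations is that of independent Poisson processes.  For one detector
   with true delay s, the Hellinger affinity between the delays s and a is at most
   exp (- c n (a - s)^2), because the signal vanishes before 0 and is positive after;
   the maximum likelihood estimator is therefore within any fixed distance of s
   outside of an event of exponentially small probability.  On a further event of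
   this kind, a second order expansion of the log-likelihood shows that the error
   of the estimator is (1 + o(1)) times the score divided by n times the Fisher
   information.  The score is a compensated Poisson integral, whose moment
   generating function is explicit and converges, after scaling, to that of a
   Gaussian.  As the scaled error is at most C sqrt n, the exceptional events do
   not contribute to its moment generating function, which has the same limit.
   Convergence of moment generating functions implies that of polynomial moments
   (by finite differences), of expectations of trigonometric polynomials (by the
   power series of cos) and of bounded continuous functions.  All the bounds are
   uniform in the true delay, which yields the local minimax risk. *)

Require Import Defs.
From HB Require Import structures.
From mathcomp Require Import all_boot all_order all_algebra.
From mathcomp Require Import all_classical all_reals all_analysis.
From mathcomp Require Import measurable_realfun ring lra.

Set Implicit Arguments.
Unset Strict Implicit.
Unset Printing Implicit Defensive.

Import Order.TTheory GRing.Theory Num.Theory.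
Import numFieldNormedType.Exports.
Local Open Scope classical_set_scope.
Local Open Scope ring_scope.

(** * Independence and simple functions *)

(** The model prescribes only the joint laws of counts. Real exponentials of step sums factor over
    independent Poisson counts, hence the choice of moment generating functions; they also control
    all moments at once, limits being taken relative to exponential weights.

    Positivity of the signal at the lags [T - s] is the source of both nondegeneracy facts, the
    separation of delays and the lower bound on the information: each compares an [L^2] norm over
    []0, T]] with an integral that can be evaluated at the endpoints.

    The linearisation error is measured relative to the score, so that it needs no rescaling by
    [sqrt n]. It requires a margin between the true delay and the ends of its range, because the
    one-step estimate must be an admissible competitor of the maximiser. The margin exists because
    [Th] is open: moving the source along the line through a detector varies the delay in both
    directions. *)

Section product_expectation.
Context {d : measure_display} {Om : measurableType d} {R : realType}.
Variable Q : {measure set Om -> \bar R}.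

(** Distributing the product over the sums leaves one term per choice function [c]; its product of
    indicators is the indicator of a joint event, whose measure is given. *)
Lemma integral_prod_simple (I J : finType) (A : I -> J -> set Om)
    (p v : I -> J -> R) :
  (forall i j, measurable (A i j)) -> (forall i j, 0 <= v i j) ->
  (forall c : {ffun I -> J},
     Q [set w | forall i, A i (c i) w] = (\prod_i p i (c i))%:E) ->
  (\int[Q]_w (\prod_i \sum_j v i j * \1_(A i j) w)%:E)%E =
  (\prod_i \sum_j v i j * p i j)%:E.
Proof.
move=> mA v0 QA.
have mI (c : {ffun I -> J}) : measurable [set w | forall i, A i (c i) w].
  rewrite (_ : [set w | _] = \bigcap_(i in [set: I]) A i (c i)); last first.
    by apply/seteqP; split=> w /= h i; [move=> _; exact: h|exact: h].
  by apply: fin_bigcap_measurable => //; exact: finite_finset.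
have E w : \prod_i \sum_j v i j * \1_(A i j) w =
    \sum_(c : {ffun I -> J}) (\prod_i v i (c i)) *
       \1_[set w | forall i, A i (c i) w] w.
  rewrite bigA_distr_bigA; apply: eq_bigr => c _.
  rewrite big_split /=; congr (_ * _).
  rewrite indicE /=; case: (asboolP (forall i, A i (c i) w)) => h.
    rewrite (mem_set (h : [set w | forall i, A i (c i) w] w)) big1// => i _.
    by rewrite indicE (mem_set (h i)).
  rewrite memNset//; move/existsNP : h => [i hi].
  by rewrite (bigD1 i)//= indicE memNset// mul0r.
under eq_integral => w _ do rewrite E -sumEFin.
rewrite ge0_integral_sum//=; last 2 first.
- move=> c; apply/measurable_EFinP; apply: measurable_funM => //.
- by move=> c w _; rewrite lee_fin mulr_ge0// prodr_ge0.
rewrite bigA_distr_bigA -sumEFin; apply: eq_bigr => c _.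
under eq_integral => w _ do rewrite EFinM.
rewrite ge0_integralZl//=; last 2 first.
- by apply/measurable_EFinP; exact: measurable_indic.
- by rewrite lee_fin prodr_ge0.
by rewrite integral_indic// setIT QA -EFinM -big_split.
Qed.

(** Monotone convergence, applied to nonnegative increasing factors, carries a product formula to
    the limit. It serves both for truncated counts and for simple approximations of arbitrary
    functions. *)
Lemma cvg_integral_prod (I : finType) (U : nat -> I -> Om -> R) (u : nat -> I -> R)
    (V : I -> Om -> R) (v : I -> R) :
  (forall n i, measurable_fun setT (U n i)) ->
  (forall n i w, 0 <= U n i w) ->
  (forall i w, {homo (fun n => U n i w) : m n / (m <= n)%N >-> m <= n}) ->
  (forall i w, U n i w @[n --> \oo] --> V i w) ->
  (forall n, (\int[Q]_w (\prod_i U n i w)%:E)%E = (\prod_i u n i)%:E) ->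
  (forall i, u n i @[n --> \oo] --> v i) ->
  (\int[Q]_w (\prod_i V i w)%:E)%E = (\prod_i v i)%:E.
Proof.
move=> mU U0 ndU cU EU cu.
have cprod (f : nat -> I -> R) (g : I -> R) :
    (forall i, f n i @[n --> \oo] --> g i) ->
    \prod_i f n i @[n --> \oo] --> \prod_i g i.
  by move=> fg; apply: cvg_big => //; exact: mul_continuous.
have h : (\int[Q]_w (\prod_i U n i w)%:E)%E @[n --> \oo] -->
    (\int[Q]_w limn (fun n => (\prod_i U n i w)%:E))%E.
  apply: cvg_monotone_convergence => //.
  - by move=> n; apply/measurable_EFinP; exact: measurable_prod.
  - by move=> n w _; rewrite lee_fin prodr_ge0.
  - move=> w _ m n mn; rewrite lee_fin; apply: ler_prod => i _.
    by rewrite U0 ndU.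
have limE w : limn (fun n => (\prod_i U n i w)%:E) = (\prod_i V i w)%:E.
  apply/cvg_lim => //; apply: cvg_EFin; first exact: nearW.
  exact: cprod.
move: h; under [X in X @ _ --> _]eq_fun do rewrite EU.
under eq_integral do rewrite limE.
move=> h; apply: (cvg_unique _ h) => //.
by apply: cvg_EFin; [exact: nearW|exact: cprod].
Qed.

End product_expectation.

(** * Moment generating function of independent Poisson counts *)

Section poisson_vector.
Context {d : measure_display} {Om : measurableType d} {R : realType}.
Variable Q : {measure set Om -> \bar R}.

Lemma cvg_pois_mgf (m v : R) :
  \sum_(c < n) expR (v * c%:R) * pois m c @[n --> \oo] -->
  expR (m * (expR v - 1)).
Proof.
have -> : expR (m * (expR v - 1)) = expR (- m) * expR (m * expR v).
  by rewrite -expRD; congr expR; ring.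
have -> : (fun n => \sum_(c < n) expR (v * c%:R) * pois m c) =
    (fun n => expR (- m) * series (exp_coeff (m * expR v)) n).
  apply/funext => n; rewrite /series /= big_mkord big_distrr /=.
  apply: eq_bigr => c _; rewrite /pois /exp_coeff /= expRM_natr exprMn.
  by rewrite [LHS]mulrA [RHS]mulrC; congr (_ * _); rewrite mulrA (mulrC (m ^+ c)).
by apply: cvgMr; exact: is_cvg_series_exp_coeff.
Qed.

Lemma poisson_vector_mgf (I : finType) (N : I -> Om -> nat) (m v : I -> R) :
  (forall i, measurable_fun setT (fun w => (N i w)%:R : R)) ->
  (forall i, 0 <= m i) ->
  (forall c : I -> nat,
     Q [set w | forall i, N i w = c i] = (\prod_i pois (m i) (c i))%:E) ->
  (\int[Q]_w (\prod_i expR (v i * (N i w)%:R))%:E)%E =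
  (\prod_i expR (m i * (expR (v i) - 1)))%:E.
Proof.
move=> mN m0 QN.
pose A n (i : I) (j : 'I_n) := [set w | N i w = j].
have mA n i (j : 'I_n) : measurable (A n i j).
  rewrite (_ : A n i j = setT `&` (fun w => (N i w)%:R : R) @^-1` [set j%:R]).
    by apply: mN => //; exact: measurable_set1.
  apply/seteqP; split => w /=; first by move=> ->.
  by move=> [_ /eqP]; rewrite eqr_nat => /eqP.
(* Truncation of the exponential to the counts below [n]: a finite combination of indicators,
   increasing with [n], and equal to [expR (v i * N i w)] as soon as [n > N i w]. *)
pose U n i w : R := \sum_(j < n) expR (v i * j%:R) * \1_(A n i j) w.
have UE n i w : U n i w = if (N i w < n)%N then expR (v i * (N i w)%:R) else 0.
  rewrite /U; case: ifPn => [lt|ge].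
    rewrite (bigD1 (Ordinal lt))//= indicE mem_set// mulr1 big1 ?addr0//.
    move=> j jN; rewrite indicE memNset ?mulr0// /A/= => NE.
    by move/eqP : jN; apply; apply/val_inj; rewrite /= NE.
  rewrite big1// => j _; rewrite indicE memNset ?mulr0// /A/= => NE.
  by rewrite NE ltn_ord in ge.
apply: (@cvg_integral_prod _ _ _ Q _ U
  (fun n i => \sum_(c < n) expR (v i * c%:R) * pois (m i) c)).
- move=> n i; apply: measurable_sum => j; apply: measurable_funM => //.
- by move=> n i w; rewrite UE; case: ifP => // _; exact: expR_ge0.
- move=> i w n p np; rewrite !UE; case: ifPn => [lt|_].
    by rewrite (leq_trans lt np).
  by case: ifP => // _; exact: expR_ge0.
- move=> i w; apply: cvg_near_cst; near=> n; rewrite UE ifT//.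
  by near: n; exists (N i w).+1.
- move=> n; apply: (@integral_prod_simple _ _ _ Q _ _ (A n)
    (fun i c => pois (m i) c) (fun i c => expR (v i * c%:R))) => //.
  by move=> c; rewrite -QN.
- by move=> i; exact: cvg_pois_mgf.
Unshelve. all: by end_near. Qed.

End poisson_vector.

(** * Simple functions and densities *)

Section simple_approximation.
Context {d : measure_display} {Om : measurableType d} {R : realType}.
Import HBNNSimple.

(** The dyadic approximation is unfolded into an explicit combination of indicators because
    [integral_prod_simple] expands over a finite index type. The last of the [n * 2 ^ n + 1] cells
    is the overflow [g >= n]. *)
Lemma simple_approximation (g : Om -> R) :
  measurable_fun setT g -> (forall x, 0 <= g x) ->
  exists (a : forall n, 'I_(n * 2 ^ n).+1 -> R)
         (A : forall n, 'I_(n * 2 ^ n).+1 -> set Om),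
  let s n x := \sum_j a n j * \1_(A n j) x in
  [/\ forall n j, 0 <= a n j, forall n j, measurable (A n j),
      forall x, {homo s^~ x : m n / (m <= n)%N >-> m <= n} &
      forall x, s n x @[n --> \oo] --> g x].
Proof.
move=> mg g0.
have mgE : measurable_fun setT (EFin \o g) by exact/measurable_EFinP.
pose M n := (n * 2 ^ n)%N.
pose A n (j : 'I_(M n).+1) : set Om :=
  if (j < M n)%N then dyadic_approx setT (EFin \o g) n j
  else integer_approx setT (EFin \o g) n.
pose a n (j : 'I_(M n).+1) : R := if (j < M n)%N then j%:R / 2 ^+ n else n%:R.
have HE n x : nnsfun_approx measurableT mgE n x = \sum_j a n j * \1_(A n j) x.
  rewrite nnsfun_approxE /approx big_ord_recr /=; congr (_ + _).
    by apply: eq_bigr => j _; rewrite /a /A /= ltn_ord.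
  by rewrite /a /A /= ltnn.
exists a, A; split.
- by move=> n j; rewrite /a; case: ifP => // _; exact: divr_ge0.
- move=> n j; rewrite /A; case: ifPn => _; last exact: emeasurable_fun_c_infty.
  rewrite /dyadic_approx; case: ifPn => // _; rewrite -preimage_comp.
  by apply: (mgE) => //; apply/measurable_image_EFin; exact: measurable_itv.
- move=> x n p np; rewrite -!HE.
  by have := nd_nnsfun_approx measurableT mgE np => /lefP; apply.
- move=> x; under eq_fun do rewrite -HE.
  have := @cvg_nnsfun_approx _ _ _ _ measurableT _ mgE _ x Logic.I.
  by move=> /(_ (fun x _ => g0 x))/fine_cvg.
Qed.

Lemma integral_simple (N : {measure set Om -> \bar R}) (J : finType)
    (a : J -> R) (A : J -> set Om) :
  (forall j, 0 <= a j) -> (forall j, measurable (A j)) ->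
  (\int[N]_x (\sum_j a j * \1_(A j) x)%:E = \sum_j (a j)%:E * N (A j))%E.
Proof.
move=> a0 mA; under eq_integral => x _ do rewrite -sumEFin.
rewrite ge0_integral_sum//=; last 2 first.
- by move=> j; apply/measurable_EFinP; apply: measurable_funM.
- by move=> j x _; rewrite lee_fin mulr_ge0.
apply: eq_bigr => j _; under eq_integral do rewrite EFinM.
rewrite ge0_integralZl//=.
- by rewrite integral_indic// setIT.
- by apply/measurable_EFinP.
- by rewrite lee_fin.
Qed.

Lemma cvg_integral_simple (N : {measure set Om -> \bar R}) (g : Om -> R)
    (s : nat -> Om -> R) :
  (forall n, measurable_fun setT (s n)) -> (forall n x, 0 <= s n x) ->
  (forall x, {homo s^~ x : m n / (m <= n)%N >-> m <= n}) ->
  (forall x, s n x @[n --> \oo] --> g x) ->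
  (\int[N]_x (s n x)%:E)%E @[n --> \oo] --> (\int[N]_x (g x)%:E)%E.
Proof.
move=> ms s0 nds sg.
have limE x : limn (fun n => (s n x)%:E) = (g x)%:E.
  by apply/cvg_lim => //; apply: cvg_EFin; [exact: nearW|exact: sg].
under [X in _ --> X]eq_integral do rewrite -limE.
apply: cvg_monotone_convergence => //.
- by move=> n; apply/measurable_EFinP.
- by move=> n x _; rewrite lee_fin.
- by move=> x _ n p np; rewrite lee_fin; exact: nds.
Qed.

(** Both sides are linear in [g] and stable under increasing limits, so indicators suffice. It is
    applied to the normal law and its density against Lebesgue measure. *)
Lemma integral_density (N nu : {measure set Om -> \bar R}) (f g : Om -> R) :
  measurable_fun setT f -> (forall x, 0 <= f x) ->
  (forall B, measurable B -> N B = (\int[nu]_(x in B) (f x)%:E)%E) ->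
  measurable_fun setT g -> (forall x, 0 <= g x) ->
  (\int[N]_x (g x)%:E = \int[nu]_x (g x * f x)%:E)%E.
Proof.
move=> mf f0 NE mg g0.
have [a [A [a0 mA nds sg]]] := simple_approximation mg g0.
have ms n : measurable_fun setT (fun x => \sum_j a n j * \1_(A n j) x).
  by apply: measurable_sum => j; apply: measurable_funM.
have s0 n x : 0 <= \sum_j a n j * \1_(A n j) x.
  by apply: sumr_ge0 => j _; rewrite mulr_ge0.
have c1 := cvg_integral_simple (N := N) ms s0 nds sg.
have c2 := @cvg_integral_simple nu (fun x => g x * f x)
  (fun n x => (\sum_j a n j * \1_(A n j) x) * f x).
have {}c2 : (\int[nu]_x ((\sum_j a n j * \1_(A n j) x) * f x)%:E)%E @[n --> \oo] -->
    (\int[nu]_x (g x * f x)%:E)%E.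
  apply: c2.
  - by move=> n; apply: measurable_funM.
  - by move=> n x; rewrite mulr_ge0.
  - by move=> x n p np; rewrite ler_wpM2r//; exact: nds.
  - by move=> x; apply: cvgM; [exact: sg|exact: cvg_cst].
apply: (cvg_unique _ c1) => //.
rewrite (_ : (fun n => _) = (fun n => \int[nu]_x
   ((\sum_j a n j * \1_(A n j) x) * f x)%:E)%E)//.
apply/funext => n; rewrite integral_simple//.
under [RHS]eq_integral => x _ do rewrite mulr_suml -sumEFin.
rewrite ge0_integral_sum//=; last 2 first.
- move=> j; apply/measurable_EFinP; apply: measurable_funM => //.
  by apply: measurable_funM.
- by move=> j x _; rewrite lee_fin !mulr_ge0.
apply: eq_bigr => j _; rewrite NE//.
under [RHS]eq_integral => x _ do rewrite -mulrA EFinM.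
rewrite ge0_integralZl//=.
- congr (_ * _)%E; rewrite integral_mkcond; apply: eq_integral => x _ /=.
  by rewrite patchE indicE; case: ifP => _; rewrite ?mul1r ?mul0r.
- by apply/measurable_EFinP; apply: measurable_funM.
- by move=> x _; rewrite lee_fin mulr_ge0.
- by rewrite lee_fin.
Qed.

End simple_approximation.

(** * Expectations of products of independent variables *)

Section independent_product.
Context {d : measure_display} {Om : measurableType d} {R : realType}.
Variable Q : {measure set Om -> \bar R}.

(** Independence is given on rectangles only; each factor is replaced by its increasing simple
    approximations, for which the expectation expands into measures of rectangles. *)
Lemma integral_prod_indep {d' : measure_display} {S : measurableType d'}
    (I : finType) (xi : I -> Om -> S) (N : I -> {measure set S -> \bar R})
    (g : I -> S -> R) (v : I -> R) :
  (forall i, measurable_fun setT (xi i)) ->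
  (forall B : I -> set S, (forall i, measurable (B i)) ->
     Q [set w | forall i, B i (xi i w)] = (\prod_i fine (N i (B i)))%:E) ->
  (forall i B, measurable B -> N i B \is a fin_num) ->
  (forall i, measurable_fun setT (g i)) -> (forall i x, 0 <= g i x) ->
  (forall i, (\int[N i]_x (g i x)%:E)%E = (v i)%:E) ->
  (\int[Q]_w (\prod_i g i (xi i w))%:E)%E = (\prod_i v i)%:E.
Proof.
move=> mxi QN Nfin mg g0 gv.
have /choice[a /choice[A H]] i := simple_approximation (mg i) (g0 i).
pose s n i x := \sum_j a i n j * \1_(A i n j) x.
have ms n i : measurable_fun setT (s n i).
  apply: measurable_sum => j; apply: measurable_funM => //.
  by apply: measurable_indic; have [_ mA _ _] := H i; exact: mA.
have s0 n i x : 0 <= s n i x.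
  by apply: sumr_ge0 => j _; rewrite mulr_ge0//; have [a0 _ _ _] := H i; exact: a0.
have nds i x : {homo (fun n => s n i x) : m n / (m <= n)%N >-> m <= n}.
  by have [_ _ nd _] := H i; exact: nd.
have sg i x : s n i x @[n --> \oo] --> g i x by have [_ _ _ h] := H i; exact: h.
apply: (@cvg_integral_prod _ _ _ Q _ (fun n i w => s n i (xi i w))
  (fun n i => \sum_j a i n j * fine (N i (A i n j)))) => //.
- by move=> n i; apply: measurableT_comp.
- move=> n.
  apply: (@integral_prod_simple _ _ _ Q _ _
    (fun i j => xi i @^-1` A i n j) (fun i j => fine (N i (A i n j)))
    (fun i j => a i n j)).
  + move=> i j; rewrite -[X in measurable X]setTI; apply: mxi => //.
    by have [_ mA _ _] := H i; exact: mA.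
  + by move=> i j; have [a0 _ _ _] := H i; exact: a0.
  + by move=> c; rewrite -QN// => i; have [_ mA _ _] := H i; exact: mA.
- move=> i; have [a0 mA _ _] := H i.
  have := cvg_integral_simple (N := N i) (ms^~ i) (s0^~ i) (nds i) (sg i).
  rewrite gv => /fine_cvg; apply: cvg_trans; apply: near_eq_cvg; apply: nearW => n.
  rewrite /= integral_simple// (_ : (\sum_j _)%E =
    (\sum_j a i n j * fine (N i (A i n j)))%:E)//.
  by rewrite -sumEFin; apply: eq_bigr => j _; rewrite EFinM fineK// Nfin.
Qed.

End independent_product.

(** * The Laplace functional of a Poisson process *)

Section clamp.
Context {R : realType}.
Implicit Types a b u : R.

(** Serves to truncate test functions and to extend the signal continuously beyond its domain. *)
Definition clamp a b u : R := Num.max a (Num.min b u).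

Lemma clamp_itv a b u : a <= b -> a <= clamp a b u <= b.
Proof. by move=> ab; rewrite /clamp le_max lexx ge_max ge_min lexx ab. Qed.

Lemma clamp_id a b u : a <= u <= b -> clamp a b u = u.
Proof. by move=> /andP[au ub]; rewrite /clamp (min_idPr ub) (max_idPr au). Qed.

Lemma clampB_le A u : 0 <= A -> `|u - clamp (- A) A u| <= `|u|.
Proof.
move=> A0; have AA : - A <= A by rewrite ge0_cp.
rewrite /clamp; have [h1|h1] := leP A u.
  by rewrite (max_idPr AA) !ger0_norm; lra.
have [h2|h2] := leP (- A) u; first by rewrite subrr normr0.
by rewrite !ler0_norm; lra.
Qed.

Lemma continuous_clamp a b : continuous (clamp a b).
Proof.
move=> u; apply: (@continuous_max _ _ (fun=> a) (Num.min b)).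
  exact: cst_continuous.
by apply: (@continuous_min _ _ (fun=> b) id); [exact: cst_continuous|exact: cvg_id].
Qed.

End clamp.

(** * Uniform continuity and integrals over half-open intervals *)

Section continuous_integrals.
Context {R : realType}.
Notation mu := (@lebesgue_measure R).
Implicit Types (f g : R -> R) (a b c : R).

(** Only [x] has to lie in [K]: [y] is any nearby point of the space, so that the second point need
    not be located when the modulus is used. *)
Lemma compact_unif_continuous (V : normedModType R) (K : set V) (f : V -> R) (e : R) :
  compact K -> (forall x, K x -> {for x, continuous f}) -> 0 < e ->
  exists2 dl : R, 0 < dl & forall x y, K x -> `|x - y| < dl -> `|f x - f y| < e.
Proof.
move=> /compact_near_coveringP/(_ _ 0^'+ (fun dl x => forall y, `|x - y| < dl ->
  `|f x - f y| < e)) cK cf e0.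
have [] := cK _ _.
  move=> x Kx; have e20 : 0 < e / 2 by rewrite divr_gt0.
  have /cvgrPdist_lt/(_ _ e20) := cf x Kx.
  case/nbhs_ballP => r /= r0 hr.
  have r20 : 0 < r / 2 by rewrite divr_gt0.
  (* With half of the radius for each of the distances from [x] to [z] and from [z] to [y], both [z]
     and [y] stay in the ball of radius [r], where [f] differs from [f x] by less than [e / 2]. *)
  exists (ball x (r / 2), [set z | z < r / 2]).
    split; first exact: nbhsx_ballx.
    by near=> z; rewrite /=; near: z; exact: nbhs_right_lt.
  move=> [z dl] /= [xz dlr] y zy.
  have fz : `|f x - f z| < e / 2.
    by apply: hr; apply: le_ball xz; rewrite ler_pdivrMr// ler_peMr ?ltW// ltr1n.
  have fy : `|f x - f y| < e / 2.
    apply: hr; rewrite -ball_normE /=.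
    rewrite -(subrKA z) (le_lt_trans (ler_normD _ _))// [ltRHS]splitr ltrD//.
      by move: xz; rewrite -ball_normE.
    exact: lt_trans dlr.
  rewrite -(subrKA (f x)) (le_lt_trans (ler_normD _ _))// [ltRHS]splitr ltrD//.
  by rewrite distrC.
move=> dl /= dl0 h.
exists (dl / 2); first by rewrite divr_gt0.
move=> x y Kx xy; apply: (h (dl / 2)) => //=.
- by rewrite sub0r normrN gtr0_norm ?divr_gt0// ltr_pdivrMr// ltr_pMr// ltr1n.
- by rewrite divr_gt0.
Unshelve. all: by end_near. Qed.

Lemma continuous_integrable f a b : continuous f ->
  mu.-integrable `]a, b] (EFin \o f).
Proof.
move=> cf; have : mu.-integrable `[a, b] (EFin \o f); last first.
  by apply: integrableS => //; exact: subset_itv_oc_cc.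
apply: continuous_compact_integrable; first exact: segment_compact.
exact: continuous_subspaceT.
Qed.

Lemma Rintegral_itvD f a b c : continuous f -> a <= b -> b <= c ->
  \int[mu]_(t in `]a, c]) f t =
  \int[mu]_(t in `]a, b]) f t + \int[mu]_(t in `]b, c]) f t.
Proof.
move=> cf ab bc; rewrite -(@Rintegral_itvB _ f (BRight a) (BRight c) b) ?bnd_simp//; last first.
  exact: continuous_integrable.
by rewrite addrC subrK.
Qed.

Lemma Rintegral_itv_le f g a b : continuous f -> continuous g ->
  (forall t, a < t <= b -> f t <= g t) ->
  \int[mu]_(t in `]a, b]) f t <= \int[mu]_(t in `]a, b]) g t.
Proof.
by move=> cf cg fg; apply: le_Rintegral => //; exact: continuous_integrable.
Qed.

Lemma Rintegral_itv_abs f g a b : continuous f -> continuous g ->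
  (forall t, a < t <= b -> `|f t| <= g t) ->
  `|\int[mu]_(t in `]a, b]) f t| <= \int[mu]_(t in `]a, b]) g t.
Proof.
move=> cf cg fg; apply: (le_trans (le_normr_Rintegral _ _)) => //.
  exact: continuous_integrable.
apply: Rintegral_itv_le => // t.
by apply: continuous_comp; [exact: cf|exact: norm_continuous].
Qed.

Lemma Rintegral_itv_eq f g a b : (forall t, a < t <= b -> f t = g t) ->
  \int[mu]_(t in `]a, b]) f t = \int[mu]_(t in `]a, b]) g t.
Proof. by move=> fg; apply: eq_Rintegral => t; rewrite inE/= in_itv/=; exact: fg. Qed.

Lemma Rintegral_itv_subf f g a b : continuous f -> continuous g ->
  \int[mu]_(t in `]a, b]) (f t - g t) =
  \int[mu]_(t in `]a, b]) f t - \int[mu]_(t in `]a, b]) g t.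
Proof. by move=> cf cg; apply: RintegralB => //; exact: continuous_integrable. Qed.

Lemma Rintegral_itv_scale r f a b : continuous f ->
  \int[mu]_(t in `]a, b]) (r * f t) = r * \int[mu]_(t in `]a, b]) f t.
Proof. by move=> cf; apply: RintegralZl => //; exact: continuous_integrable. Qed.

Lemma Rintegral_itv_cst r a b : a <= b -> \int[mu]_(t in `]a, b]) r = r * (b - a).
Proof.
move=> ab; rewrite Rintegral_cst//; congr (_ * _).
have /(congr1 fine) /= := lebesgue_measure_itv `]a, b].
move=> h; apply: (eq_trans h); rewrite lte_fin; case: ifPn => //.
rewrite -leNgt => ba; suff -> : a = b by rewrite subrr.
by apply/eqP; rewrite eq_le ab.
Qed.

End continuous_integrals.

(** * Sums over event times, step functions and Riemann sums *)

Section point_integrals.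
Context {R : realType} (T : R).
Hypothesis T0 : 0 < T.
Notation mu := (@lebesgue_measure R).

(** The stochastic integral of [f] over []0, T]] along the path with event times [x]. *)
Definition pint (f : R -> R) (x : seq R) : R :=
  \sum_(t <- x | (0 < t) && (t <= T)) f t.

Lemma pintB (f g : R -> R) x :
  pint (fun t => f t - g t) x = pint f x - pint g x.
Proof. by rewrite /pint sumrB. Qed.

Lemma pintZ c (f : R -> R) x : pint (fun t => c * f t) x = c * pint f x.
Proof. by rewrite /pint mulr_sumr. Qed.

Lemma pint_le (f g : R -> R) x : (forall t, 0 < t <= T -> `|f t| <= g t) ->
  `|pint f x| <= pint g x.
Proof.
move=> fg; rewrite /pint; apply: (le_trans (ler_norm_sum _ _ _)).
by apply: ler_sum => t; exact: fg.
Qed.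

Lemma pint_cst c x : pint (fun=> c) x = c * pint (fun=> 1) x.
Proof. by rewrite -pintZ; apply: eq_bigr => t _; rewrite mulr1. Qed.

Lemma pint1_ge0 x : 0 <= pint (fun=> 1) x.
Proof. by rewrite /pint sumr_ge0. Qed.

Definition grid (N i : nat) : R := T * (i%:R / N%:R).

(** Stieltjes sum with [f] taken at the right end of each cell; it depends on the path through
    counts only, whose joint law is what the model prescribes. *)
Definition pstep N (f : R -> R) (x : seq R) : R :=
  \sum_(i < N.+1) f (grid N.+1 i.+1) *
    (Defs.count x (grid N.+1 i) (grid N.+1 i.+1))%:R.

Lemma grid0 N : grid N.+1 0 = 0. Proof. by rewrite /grid mul0r mulr0. Qed.
Lemma gridn N : grid N.+1 N.+1 = T.
Proof. by rewrite /grid divff ?mulr1// pnatr_eq0. Qed.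
Lemma grid_le N i j : (i <= j)%N -> grid N.+1 i <= grid N.+1 j.
Proof.
by move=> ij; rewrite /grid ler_pM2l// ler_pM2r ?invr_gt0// ler_nat.
Qed.

Lemma grid_ge0 N i : 0 <= grid N.+1 i.
Proof. by rewrite -(grid0 N) grid_le. Qed.
Lemma grid_leT N i : (i <= N.+1)%N -> grid N.+1 i <= T.
Proof. by move=> iN; rewrite -[leRHS](gridn N) grid_le. Qed.
Lemma gridS N i : grid N.+1 i.+1 - grid N.+1 i = T / N.+1%:R.
Proof. by rewrite /grid -mulrBr -mulrBl -natrB// subSnn mul1r. Qed.

Lemma countE (x : seq R) a b :
  (Defs.count x a b)%:R = \sum_(t <- x) ((a < t) && (t <= b))%:R :> R.
Proof.
elim: x => [|t x IH]; first by rewrite big_nil.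
rewrite big_cons -IH /Defs.count /=; case: ifP => _ /=; last by rewrite add0r.
by rewrite -add1n natrD.
Qed.

(** The half-open cells partition []0, T]]: the indicator of a cell is a difference of indicators of
    half-lines, and the sum telescopes. *)
Lemma cell_sum N (t : R) :
  \sum_(i < N.+1) ((grid N.+1 i < t) && (t <= grid N.+1 i.+1))%:R =
  ((0 < t) && (t <= T))%:R :> R.
Proof.
have E i : ((grid N.+1 i < t) && (t <= grid N.+1 i.+1))%:R =
    (t <= grid N.+1 i.+1)%R%:R - (t <= grid N.+1 i)%R%:R :> R.
  have := @grid_le N i i.+1 (leqnSn i); case: (leP t (grid N.+1 i)) => [h1 h2|h1 h2] /=.
    by rewrite (le_trans h1 h2) subrr.
  by rewrite subr0.
under eq_bigr do rewrite E.
rewrite -(big_mkord xpredT (fun i => (t <= grid N.+1 i.+1)%R%:R - (t <= grid N.+1 i)%R%:R)).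
rewrite telescope_sumr// grid0 gridn; case: (leP t 0) => [t0|t0] /=.
  by rewrite (le_trans t0 (ltW T0)) subrr.
by rewrite subr0.
Qed.

Lemma pstep_pint (f : R -> R) N (e : R) x :
  (forall s t, 0 <= s <= T -> 0 <= t <= T -> `|s - t| <= T / N.+1%:R ->
     `|f s - f t| <= e) ->
  `|pstep N f x - pint f x| <= e * (Defs.count x 0 T)%:R.
Proof.
move=> fe; rewrite /pstep /pint countE.
have -> : \sum_(i < N.+1) f (grid N.+1 i.+1) *
    (Defs.count x (grid N.+1 i) (grid N.+1 i.+1))%:R =
  \sum_(t <- x) \sum_(i < N.+1) f (grid N.+1 i.+1) *
     ((grid N.+1 i < t) && (t <= grid N.+1 i.+1))%:R.
  by rewrite exchange_big /=; apply: eq_bigr => i _; rewrite countE big_distrr.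
rewrite [X in _ - X]big_mkcond /= -sumrB mulr_sumr.
apply: (le_trans (ler_norm_sum _ _ _)); apply: ler_sum => t _.
have -> : (if (0 < t) && (t <= T) then f t else 0) =
    f t * ((0 < t) && (t <= T))%:R by case: ifP => _; rewrite ?mulr1 ?mulr0.
rewrite -(cell_sum N) !mulr_sumr -sumrB.
apply: (le_trans (ler_norm_sum _ _ _)); apply: ler_sum => i _.
rewrite -mulrBl normrM normr_nat.
case: andP => [[h1 h2]|_]; last by rewrite !mulr0.
rewrite !mulr1; apply: fe.
- by rewrite grid_ge0 grid_leT.
- by rewrite (le_trans (grid_ge0 _ _) (ltW h1)) (le_trans h2)// grid_leT.
- by rewrite ger0_norm ?subr_ge0// -(gridS N i) lerB// ltW.
Qed.

Lemma unif_step (f : R -> R) (e : R) : continuous f -> 0 < e ->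
  \forall N \near \oo, forall s t, 0 <= s <= T -> 0 <= t <= T ->
    `|s - t| <= T / N.+1%:R -> `|f s - f t| <= e.
Proof.
move=> cf e0.
have [dl dl0 h] := compact_unif_continuous (@segment_compact R 0 T) (fun x _ => cf x) e0.
have : \forall N \near \oo, T / N.+1%:R < dl.
  have /cvgrPdist_lt/(_ _ dl0) : (fun N => T * (N.+1%:R)^-1) @ \oo --> T * 0.
    by apply: cvgMr; exact: cvg_harmonic.
  apply: filterS => N; rewrite mulr0 sub0r normrN ger0_norm//.
  by rewrite divr_ge0// ltW.
apply: filterS => N Ndl s t s01 _ st; apply: ltW; apply: h => //=.
exact: le_lt_trans Ndl.
Qed.

Lemma cvg_pstep (f : R -> R) x : continuous f ->
  pstep N f x @[N --> \oo] --> pint f x.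
Proof.
move=> cf; apply/cvgrPdist_le => /= e e0.
set c : R := (Defs.count x 0 T)%:R.
have c1 : 0 < c + 1 by rewrite ltr_wpDl.
have ec : 0 < e / (c + 1) by rewrite divr_gt0.
apply: filterS (unif_step cf ec) => N h.
rewrite distrC (le_trans (pstep_pint x h))// -/c mulrAC ler_pdivrMr//.
by rewrite ler_pM2l// lerDl.
Qed.

(** Only [h] is discretised, the mass of each cell being exact; the error is at most the oscillation
    of [h] over a cell times the total mass of [m]. *)
Lemma cvg_riemann (h m : R -> R) : continuous h -> continuous m ->
  (forall t, 0 < t <= T -> 0 <= m t) ->
  \sum_(i < N.+1) h (grid N.+1 i.+1) *
    \int[mu]_(t in `]grid N.+1 i, grid N.+1 i.+1]) m t @[N --> \oo] -->
  \int[mu]_(t in `]0, T]) (h t * m t).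
Proof.
move=> ch cm m0.
have chm : continuous (fun t => h t * m t).
  by move=> t; apply: continuousM; [exact: ch|exact: cm].
have split_int (g : R -> R) N : continuous g -> \int[mu]_(t in `]0, T]) g t =
    \sum_(i < N.+1) \int[mu]_(t in `]grid N.+1 i, grid N.+1 i.+1]) g t.
  move=> cg; pose A i := \int[mu]_(t in `]0, grid N.+1 i]) g t.
  have E i : \int[mu]_(t in `]grid N.+1 i, grid N.+1 i.+1]) g t = A i.+1 - A i.
    rewrite /A (@Rintegral_itvD _ g 0 (grid N.+1 i) (grid N.+1 i.+1)) ?grid_ge0 ?grid_le//.
    by rewrite addrC addKr.
  under eq_bigr do rewrite E.
  rewrite -(big_mkord xpredT (fun i => A i.+1 - A i)) telescope_sumr//.
  rewrite /A gridn grid0 [X in _ - X](_ : _ = 0) ?subr0//.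
  by rewrite set_itv_ge ?bnd_simp ?ltxx// Rintegral_set0.
set M := \int[mu]_(t in `]0, T]) m t.
have M0 : 0 <= M by apply: Rintegral_ge0 => t; rewrite /= in_itv/=; exact: m0.
apply/cvgrPdist_le => /= e e0.
have M1 : 0 < M + 1 by rewrite ltr_wpDl.
have eM : 0 < e / (M + 1) by rewrite divr_gt0.
apply: filterS (unif_step ch eM) => N hN.
rewrite (split_int _ N chm) -sumrB (le_trans (ler_norm_sum _ _ _))//.
apply: (@le_trans _ _ (e / (M + 1) * M)); last first.
  by rewrite mulrAC ler_pdivrMr// ler_pM2l// lerDl.
move: (e / (M + 1)) hN {eM} => c hN.
rewrite /M (split_int _ N cm) mulr_sumr; apply: ler_sum => i _.
rewrite -!Rintegral_itv_scale// -Rintegral_itv_subf//; last first.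
  by move=> t; apply: continuousM; [exact: cst_continuous|exact: cm].
apply: Rintegral_itv_abs.
- move=> t; apply: cvgB; first exact: chm.
  by apply: cvgM; [exact: cvg_cst|exact: cm].
- by move=> t; apply: cvgM; [exact: cvg_cst|exact: cm].
move=> t /andP[t1 t2]; rewrite -mulrBl normrM.
have tT : 0 < t <= T.
  by rewrite (le_lt_trans (grid_ge0 _ _) t1) (le_trans t2)// grid_leT.
rewrite (ger0_norm (m0 _ tT)) ler_wpM2r ?m0//; apply: hN.
- by case/andP: tT => /ltW -> ->.
- by rewrite grid_ge0 grid_leT.
- by rewrite distrC ger0_norm ?subr_ge0// -(gridS N i) lerB// ltW.
Qed.

End point_integrals.

(** * Laplace functional of the joint observation *)

Section poisson_process.
Context {d : measure_display} {Om : measurableType d} {R : realType}.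
Variables (P : probability Om R) (k : nat) (X : 'I_k -> Om -> seq R).
Variables (m : 'I_k -> R -> R) (T : R).
Hypothesis T0 : 0 < T.
Hypothesis cm : forall j, continuous (m j).
Hypothesis m0 : forall j t, 0 < t <= T -> 0 <= m j t.
Hypothesis PX : poisson_model P X m T.
Notation mu := (@lebesgue_measure R).

Lemma measurable_count_eq j a b c :
  measurable [set w | Defs.count (X j w) a b = c].
Proof.
rewrite (_ : [set w | _] =
    setT `&` (fun w => (Defs.count (X j w) a b)%:R : R) @^-1` [set c%:R]).
  by apply: PX.1 => //; exact: measurable_set1.
apply/seteqP; split => w /=; first by move=> ->.
by move=> [_ /eqP]; rewrite eqr_nat => /eqP.
Qed.

(** The model speaks of families indexed by ordinals; enumerating [I] transfers it to any finite
    type, in particular to pairs of a process and a cell. *)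
Lemma poisson_counts (I : finType) (J : I -> 'I_k) (a b : I -> R) :
  (forall i, 0 <= a i /\ a i <= b i /\ b i <= T) ->
  (forall i i', i != i' -> J i = J i' -> b i <= a i' \/ b i' <= a i) ->
  forall c : I -> nat,
  P [set w | forall i, Defs.count (X (J i) w) (a i) (b i) = c i] =
  (\prod_i pois (\int[mu]_(t in `]a i, b i]) m (J i) t) (c i))%:E.
Proof.
move=> ab sep c.
have ms : measurable [set w | forall i, Defs.count (X (J i) w) (a i) (b i) = c i].
  rewrite (_ : [set w | _] = \bigcap_(i in [set: I])
     [set w | Defs.count (X (J i) w) (a i) (b i) = c i]); last first.
    by apply/seteqP; split=> w /= h i; [move=> _; exact: h|exact: h].
  apply: fin_bigcap_measurable; first exact: finite_finset.
  by move=> i _; exact: measurable_count_eq.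
rewrite -[LHS]fineK ?fin_num_measure//; congr EFin.
have := PX.2 #|I| (J \o enum_val) (a \o enum_val) (b \o enum_val) (c \o enum_val).
have -> : [set w | forall i : 'I_#|I|, Defs.count (X ((J \o enum_val) i) w)
     ((a \o enum_val) i) ((b \o enum_val) i) = (c \o enum_val) i] =
   [set w | forall i, Defs.count (X (J i) w) (a i) (b i) = c i].
  apply/seteqP; split => w /= h i; last exact: h.
  by have := h (enum_rank i); rewrite enum_rankK.
move=> ->; last 2 first.
- by move=> i /=; exact: ab.
- move=> i i' ii' /=; apply: sep; apply: contra ii'.
  by move=> /eqP/enum_val_inj ->.
rewrite -(big_enum_val (fun i => pois (\int[mu]_(t in `]a i, b i]) m (J i) t) (c i))).
by apply: eq_bigl => i; rewrite inE.
Qed.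

Lemma measurable_pstep N f j : measurable_fun setT (fun w => pstep T N f (X j w)).
Proof.
apply: measurable_sum => i; apply: measurable_funM => //; exact: PX.1.
Qed.

(** Measurability is assumed for counts alone; [pint] inherits it as a pointwise limit of step
    sums. *)
Lemma measurable_pint f j : continuous f ->
  measurable_fun setT (fun w => pint T f (X j w)).
Proof.
move=> cf; apply: (@measurable_fun_cvg _ _ _ _ (fun N w => pstep T N f (X j w))).
  by move=> N; exact: measurable_pstep.
by move=> w _; exact: cvg_pstep.
Qed.

Lemma poisson_step_mgf N (f : 'I_k -> R -> R) :
  (\int[P]_w (expR (\sum_j pstep T N (f j) (X j w)))%:E)%E =
  (expR (\sum_j \sum_(i < N.+1) (expR (f j (grid T N.+1 i.+1)) - 1) *
     \int[mu]_(t in `]grid T N.+1 i, grid T N.+1 i.+1]) m j t))%:E.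
Proof.
have := @poisson_vector_mgf _ _ _ P ('I_k * 'I_N.+1)%type
  (fun q w => Defs.count (X q.1 w) (grid T N.+1 q.2) (grid T N.+1 q.2.+1))
  (fun q => \int[mu]_(t in `]grid T N.+1 q.2, grid T N.+1 q.2.+1]) m q.1 t)
  (fun q => f q.1 (grid T N.+1 q.2.+1)).
move=> H; transitivity (\int[P]_w (\prod_(q : 'I_k * 'I_N.+1)
   expR (f q.1 (grid T N.+1 q.2.+1) *
     (Defs.count (X q.1 w) (grid T N.+1 q.2) (grid T N.+1 q.2.+1))%:R))%:E)%E.
  apply: eq_integral => w _; congr EFin.
  by rewrite -expR_sum pair_bigA.
rewrite H.
- rewrite -expR_sum; congr (expR _)%:E; rewrite pair_bigA; apply: eq_bigr => q _.
  by rewrite mulrC.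
- by move=> q; exact: PX.1.
- move=> q; apply: Rintegral_ge0 => t /=; rewrite in_itv/= => /andP[t1 t2].
  apply: m0; rewrite (le_lt_trans (grid_ge0 T0 _ _) t1) (le_trans t2)//.
  exact: grid_leT.
- apply: poisson_counts.
  + by move=> q; rewrite grid_ge0// grid_le// grid_leT.
  + move=> [j i] [j' i'] /= ne jj'; subst j'.
    have : (i : nat) != i'.
      by apply: contra ne => /eqP/val_inj ->.
    rewrite neq_ltn => /orP[lt|lt]; [left|right]; exact: grid_le.
Qed.

Lemma pstep_ub N f B x : (forall t, 0 <= t <= T -> f t <= B) ->
  pstep T N f x <= B * (Defs.count x 0 T)%:R.
Proof.
move=> fB; apply: (@le_trans _ _ (\sum_(i < N.+1)
    B * (Defs.count x (grid T N.+1 i) (grid T N.+1 i.+1))%:R)).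
  by apply: ler_sum => i _; rewrite ler_wpM2r// fB// grid_ge0// grid_leT.
rewrite -mulr_sumr countE; under eq_bigr do rewrite countE.
rewrite exchange_big /=; under eq_bigr do rewrite cell_sum//.
exact: lexx.
Qed.

Lemma continuous_itv_bounded (f : R -> R) a b : continuous f ->
  exists2 B, 0 <= B & forall t, a <= t <= b -> `|f t| <= B.
Proof.
move=> cf.
have cN : continuous (fun t => `|f t|).
  by move=> t; apply: continuous_comp; [exact: cf|exact: norm_continuous].
case: (leP a b) => ab; last first.
  by exists 0 => // t /andP[/le_trans h /h]; rewrite leNgt ab.
have [c _ hc] := @EVT_max R (fun t => `|f t|) a b ab (continuous_subspaceT cN).
by exists `|f c| => // t tab; apply: hc; rewrite in_itv.
Qed.

(** Dominated convergence along the step sums. The dominating variable is the exponential of [B]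
    times the total number of events, integrable because Poisson counts have exponential moments of
    every order. *)
Lemma poisson_mgf (f : 'I_k -> R -> R) : (forall j, continuous (f j)) ->
  (\int[P]_w (expR (\sum_j pint T (f j) (X j w)))%:E)%E =
  (expR (\sum_j \int[mu]_(t in `]0, T]) ((expR (f j t) - 1) * m j t)))%:E.
Proof.
move=> cf.
have [B B0 fB] : exists2 B : R, 0 <= B & forall j t, 0 <= t <= T -> `|f j t| <= B.
  have /choice[B hB] (j : 'I_k) :
      exists b, 0 <= b /\ forall t, 0 <= t <= T -> `|f j t| <= b.
    by have [b b0 hb] := continuous_itv_bounded 0 T (cf j); exists b.
  exists (\sum_j B j); first by apply: sumr_ge0 => j _; case: (hB j).
  move=> j t tT; apply: (le_trans ((hB j).2 t tT)).
  by rewrite (bigD1 j)//= lerDl sumr_ge0// => i _; case: (hB i).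
pose g w := (expR (\sum_j B * (Defs.count (X j w) 0 T)%:R))%:E.
have mS N : measurable_fun setT
    (fun w => expR (\sum_j pstep T N (f j) (X j w))).
  by apply: measurableT_comp => //; apply: measurable_sum => j; exact: measurable_pstep.
have ig : P.-integrable setT g.
  apply/integrableP; split.
    apply/measurable_EFinP; apply: measurableT_comp => //.
    by apply: measurable_sum => j; apply: measurable_funM => //; exact: PX.1.
  rewrite (_ : (\int[P]_w `|g w|)%E = (\prod_j expR ((\int[mu]_(t in `]0, T]) m j t) *
     (expR B - 1)))%:E); first exact: ltry.
  have <- := @poisson_vector_mgf _ _ _ P 'I_k
    (fun j w => Defs.count (X j w) 0 T) (fun j => \int[mu]_(t in `]0, T]) m j t)
    (fun=> B).
  - apply: eq_integral => w _; rewrite /g gee0_abs ?lee_fin ?expR_ge0//.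
    by rewrite expR_sum.
  - by move=> j; exact: PX.1.
  - by move=> j; apply: Rintegral_ge0 => t /=; rewrite in_itv/=; exact: m0.
  - apply: (poisson_counts (J := id)).
      by move=> i; split; [exact: lexx|split; [exact: ltW|exact: lexx]].
    by move=> i i' /eqP.
have : (\int[P]_w (expR (\sum_j pstep T N (f j) (X j w)))%:E)%E @[N --> \oo] -->
    (\int[P]_w (expR (\sum_j pint T (f j) (X j w)))%:E)%E.
  apply: (@dominated_cvg _ _ _ P setT measurableT _ _ g) => //.
  - by move=> N; apply/measurable_EFinP.
  - move=> w _; apply: cvg_EFin; first exact: nearW.
    apply: continuous_cvg; first exact: continuous_expR.
    apply: cvg_big => //; first exact: add_continuous.
    by move=> j _; exact: cvg_pstep.
  - move=> N w _; rewrite gee0_abs ?lee_fin ?expR_ge0// ler_expR.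
    apply: ler_sum => j _; apply: pstep_ub => t tT.
    by rewrite (le_trans (ler_norm _))// fB.
under eq_fun do rewrite poisson_step_mgf.
move=> h; apply: (cvg_unique _ h) => //.
apply: cvg_EFin; first exact: nearW.
apply: continuous_cvg; first exact: continuous_expR.
apply: cvg_big => //; first exact: add_continuous.
move=> j _; apply: (cvg_riemann T0 (h := fun t => expR (f j t) - 1)) => //; last exact: m0.
move=> t; apply: cvgB; last exact: cvg_cst.
by apply: continuous_comp; [exact: cf|exact: continuous_expR].
Qed.

End poisson_process.

(** * Convergence of expectations *)

Section moment_convergence.
Context {d d' : measure_display} {Om : measurableType d} {Om' : measurableType d'}.
Context {R : realType} (k : nat).
Variables (P : nat -> probability Om R) (Q : probability Om' R).
Variables (Z : nat -> Om -> 'rV[R]_k) (xi : Om' -> 'rV[R]_k).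
Implicit Types (F G W h : 'rV[R]_k -> R).

(** Integrability is part of the definition because [Rintegral] takes a default value on infinite
    integrals, on which linearity fails. *)
Definition cvgE F : Prop :=
  [/\ forall n, (P n).-integrable setT (fun w => (F (Z n w))%:E),
      Q.-integrable setT (fun w => (F (xi w))%:E) &
      (\int[P n]_w F (Z n w)) @[n --> \oo] --> \int[Q]_w F (xi w)].

Lemma cvgE_ext F G : (forall x, F x = G x) -> cvgE F -> cvgE G.
Proof. by move=> /funext ->. Qed.

Lemma cvgED F G : cvgE F -> cvgE G -> cvgE (fun x => F x + G x).
Proof.
move=> [F1 F2 F3] [G1 G2 G3]; split.
- by move=> n; exact: (integrableD measurableT (F1 n) (G1 n)).
- exact: (integrableD measurableT F2 G2).
- rewrite RintegralD//.
  rewrite (_ : (fun n => _) = (fun n => (\int[P n]_w F (Z n w)) + (\int[P n]_w G (Z n w)))).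
    exact: cvgD.
  by apply/funext => n; rewrite (RintegralD measurableT (F1 n) (G1 n)).
Qed.

Lemma cvgEZ (c : R) F : cvgE F -> cvgE (fun x => c * F x).
Proof.
move=> [F1 F2 F3]; split.
- by move=> n; exact: (integrableZl measurableT c (F1 n)).
- exact: (integrableZl measurableT c F2).
- rewrite RintegralZl//.
  rewrite (_ : (fun n => _) = (fun n => c * (\int[P n]_w F (Z n w)))).
    exact: cvgMr.
  by apply/funext => n; rewrite (RintegralZl _ measurableT (F1 n)).
Qed.

Lemma cvgE_sum (I : Type) (r : seq I) (F : I -> 'rV[R]_k -> R) :
  cvgE (fun=> 0) -> (forall i, cvgE (F i)) -> cvgE (fun x => \sum_(i <- r) F i x).
Proof.
move=> c0 cF; elim: r => [|i r IH].
  by apply: cvgE_ext c0 => x; rewrite big_nil.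
by apply: cvgE_ext (cvgED (cF i) IH) => x; rewrite big_cons.
Qed.

(** Convergent expectations of [W] bound the approximation error uniformly in [n], so that
    exponential weights do the work of tightness and uniform integrability. Measurability of [F]
    comes from the pointwise convergence of the approximations. *)
Lemma cvgE_approx W F : cvgE W ->
  (forall e : R, 0 < e -> exists2 G, cvgE G & forall x, `|F x - G x| <= e * W x) ->
  cvgE F.
Proof.
move=> [W1 W2 W3] app.
have /choice[G hG] (m : nat) : exists G, cvgE G /\
    forall x, `|F x - G x| <= m.+1%:R^-1 * W x.
  by have [|G] := app m.+1%:R^-1 => //; exists G.
have cG x : G m x @[m --> \oo] --> F x.
  apply/cvgrPdist_le => /= e e0.
  have c1 : 0 < `|W x| + 1 by rewrite ltr_wpDl.
  have q0 : 0 < e / (`|W x| + 1) by exact: divr_gt0.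
  have /cvgrPdist_lt/(_ _ q0) := @cvg_harmonic R.
  apply: filterS => m; rewrite /= sub0r normrN ger0_norm// => hm.
  apply: (le_trans ((hG m).2 x)).
  apply: (@le_trans _ _ (m.+1%:R^-1 * (`|W x| + 1))).
    by rewrite ler_wpM2l// (le_trans (ler_norm _))// lerDl.
  by rewrite -ler_pdivlMr// ltW.
have int dd (O : measurableType dd) (mu : {measure set O -> \bar R}) (Y : O -> 'rV[R]_k) :
    mu.-integrable setT (fun w => (W (Y w))%:E) ->
    (forall m, mu.-integrable setT (fun w => (G m (Y w))%:E)) ->
    mu.-integrable setT (fun w => (F (Y w))%:E).
  move=> iW iG.
  have mF : measurable_fun setT (fun w => F (Y w)).
    apply: (@measurable_fun_cvg _ _ _ _ (fun m w => G m (Y w))).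
      by move=> m; apply/measurable_EFinP; have /integrableP[] := iG m.
    by move=> w _; exact: cG.
  (* At [m = 0] the approximation gives [|F| <= W + |G 0|], an integrable bound. *)
  have iS : mu.-integrable setT (fun w => ((1%R : R)%:E * (W (Y w))%:E + `|(G 0%N (Y w))%:E|)%E).
    apply: integrableD => //; first exact: (integrableZl measurableT 1 iW).
    exact: (integrable_abse (iG 0%N)).
  apply: (le_integrable _ _ _ iS) => //; first exact/measurable_EFinP.
  move=> w _; have := (hG 0%N).2 (Y w); rewrite invr1 => h.
  rewrite abse_EFin -EFinM -EFinD abse_EFin lee_fin.
  rewrite [leRHS]ger0_norm; last first.
    by rewrite addr_ge0// (le_trans _ h).
  by rewrite -lerBlDr (le_trans _ h)// lerB_dist.
split.
- by move=> n; apply: (int _ _ _ _ (W1 n)) => m; have [[g1 _ _] _] := hG m; exact: g1.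
- by apply: (int _ _ _ _ W2) => m; have [[_ g2 _] _] := hG m; exact: g2.
have iFP n : (P n).-integrable setT (fun w => (F (Z n w))%:E).
  by apply: (int _ _ _ _ (W1 n)) => m; have [[g1 _ _] _] := hG m; exact: g1.
have iFQ : Q.-integrable setT (fun w => (F (xi w))%:E).
  by apply: (int _ _ _ _ W2) => m; have [[_ g2 _] _] := hG m; exact: g2.
have bnd dd (O : measurableType dd) (mu : {measure set O -> \bar R}) (Y : O -> 'rV[R]_k) m :
    mu.-integrable setT (fun w => (W (Y w))%:E) ->
    mu.-integrable setT (fun w => (G m (Y w))%:E) ->
    mu.-integrable setT (fun w => (F (Y w))%:E) ->
    `|\int[mu]_w F (Y w) - \int[mu]_w G m (Y w)| <=
      m.+1%:R^-1 * \int[mu]_w W (Y w).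
  move=> iW iG iF; rewrite -RintegralB// -RintegralZl//.
  have iFG : mu.-integrable setT (fun w => (F (Y w) - G m (Y w))%:E).
    exact: (integrableB measurableT iF iG).
  apply: (le_trans (le_normr_Rintegral _ _)) => //.
  have iA : mu.-integrable setT (fun w => `|F (Y w) - G m (Y w)|%:E).
    by have := integrable_abse iFG.
  apply: le_Rintegral => //.
    exact: (integrableZl measurableT m.+1%:R^-1 iW).
  by move=> w _; exact: (hG m).2.
apply/cvgrPdist_le => /= e e0.
set w0 := \int[Q]_w W (xi w).
have K0 : 0 < 4 * (`|w0| + 1) by rewrite mulr_gt0// ltr_wpDl.
have q0 : 0 < e / (4 * (`|w0| + 1)) by exact: divr_gt0.
have /cvgrPdist_lt/(_ _ q0) := @cvg_harmonic R.
case=> m _ /(_ m (leqnn m)); rewrite /= sub0r normrN ger0_norm// => hm.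
have [[G1 G2 G3] _] := hG m.
have e40 : 0 < e / 4 by rewrite divr_gt0.
move/cvgrPdist_le : G3 => /(_ _ e40) G3.
move/cvgrPdist_le : W3 => /(_ _ ltr01) W3.
near=> n.
have h1 := bnd _ _ Q xi m W2 G2 iFQ.
have h2 := bnd _ _ (P n) (Z n) m (W1 n) (G1 n) (iFP n).
have h3 : `|\int[Q]_w G m (xi w) - \int[P n]_w G m (Z n w)| <= e / 4 by near: n.
have h4 : `|w0 - \int[P n]_w W (Z n w)| <= 1 by near: n.
have m1 : m.+1%:R^-1 * (`|w0| + 1) <= e / 4.
  rewrite -ler_pdivlMr ?ltr_wpDl// (le_trans (ltW hm))// [4 * _]mulrC invfM mulrA.
  by rewrite mulrAC.
have h5 : \int[P n]_w W (Z n w) <= `|w0| + 1.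
  have := ler_norm w0; move: h4; rewrite distrC ler_distl => /andP[_ h4] h5.
  by rewrite (le_trans h4)// lerD2r.
have h2' : `|\int[P n]_w F (Z n w) - \int[P n]_w G m (Z n w)| <= e / 4.
  by apply: (le_trans h2); apply: (le_trans _ m1); rewrite ler_wpM2l.
have h1' : `|\int[Q]_w F (xi w) - \int[Q]_w G m (xi w)| <= e / 4.
  apply: (le_trans h1); apply: (le_trans _ m1); rewrite ler_wpM2l//.
  by rewrite (le_trans (ler_norm _))// lerDl.
move: h1' h2' h3; rewrite !ler_distl => /andP[? ?] /andP[? ?] /andP[? ?].
by apply/andP; split; lra.
Unshelve. all: by end_near. Qed.

(* Multipliers form an algebra, which spares expanding exponential and
   trigonometric polynomials into combinations of elements of S. *)
Definition multiplier (S : set ('rV[R]_k -> R)) h := forall F,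
  (forall s, S s -> cvgE (fun x => F x * s x)) ->
  (forall s, S s -> cvgE (fun x => F x * h x * s x)).

Section multiplier.
Variable S : set ('rV[R]_k -> R).
Implicit Types g : 'rV[R]_k -> R.

Lemma multiplier_ext h g : (forall x, h x = g x) -> multiplier S h -> multiplier S g.
Proof. by move=> /funext ->. Qed.

Lemma multiplier_cst c : multiplier S (fun=> c).
Proof.
move=> F FS s Ss; apply: cvgE_ext (cvgEZ c (FS s Ss)) => x /=.
by rewrite mulrA (mulrC c).
Qed.

Lemma multiplierD h g : multiplier S h -> multiplier S g ->
  multiplier S (fun x => h x + g x).
Proof.
move=> mh mg F FS s Ss; apply: cvgE_ext (cvgED (mh _ FS s Ss) (mg _ FS s Ss)) => x.
by rewrite mulrDr mulrDl.
Qed.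

Lemma multiplierM h g : multiplier S h -> multiplier S g ->
  multiplier S (fun x => h x * g x).
Proof.
move=> mh mg F FS s Ss.
by apply: cvgE_ext (mg _ (mh _ FS) s Ss) => x; rewrite mulrA.
Qed.

Lemma multiplierZ c h : multiplier S h -> multiplier S (fun x => c * h x).
Proof. by apply: multiplierM; exact: multiplier_cst. Qed.

Lemma multiplierX h n : multiplier S h -> multiplier S (fun x => h x ^+ n).
Proof.
move=> mh; elim: n => [|n IH]; first exact: multiplier_cst.
by apply: multiplier_ext (multiplierM mh IH) => x; rewrite exprS.
Qed.

Lemma multiplier_sum (I : Type) (r : seq I) (h : I -> 'rV[R]_k -> R) :
  (forall i, multiplier S (h i)) -> multiplier S (fun x => \sum_(i <- r) h i x).
Proof.
move=> mh; elim: r => [|i r IH].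
  by apply: multiplier_ext (multiplier_cst 0) => x; rewrite big_nil.
by apply: multiplier_ext (multiplierD (mh i) IH) => x; rewrite big_cons.
Qed.

Lemma multiplier_prod (I : Type) (r : seq I) (h : I -> 'rV[R]_k -> R) :
  (forall i, multiplier S (h i)) -> multiplier S (fun x => \prod_(i <- r) h i x).
Proof.
move=> mh; elim: r => [|i r IH].
  by apply: multiplier_ext (multiplier_cst 1) => x; rewrite big_nil.
by apply: multiplier_ext (multiplierM (mh i) IH) => x; rewrite big_cons.
Qed.

Lemma multiplier_cvgE h : (forall s, S s -> cvgE s) -> S (fun=> 1) ->
  multiplier S h -> cvgE h.
Proof.
move=> Sc S1 mh; have c1 s : S s -> cvgE (fun x => 1 * s x).
  by move=> /Sc; apply: cvgE_ext => x; rewrite mul1r.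
by apply: cvgE_ext (mh _ c1 _ S1) => x; rewrite mul1r mulr1.
Qed.

End multiplier.

End moment_convergence.

(** * Exponential inequalities and remainders of power series *)

Section exponential_bounds.
Context {R : realType}.
Implicit Types x y u : R.

(** As [(n + i)! >= n! * i!], the terms from rank [n] on are dominated by [|x| ^ n / n!] times the
    exponential series of [|x|]. The bounded coefficients [c] let one proof cover [expR] and
    [cos]. *)
Lemma exp_series_tail (c : nat -> R) x (S : R) n : (forall i, `|c i| <= 1) ->
  series (fun i => c i * exp_coeff x i) @ \oo --> S ->
  `|S - \sum_(i < n) c i * exp_coeff x i| <= `|x| ^+ n / n`!%:R * expR `|x|.
Proof.
move=> c1 cS.
have partial N : \sum_(i < N) exp_coeff `|x| i <= expR `|x|.
  have -> : \sum_(i < N) exp_coeff `|x| i = series (exp_coeff `|x|) N.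
    by rewrite /series /= big_mkord.
  apply: nondecreasing_cvgn_le; last exact: is_cvg_series_exp_coeff.
  apply: nondecreasing_series => i _ _.
  by rewrite /exp_coeff /= divr_ge0// exprn_ge0.
have bound N : `|series (fun i => c i * exp_coeff x i) (n + N)%N -
    \sum_(i < n) c i * exp_coeff x i| <= `|x| ^+ n / n`!%:R * expR `|x|.
  rewrite /series /= big_mkord big_split_ord /= addrAC subrr add0r.
  apply: (le_trans (ler_norm_sum _ _ _)).
  apply: (@le_trans _ _ (\sum_(i < N) `|x| ^+ n / n`!%:R * exp_coeff `|x| i)).
    apply: ler_sum => i _; rewrite normrM.
    apply: (@le_trans _ _ (1 * `|exp_coeff x (n + i)|)).
      by rewrite ler_wpM2r.
    rewrite mul1r /exp_coeff /= normrM normrX normfV normr_nat exprD.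
    rewrite mulrACA ler_wpM2l ?mulr_ge0 ?exprn_ge0//.
    rewrite -invfM -natrM lef_pV2 ?posrE ?ltr0n ?muln_gt0 ?fact_gt0// ler_nat.
    rewrite -(bin_fact (leq_addr i n)) addKn leq_pmull//.
    by rewrite bin_gt0 leq_addr.
  by rewrite -mulr_sumr ler_wpM2l// divr_ge0// exprn_ge0.
have cv : `|series (fun i => c i * exp_coeff x i) (n + N)%N -
    \sum_(i < n) c i * exp_coeff x i| @[N --> \oo] -->
    `|S - \sum_(i < n) c i * exp_coeff x i|.
  apply: cvg_norm; apply: cvgB; last exact: cvg_cst.
  have h := cS; rewrite -(cvg_shiftn n) in h.
  rewrite (_ : (fun N => _) =
    (fun N => series (fun i => c i * exp_coeff x i) (N + n)%N)) //.
  by apply/funext => N; rewrite addnC.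
by apply: (cvgr_to_le cv); apply: nearW => N; exact: bound.
Qed.

Lemma expR_tail x n :
  `|expR x - \sum_(i < n) exp_coeff x i| <= `|x| ^+ n / n`!%:R * expR `|x|.
Proof.
have := @exp_series_tail (fun=> 1) x (expR x) n _ _.
under eq_bigr do rewrite mul1r.
apply; first by move=> _; rewrite normr1.
rewrite (_ : (fun i => _) = exp_coeff x); last by apply/funext => i; rewrite mul1r.
exact: is_cvg_series_exp_coeff.
Qed.

Lemma expR_tail2 x : `|expR x - 1 - x| <= x ^+ 2 * expR `|x|.
Proof.
have := expR_tail x 2; rewrite !big_ord_recr big_ord0 /= /exp_coeff /= add0r.
rewrite expr0 expr1 !divr1 opprD addrA => /le_trans; apply.
rewrite ler_wpM2r ?expR_ge0// real_normK ?num_real// ler_piMr ?sqr_ge0//.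
by rewrite invf_le1 ?ler1n.
Qed.

Lemma expR_tail3 x : `|expR x - 1 - x - x ^+ 2 / 2| <= `|x| ^+ 3 * expR `|x|.
Proof.
have := expR_tail x 3; rewrite !big_ord_recr big_ord0 /= /exp_coeff /= add0r.
rewrite expr0 expr1 !divr1 !opprD !addrA => /le_trans; apply.
rewrite ler_wpM2r ?expR_ge0// ler_piMr ?exprn_ge0//.
by rewrite invf_le1 ?ler1n.
Qed.

Lemma cos_tail n : exists c : nat -> R, forall x : R,
  `|cos x - \sum_(i < n) c i * x ^+ i| <= `|x| ^+ n / n`!%:R * expR `|x|.
Proof.
pose c i : R := (~~ odd i)%:R * (-1) ^+ i./2.
exists (fun i => c i / i`!%:R) => x.
have := @exp_series_tail c x (cos x) n _ _.
under eq_bigr do rewrite /exp_coeff /= mulrA mulrAC.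
apply; first by move=> i; rewrite /c normrM normrX normrN1 expr1n mulr1 normr_nat; case: odd.
rewrite (_ : (fun i => _) = cos_coeff x); last first.
  apply/funext => i; rewrite /cos_coeff /exp_coeff /c /=.
  by rewrite !mulrA.
by rewrite unlock; exact: is_cvg_series_cos_coeff.
Qed.

Lemma expr_le_expR x n : 0 <= x -> x ^+ n <= n`!%:R * expR x.
Proof.
move=> x0; case: n => [|n].
  by rewrite expr0 fact0 mul1r -[leLHS]addr0 (le_trans _ (expR_ge1Dx x))// lerD2l.
have := expR_ge1Dxn n x0; rewrite -ler_pdivrMl ?ltr0n ?fact_gt0// mulrC => /(le_trans _); apply.
by rewrite lerDr.
Qed.

Lemma expR_norm_le y : expR `|y| <= expR y + expR (- y).
Proof.
by case: (ger0P y) => _; rewrite ?lerDl ?lerDr expR_ge0.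
Qed.

Lemma expRM_norm_le (c y : R) : 0 <= c ->
  expR (c * `|y|) <= expR (c * y) + expR (- (c * y)).
Proof.
by move=> c0; rewrite -[X in X * `|_|](ger0_norm c0) -normrM; exact: expR_norm_le.
Qed.

Lemma ler_normXB (a b M : R) m : `|a| <= M -> `|b| <= M ->
  `|a ^+ m - b ^+ m| <= `|a - b| * (m%:R * M ^+ m.-1).
Proof.
move=> aM bM; have M0 : 0 <= M := le_trans (normr_ge0 _) aM.
rewrite subrXX normrM ler_wpM2l//.
apply: (le_trans (ler_norm_sum _ _ _)).
rewrite -[m in m%:R](card_ord m) mulr_natl -sumr_const; apply: ler_sum => i _.
rewrite normrM !normrX -[leRHS](_ : M ^+ (m.-1 - i) * M ^+ i = _); last first.
  by rewrite -exprD subnK// -ltnS prednK// (leq_ltn_trans _ (ltn_ord i)).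
rewrite -subn1 subnAC subn1; apply: ler_pM; rewrite ?exprn_ge0//; exact: lerXn2r.
Qed.

(* Recovers polynomial moments from moment generating functions. *)
Lemma finite_difference_pow m : exists C : R, 0 <= C /\
  forall h y : R, 0 < h -> h <= 1 ->
  `|((expR (h * y) - 1) / h) ^+ m - y ^+ m| <= h * (C * expR ((m.*2).+2%:R * `|y|)).
Proof.
(* The factor [m] comes from factoring a difference of [m]-th powers, the factorial from
   [|y| ^ (m + 1) <= (m + 1)! * expR |y|]. The exponent in the weight collects a bound
   [|y| * expR (2 * |y|)] for each of the remaining factors. *)
exists (2%:R * m%:R * m.+1`!%:R); split; first by rewrite !mulr_ge0.
move=> h y h0 h1; set A := (expR (h * y) - 1) / h.
have hy : `|h * y| <= `|y| by rewrite normrM gtr0_norm// ler_piMl.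
have dA : `|A - y| <= h * (y ^+ 2 * expR `|y|).
  have -> : A - y = (expR (h * y) - 1 - h * y) / h.
    by rewrite mulrBl -/A mulrAC divff ?gt_eqF// mul1r.
  rewrite normrM normfV (gtr0_norm h0) ler_pdivrMr// (le_trans (expR_tail2 _))//.
  rewrite exprMn (_ : h * _ * h = h ^+ 2 * y ^+ 2 * expR `|y|); last by ring.
  by rewrite ler_wpM2l ?(mulr_ge0 (sqr_ge0 _) (sqr_ge0 _))// ler_expR.
have nA : `|A| <= `|y| * expR (2 * `|y|).
  have e1 : `|expR (h * y) - 1| <= `|h * y| * expR `|h * y|.
    have := expR_tail (h * y) 1; rewrite big_ord_recr big_ord0 /= /exp_coeff /= add0r.
    by rewrite expr0 !divr1 expr1.
  rewrite /A normrM normfV (gtr0_norm h0) ler_pdivrMr// (le_trans e1)//.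
  have e2 : expR `|h * y| <= expR (2 * `|y|).
    by rewrite ler_expR (le_trans hy)// ler_peMl// ler1n.
  rewrite [leRHS](_ : _ = `|h * y| * expR (2 * `|y|)).
    by rewrite ler_wpM2l.
  by rewrite normrM (gtr0_norm h0) mulrC mulrA.
have ny : `|y| <= `|y| * expR (2 * `|y|).
  by rewrite ler_peMr// -expR0 ler_expR mulr_ge0.
apply: (le_trans (ler_normXB m nA ny)).
case: m => [|m]; first by rewrite mul0r mulr0 mulr0 mul0r mul0r mulr0.
apply: (@le_trans _ _ (h * (y ^+ 2 * expR `|y|) *
    (m.+1%:R * (`|y| * expR (2 * `|y|)) ^+ m))).
  by rewrite ler_wpM2r// mulr_ge0// exprn_ge0// mulr_ge0// expR_ge0.
rewrite -!mulrA (ler_wpM2l (ltW h0))//= exprMn -expRM_natl.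
have yy : y ^+ 2 * `|y| ^+ m <= m.+2`!%:R * expR `|y|.
  by rewrite -(real_normK (num_real y)) -exprD add2n; exact: expr_le_expR.
rewrite [leLHS](_ : _ = m.+1%:R * (expR `|y| * expR (m%:R * (2 * `|y|))) *
   (y ^+ 2 * `|y| ^+ m)); last by ring.
apply: (@le_trans _ _ (m.+1%:R * (expR `|y| * expR (m%:R * (2 * `|y|))) *
   (m.+2`!%:R * expR `|y|))).
  by rewrite ler_wpM2l// !mulr_ge0// expR_ge0.
rewrite [leLHS](_ : _ = m.+1%:R * m.+2`!%:R *
   (expR `|y| * expR (m%:R * (2 * `|y|)) * expR `|y|)); last by ring.
rewrite -!expRD.
rewrite [leRHS](_ : _ = 2 * (m.+1%:R * m.+2`!%:R) *
  expR ((m.+1.*2).+2%:R * `|y|)); last by ring.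
apply: ler_pM; rewrite ?mulr_ge0 ?expR_ge0//.
  by rewrite ler_peMl ?mulr_ge0// ler1n.
rewrite ler_expR (_ : `|y| + _ + _ = (m%:R * 2 + 2) * `|y|); last by ring.
rewrite ler_wpM2r// -natrM -natrD ler_nat muln2 addn2 doubleS.
by rewrite !ltnS -addn2 leq_addr.
Qed.

End exponential_bounds.

(** * Multivariate Bernstein polynomials *)

Section bernstein.
Context {R : realType}.
Implicit Types (p : R) (N : nat).

Definition bernstein N p (c : nat) : R :=
  'C(N, c)%:R * p ^+ c * (1 - p) ^+ (N - c).

Lemma bernstein_ge0 N p c : 0 <= p <= 1 -> 0 <= bernstein N p c.
Proof.
move=> /andP[p0 p1]; rewrite /bernstein mulr_ge0 ?exprn_ge0 ?subr_ge0//.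
by rewrite mulr_ge0// exprn_ge0.
Qed.

Lemma bernstein_sum N p : \sum_(c < N.+1) bernstein N p c = 1.
Proof.
have := exprDn (1 - p) p N; rewrite subrK expr1n => ->.
by apply: eq_bigr => c _; rewrite /bernstein -mulr_natl; ring.
Qed.

(** The identity [c * 'C(N + 1, c) = (N + 1) * 'C(N, c - 1)] lowers the order of a moment by one; it
    yields the mean with [g = 1] and the second moment with [g c = c + 1]. *)
Lemma bernstein_moment N p (g : nat -> R) :
  \sum_(c < N.+2) bernstein N.+1 p c * (c%:R * g c.-1) =
  N.+1%:R * p * \sum_(c < N.+1) bernstein N p c * g c.
Proof.
rewrite big_ord_recl /= mul0r mulr0 add0r mulr_sumr; apply: eq_bigr => c _.
rewrite /bernstein /bump /= add1n subSS exprS.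
have H : N.+1%:R * 'C(N, c)%:R = c.+1%:R * 'C(N.+1, c.+1)%:R :> R.
  by rewrite -!natrM mul_bin_diag.
transitivity ((c.+1%:R * 'C(N.+1, c.+1)%:R) * p * (p ^+ c * (1 - p) ^+ (N - c) * g c)).
  by ring.
by rewrite -H; ring.
Qed.

Lemma bernstein_mean N p : \sum_(c < N.+1) bernstein N p c * c%:R = N%:R * p.
Proof.
case: N => [|N]; first by rewrite big_ord_recr big_ord0 /= mul0r mulr0 addr0.
have := bernstein_moment N p (fun=> 1).
under eq_bigr do rewrite mulr1.
by under [in X in _ = X -> _]eq_bigr do rewrite mulr1; rewrite bernstein_sum mulr1.
Qed.

Lemma bernstein_variance N p : 0 <= p <= 1 ->
  \sum_(c < N.+2) bernstein N.+1 p c * (c%:R / N.+1%:R - p) ^+ 2 <= N.+1%:R^-1.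
Proof.
move=> /andP[p0 p1].
have sq : \sum_(c < N.+2) bernstein N.+1 p c * c%:R ^+ 2 =
    N.+1%:R * p * (N%:R * p + 1).
  have := bernstein_moment N p (fun c => c%:R + 1).
  under [in X in _ = X -> _]eq_bigr do rewrite mulrDr mulr1.
  rewrite big_split /= bernstein_mean bernstein_sum => <-.
  apply: eq_bigr => -[[|c] hc] _ /=; first by rewrite expr0n mul0r.
  by rewrite expr2 natr1.
have N0 : N.+1%:R != 0 :> R by rewrite pnatr_eq0.
rewrite (_ : \sum_(c < N.+2) _ = p * (1 - p) / N.+1%:R).
  rewrite ler_piMl// ?invr_ge0//.
  have : 0 <= 1 - p by rewrite subr_ge0.
  by nra.
transitivity (\sum_(c < N.+2) (N.+1%:R^-2 * (bernstein N.+1 p c * c%:R ^+ 2) +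
   (- (2 * p / N.+1%:R)) * (bernstein N.+1 p c * c%:R) + p ^+ 2 * bernstein N.+1 p c)).
  by apply: eq_bigr => c _; field; rewrite addrC natr1.
rewrite !big_split /= -!mulr_sumr sq bernstein_mean bernstein_sum.
by field; rewrite addrC natr1.
Qed.

Variable k : nat.

Lemma bernstein_prod_sum N (q : 'I_k -> R) :
  \sum_(c : {ffun 'I_k -> 'I_N.+2}) \prod_j bernstein N.+1 (q j) (c j) = 1.
Proof.
rewrite -(bigA_distr_bigA (fun j i => bernstein N.+1 (q j) (i : 'I_N.+2))).
by rewrite big1// => j _; exact: bernstein_sum.
Qed.

Lemma bernstein_bound N (q : 'I_k -> R) (phi : {ffun 'I_k -> 'I_N.+2} -> R) (M : R) :
  (forall j, 0 <= q j <= 1) -> (forall c, `|phi c| <= M) ->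
  `|\sum_(c : {ffun 'I_k -> 'I_N.+2}) phi c * \prod_j bernstein N.+1 (q j) (c j)| <= M.
Proof.
move=> q01 phiM; rewrite -[leRHS]mulr1 -[X in _ <= _ * X](bernstein_prod_sum N q) mulr_sumr.
apply: (le_trans (ler_norm_sum _ _ _)); apply: ler_sum => c _.
have w0 : 0 <= \prod_j bernstein N.+1 (q j) (c j).
  by apply: prodr_ge0 => j _; exact: bernstein_ge0.
by rewrite normrM [X in _ * X]ger0_norm// ler_wpM2r.
Qed.

(** Chebyshev's inequality. A node with a coordinate at distance at least [dl] from that of [q]
    costs at most [2 * M], hence at most [2 * M / dl ^ 2] times the sum of the squared deviations,
    whose mean is at most [k / (N + 1)]. *)
Lemma bernstein_approx N (q : 'I_k -> R) (phi : {ffun 'I_k -> 'I_N.+2} -> R) (y M dl e : R) :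
  (forall j, 0 <= q j <= 1) -> 0 < dl -> 0 <= e -> 0 <= M ->
  (forall c, `|phi c| <= M) -> `|y| <= M ->
  (forall c : {ffun 'I_k -> 'I_N.+2}, (forall j, `|(c j)%:R / N.+1%:R - q j| < dl) -> `|phi c - y| <= e) ->
  `|\sum_(c : {ffun 'I_k -> 'I_N.+2}) phi c * \prod_j bernstein N.+1 (q j) (c j) - y|
    <= e + 2 * M / dl ^+ 2 * k%:R / N.+1%:R.
Proof.
move=> q01 dl0 e0 M0 phiM yM phie.
pose w (c : {ffun 'I_k -> 'I_N.+2}) := \prod_j bernstein N.+1 (q j) (c j).
have w0 c : 0 <= w c by apply: prodr_ge0 => j _; exact: bernstein_ge0.
have w1 : \sum_c w c = 1 := bernstein_prod_sum N q.
have wv i : \sum_(c : {ffun 'I_k -> 'I_N.+2}) w c * ((c i)%:R / N.+1%:R - q i) ^+ 2 <=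
    N.+1%:R^-1.
  rewrite (_ : \sum_c _ = \sum_(l < N.+2) bernstein N.+1 (q i) l *
     (l%:R / N.+1%:R - q i) ^+ 2); first exact: bernstein_variance.
  (* The factor at [i] absorbs the squared deviation; distributing the product over the sum reduces
     the mean to the one-dimensional variance, the other factors summing to 1. *)
  pose h j (l : 'I_N.+2) : R := bernstein N.+1 (q j) l *
    (if j == i then (l%:R / N.+1%:R - q i) ^+ 2 else 1).
  transitivity (\sum_(c : {ffun 'I_k -> 'I_N.+2}) \prod_j h j (c j)).
    apply: eq_bigr => c _; rewrite /h big_split /=; congr (_ * _).
    by rewrite (bigD1 i)//= eqxx big1 ?mulr1// => j /negbTE ->.
  rewrite -bigA_distr_bigA (bigD1 i)//= [X in _ * X]big1 ?mulr1.
    by apply: eq_bigr => l _; rewrite /h eqxx.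
  move=> j /negbTE ji; rewrite -[RHS](bernstein_sum N.+1 (q j)).
  by apply: eq_bigr => l _; rewrite /h ji mulr1.
have -> : y = \sum_c y * w c by rewrite -mulr_sumr w1 mulr1.
rewrite -sumrB; apply: (le_trans (ler_norm_sum _ _ _)).
apply: (@le_trans _ _ (\sum_c (e * w c + 2 * M / dl ^+ 2 *
   \sum_i w c * ((c i)%:R / N.+1%:R - q i) ^+ 2))).
  apply: ler_sum => c _; rewrite -/(w c) -mulrBl normrM (ger0_norm (w0 c)).
  rewrite -mulr_sumr mulrCA [e * _]mulrC -mulrDr mulrC ler_wpM2l//.
  have K0 : 0 <= 2 * M / dl ^+ 2 by rewrite divr_ge0 ?sqr_ge0 ?mulr_ge0.
  have S0 : 0 <= \sum_i ((c i)%:R / N.+1%:R - q i) ^+ 2.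
    by apply: sumr_ge0 => i _; exact: sqr_ge0.
  case: (pselect (forall j, `|(c j)%:R / N.+1%:R - q j| < dl)) => [h|].
    by rewrite (le_trans (phie c h))// lerDl mulr_ge0.
  move=> /existsNP[i /negP]; rewrite -leNgt => hi.
  apply: (@le_trans _ _ (2 * M)).
    by rewrite (le_trans (ler_normB _ _))// mulr_natl mulr2n lerD.
  apply: (@le_trans _ _ (2 * M / dl ^+ 2 * \sum_i ((c i)%:R / N.+1%:R - q i) ^+ 2)); last first.
    by rewrite lerDr.
  rewrite -mulrA ler_peMr ?mulr_ge0// ler_pdivlMl ?exprn_gt0// mulr1.
  rewrite (bigD1 i)//= -[leLHS]addr0 lerD//; last first.
    by apply: sumr_ge0 => j _; exact: sqr_ge0.
  rewrite -(real_normK (num_real (_ - q i))) lerXn2r// nnegrE//.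
  exact: ltW.
rewrite big_split /= -mulr_sumr w1 mulr1 lerD2l -mulr_sumr -[leRHS]mulrA ler_wpM2l//.
  by rewrite divr_ge0 ?sqr_ge0 ?mulr_ge0.
rewrite exchange_big /= -[X in X%:R / _](card_ord k) mulr_natl -sumr_const.
by apply: ler_sum => i _; exact: wv.
Qed.

End bernstein.

(** * From exponentials to polynomials, trigonometric polynomials and continuous functions *)

Section exponential_determining.
Context {d d' : measure_display} {Om : measurableType d} {Om' : measurableType d'}.
Context {R : realType} (k : nat).
Variables (P : nat -> probability Om R) (Q : probability Om' R).
Variables (Z : nat -> Om -> 'rV[R]_k) (xi : Om' -> 'rV[R]_k).
Implicit Types (a b : 'I_k -> R) (x : 'rV[R]_k).
Notation cv := (cvgE P Q Z xi).

Definition lin a x : R := \sum_j a j * x ord0 j.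

Lemma linD a b x : lin (fun j => a j + b j) x = lin a x + lin b x.
Proof. by rewrite /lin -big_split; apply: eq_bigr => j _; rewrite mulrDl. Qed.

Lemma linZ c a x : lin (fun j => c * a j) x = c * lin a x.
Proof. by rewrite /lin mulr_sumr; apply: eq_bigr => j _; rewrite mulrA. Qed.

Hypothesis Hexp : forall a, cv (fun x => expR (lin a x)).

Lemma cvgE_expZ c a : cv (fun x => expR (c * lin a x)).
Proof. by apply: cvgE_ext (Hexp (fun j => c * a j)) => x; rewrite linZ. Qed.

Lemma cvgE_weight c a : cv (fun x => expR (c * lin a x) + expR (- (c * lin a x))).
Proof.
apply: cvgED; first exact: cvgE_expZ.
by apply: cvgE_ext (cvgE_expZ (- c) a) => x; rewrite mulNr.
Qed.

Lemma cvgE1 : cv (fun=> 1).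
Proof.
apply: cvgE_ext (Hexp (fun=> 0)) => x; rewrite /lin big1 ?expR0// => j _.
by rewrite mul0r.
Qed.

Lemma cvgE_cst c : cv (fun=> c).
Proof. by apply: cvgE_ext (cvgEZ c cvgE1) => x; rewrite mulr1. Qed.

Let Sexp : set ('rV[R]_k -> R) := [set s | exists a, s = (fun x => expR (lin a x))].

Lemma multiplier_exp c a : multiplier P Q Z xi Sexp (fun x => expR (c * lin a x)).
Proof.
move=> F FS s [b ->]; have Sab : Sexp (fun x => expR (lin (fun j => c * a j + b j) x)).
  by exists (fun j => c * a j + b j).
apply: cvgE_ext (FS _ Sab) => x.
by rewrite linD linZ expRD mulrA.
Qed.

Lemma cvgE_pow a m : cv (fun x => lin a x ^+ m).
Proof.
have [C [C0 hC]] := @finite_difference_pow R m.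
apply: (cvgE_approx (cvgE_weight (m.*2).+2%:R a)) => e e0.
have C1 : 0 < C + 1 by rewrite ltr_wpDl.
pose h := Num.min 1 (e / (C + 1)).
have h0 : 0 < h by rewrite lt_min ltr01 divr_gt0.
have h1 : h <= 1 by rewrite ge_min lexx.
have he : h * C <= e.
  apply: (@le_trans _ _ (h * (C + 1))); first by rewrite ler_wpM2l ?lerDl// ltW.
  by rewrite -ler_pdivlMr// ge_min lexx orbT.
exists (fun x => ((expR (h * lin a x) - 1) / h) ^+ m).
  apply: (@multiplier_cvgE _ _ _ _ _ _ P Q Z xi Sexp).
  - by move=> s [b ->].
  - exists (fun=> 0); apply/funext => x; rewrite /lin big1 ?expR0// => j _.
    by rewrite mul0r.
  - apply: multiplierX; apply: multiplierM; last exact: multiplier_cst.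
    by apply: multiplierD; [exact: multiplier_exp|exact: multiplier_cst].
move=> x; rewrite distrC (le_trans (hC _ _ h0 h1))// mulrA.
apply: ler_pM => //; rewrite ?mulr_ge0 ?(ltW h0) ?expR_ge0//.
exact: expRM_norm_le.
Qed.

(** Since [(2 * |z|) ^ n <= n! * expR (2 * |z|)], the remainder of rank [n] is at most
    [expR (3 * |z|) / 2 ^ n]: the cosine series converges uniformly relative to an exponential
    weight, and its partial sums are polynomials. *)
Lemma cvgE_cos a th : cv (fun x => cos (lin a x + th)).
Proof.
apply: (cvgE_approx (cvgE_weight 3%:R a)) => e e0.
set D := expR (3 * `|th|).
have D0 : 0 < D by exact: expR_gt0.
have [n hn] : exists n, D * 2^-1 ^+ n <= e.
  have eD : 0 < e / D by rewrite divr_gt0.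
  have /cvgrPdist_lt/(_ _ eD) : (fun n => 2^-1 ^+ n : R) @ \oo --> (0 : R).
    by apply: cvg_expr; rewrite ger0_norm// invf_lt1// ltr1n.
  case=> n _ /(_ n (leqnn n)) /=; rewrite sub0r normrN ger0_norm ?exprn_ge0// => h.
  by exists n; rewrite mulrC -ler_pdivlMr// ltW.
have [c hc] := @cos_tail R n.
exists (fun x => \sum_(i < n) c i * (lin a x + th) ^+ i).
  apply: cvgE_sum; first exact: cvgE_cst.
  move=> i; apply: cvgEZ.
  under eq_fun do rewrite exprDn.
  apply: cvgE_sum; first exact: cvgE_cst.
  move=> j; apply: cvgE_ext (cvgEZ (th ^+ j *+ 'C(i, j)) (cvgE_pow a (i - j))) => x.
  by rewrite -mulrnAr mulrC.
move=> x; apply: (le_trans (hc _)).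
set z := lin a x + th.
apply: (@le_trans _ _ (2^-1 ^+ n * expR (3 * `|z|))).
  have := @expr_le_expR R (2 * `|z|) n; rewrite mulr_ge0// => /(_ isT).
  rewrite exprMn => h; have f0 : 0 < n`!%:R :> R by rewrite ltr0n fact_gt0.
  rewrite (_ : 3 * `|z| = 2 * `|z| + `|z|); last by ring.
  rewrite expRD mulrA ler_wpM2r ?expR_ge0// ler_pdivrMr// exprVn mulrC.
  by rewrite mulrCA ler_pdivlMl ?exprn_gt0// [leRHS]mulrC.
apply: (@le_trans _ _ (2^-1 ^+ n * (expR (3 * `|lin a x|) * D))).
  rewrite ler_wpM2l ?exprn_ge0// /D -expRD ler_expR -mulrDr ler_wpM2l//.
  exact: ler_normD.
rewrite [leLHS](_ : _ = (D * 2^-1 ^+ n) * expR (3 * `|lin a x|)); last by ring.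
apply: ler_pM; rewrite ?mulr_ge0 ?exprn_ge0 ?expR_ge0 ?(ltW D0)//.
exact: expRM_norm_le.
Qed.

Let Scos : set ('rV[R]_k -> R) :=
  [set s | exists a th, s = (fun x => cos (lin a x + th))].

(** Product-to-sum formula. Allowing a phase [th] makes the family contain the sines and keeps
    products within its linear combinations. *)
Lemma multiplier_cos a th : multiplier P Q Z xi Scos (fun x => cos (lin a x + th)).
Proof.
move=> F FS s [b [ph ->]].
have S1 : Scos (fun x => cos (lin (fun j => a j + b j) x + (th + ph))).
  by exists (fun j => a j + b j), (th + ph).
have S2 : Scos (fun x => cos (lin (fun j => a j + - 1 * b j) x + (th - ph))).
  by exists (fun j => a j + -1 * b j), (th - ph).
apply: cvgE_ext (cvgEZ 2^-1 (cvgED (FS _ S1) (FS _ S2))) => x.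
rewrite linD (linD a) linZ mulN1r.
rewrite (_ : lin a x + lin b x + _ = (lin a x + th) + (lin b x + ph)); last by ring.
rewrite (_ : lin a x - lin b x + _ = (lin a x + th) - (lin b x + ph)); last by ring.
by rewrite cosD cosB; field.
Qed.

Lemma multiplier_cos_cvgE h : multiplier P Q Z xi Scos h -> cv h.
Proof.
apply: multiplier_cvgE.
  by move=> s [a [th ->]]; exact: cvgE_cos.
exists (fun=> 0), 0; apply/funext => x; rewrite /lin big1 ?addr0 ?cos0// => j _.
by rewrite mul0r.
Qed.

Lemma multiplier_sin c j : multiplier P Q Z xi Scos (fun x => sin (c * x ord0 j)).
Proof.
apply: multiplier_ext (multiplier_cos (fun i => c * (i == j)%:R) (- (pi / 2))) => x.
rewrite cosBpihalf; congr sin; rewrite linZ; congr (_ * _).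
rewrite /lin (bigD1 j)//= eqxx mul1r big1 ?addr0// => i /negbTE ->.
by rewrite mul0r.
Qed.

Lemma cvgE_coord_weight c :
  cv (fun x => 1 + \sum_j (expR (c * x ord0 j) + expR (- (c * x ord0 j)))).
Proof.
apply: cvgED; first exact: cvgE1.
apply: cvgE_sum; first exact: cvgE_cst.
move=> j; apply: cvgE_ext (cvgE_weight c (fun i => (i == j)%:R)) => x.
suff -> : lin (fun i => (i == j)%:R) x = x ord0 j by [].
rewrite /lin (bigD1 j)//= eqxx mul1r big1 ?addr0// => i /negbTE ->.
by rewrite mul0r.
Qed.

Lemma rV_norm_le x (r : R) : 0 <= r -> (forall j, `|x ord0 j| <= r) -> `|x| <= r.
Proof.
move=> r0 h; rewrite [`|x|]mx_normrE; apply: bigmax_le => // -[i j] _ /=.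
by rewrite ord1.
Qed.

Lemma rV_coord_le x (j : 'I_k) : `|x ord0 j| <= `|x|.
Proof.
rewrite [leRHS]mx_normrE.
exact: (@le_bigmax _ _ _ (0 : R) (fun ij : 'I_1 * 'I_k => `|x ij.1 ij.2|) (ord0, j)).
Qed.

(* Bernstein polynomials in sin (x_j / r) are trigonometric polynomials; on the
   ball of radius r they approximate f, outside of it the exponential weight
   dominates. *)
Lemma cvgE_bounded (f : 'rV[R]_k -> R) (M : R) :
  continuous f -> (forall x, `|f x| <= M) -> cv f.
Proof.
move=> cf fM.
have M0 : 0 <= M := le_trans (normr_ge0 _) (fM 0).
pose W x : R := 1 + \sum_j (expR (1 * x ord0 j) + expR (- (1 * x ord0 j))).
apply: (cvgE_approx (cvgE_coord_weight 1 : cv W)) => e e0.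
have W1 x : 1 <= W x.
  by rewrite /W lerDl sumr_ge0// => j _; rewrite addr_ge0// expR_ge0.
(* Outside of the ball of this radius some coordinate exceeds [r] in absolute value, and
   [W x >= expR |x_j| >= r >= 2 * M / e]: two functions bounded by [M] are then within [e * W x] of
   each other. *)
pose r : R := 2 * M / e + 1.
have r0 : 0 < r by rewrite ltr_wpDl// divr_ge0 ?mulr_ge0// ltW.
have Wr x : ~ (`|x| <= r) -> 2 * M <= e * W x.
  move=> xr; have [j hj] : exists j, r < `|x ord0 j|.
    apply: contrapT => /forallNP h; apply: xr; apply: rV_norm_le; first exact: ltW.
    by move=> j; rewrite leNgt; apply/negP/h.
  rewrite [leRHS]mulrC -ler_pdivrMr//; apply: (@le_trans _ _ r); first by rewrite lerDl.
  apply: (@le_trans _ _ (expR (1 * x ord0 j) + expR (- (1 * x ord0 j)))).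
    rewrite mul1r (le_trans (ltW hj))// (le_trans _ (expR_norm_le _))//.
    by rewrite (le_trans _ (expR_ge1Dx _))// lerDr.
  by rewrite /W (bigD1 j)//= addrCA lerDl addr_ge0// sumr_ge0.
pose K : set 'rV[R]_k := [set x | `|x| <= r].
have cK : compact K.
  apply: bounded_closed_compact.
    by exists r; split; [exact: num_real|move=> s rs x /= /le_trans; apply; exact: ltW].
  apply: (@preimage_closed _ _ (fun x : 'rV[R]_k => `|x|) [set s | s <= r]).
    by move=> x _; exact: norm_continuous.
  exact: closed_le.
have e20 : 0 < e / 2 by rewrite divr_gt0.
have [dl dl0 hdl] := compact_unif_continuous cK (fun x _ => cf x) e20.
(* On the ball [|x_j / r| <= 1 < pi / 2], so [sin (x_j / r)] stays in [[- sin 1, sin 1]], inside the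
   open interval []- 1, 1[] where [asin] is continuous, and [asin] recovers [x_j / r]. *)
have pi1 : 1 < pi / 2 :> R.
  by have := @pihalf_ge1 R; rewrite le_eqVlt => /predU1P[E|//];
     have := @cos_pihalf R; rewrite -E => c1; have := @cos1_gt0 R; rewrite c1 ltxx.
have s1 : sin 1 < 1 :> R.
  rewrite -[ltRHS]sin_pihalf ltr_sin//; rewrite in_itv/=; apply/andP; split; lra.
have s0 : 0 < sin 1 :> R by apply: sin_gt0_pihalf; rewrite ltr01.
have dlr : 0 < dl / (2 * r) by rewrite divr_gt0// mulr_gt0.
have casin z : `[- sin 1, sin 1]%classic z -> {for z, continuous (@asin R)}.
  rewrite /= in_itv/= => /andP[z1 z2]; apply: continuous_asin.
  by apply/andP; split; lra.
have [et et0 het] :=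
  compact_unif_continuous (@segment_compact R (- sin 1) (sin 1)) casin dlr.
pose u j x := (1 + sin (r^-1 * x ord0 j)) / 2.
have mu' j : multiplier P Q Z xi Scos (u j).
  apply: multiplierM; last exact: multiplier_cst.
  by apply: multiplierD; [exact: multiplier_cst|exact: multiplier_sin].
have u01 j x : 0 <= u j x <= 1.
  have := sin_max (r^-1 * x ord0 j); rewrite ler_norml /u => /andP[? ?].
  by apply/andP; split; lra.
have [N hN] : exists N, 2 * M / (et / 2) ^+ 2 * k%:R / N.+1%:R <= e / 2.
  set A := 2 * M / (et / 2) ^+ 2 * k%:R.
  have A0 : 0 <= A by rewrite mulr_ge0// divr_ge0 ?sqr_ge0 ?mulr_ge0.
  have A1 : 0 < A + 1 by rewrite ltr_wpDl.
  have q0 : 0 < e / 2 / (A + 1) by exact: divr_gt0.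
  have /cvgrPdist_lt/(_ _ q0) := @cvg_harmonic R.
  case=> N _ /(_ N (leqnn N)) /=; rewrite sub0r normrN ger0_norm// => h; exists N.
  apply: (@le_trans _ _ ((A + 1) / N.+1%:R)); first by rewrite ler_wpM2r// lerDl.
  by rewrite mulrC -ler_pdivlMr// ltW.
(* The point whose image under [u] has coordinates [c j / (N + 1)], so that [g] is the Bernstein
   polynomial of [f] read in the variables [u]. *)
pose node (c : {ffun 'I_k -> 'I_N.+2}) : 'rV[R]_k :=
  \row_j (r * asin (2 * ((c j)%:R / N.+1%:R) - 1)).
pose g x := \sum_(c : {ffun 'I_k -> 'I_N.+2})
  f (node c) * \prod_j bernstein N.+1 (u j x) (c j).
exists g.
  apply: multiplier_cos_cvgE; apply: multiplier_sum => c.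
  apply: multiplierZ; apply: multiplier_prod => j.
  apply: multiplierM; last first.
    apply: multiplierX; apply: multiplier_ext (multiplierD (multiplier_cst 1)
      (multiplierZ (-1) (mu' j))) => x; by rewrite mulN1r.
  by apply: multiplierZ; exact: multiplierX.
move=> x.
have gM : `|g x| <= M by exact: bernstein_bound.
have [xr|xr] := pselect (`|x| <= r); last first.
  apply: (le_trans _ (Wr x xr)); apply: (le_trans (ler_normB _ _)).
  by rewrite mulr_natl mulr2n lerD.
apply: (@le_trans _ _ e); last by rewrite ler_peMr// ltW.
rewrite distrC [leRHS]splitr.
apply: (le_trans (@bernstein_approx R k N (u^~ x) (fun c => f (node c)) (f x) M
  (et / 2) (e / 2) _ _ _ _ _ _ _)) => //.
- by rewrite divr_gt0.
- exact: ltW.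
- move=> c hc; rewrite distrC ltW//; apply: hdl => //.
  apply: (@le_lt_trans _ _ (dl / 2)); last by rewrite ltr_pdivrMr// ltr_pMr// ltr1n.
  apply: rV_norm_le; first by rewrite divr_ge0// ltW.
  move=> j; rewrite !mxE.
  have xj : `|r^-1 * x ord0 j| <= 1.
    rewrite normrM gtr0_norm ?invr_gt0// ler_pdivrMl// mulr1.
    exact: le_trans (rV_coord_le x j) xr.
  have Kx : `[- sin 1, sin 1]%classic (sin (r^-1 * x ord0 j)).
    move: xj; rewrite ler_norml /= in_itv/= -sinN => /andP[x1 x2].
    have sin_le (y z : R) : - 1 <= y -> y <= z -> z <= 1 -> sin y <= sin z.
      rewrite [y <= z]le_eqVlt => y1 /predU1P[-> //|yz] z1; rewrite ltW// ltr_sin//;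
        rewrite in_itv/=; apply/andP; split; lra.
    by apply/andP; split; apply: sin_le => //; lra.
  have := het _ (2 * ((c j)%:R / N.+1%:R) - 1) Kx.
  rewrite sinK; last first.
    by move: xj; rewrite ler_norml in_itv/= => /andP[x1 x2]; apply/andP; split; lra.
  have hcj : `|sin (r^-1 * x ord0 j) - (2 * ((c j)%:R / N.+1%:R) - 1)| < et.
    have := hc j; rewrite /u; move: (_ / N.+1%:R) => v.
    by rewrite !ltr_distl => /andP[h1 h2]; apply/andP; split; lra.
  move=> /(_ hcj) h.
  rewrite -[x ord0 j](mulVKf (lt0r_neq0 r0)) -mulrBr normrM (gtr0_norm r0).
  rewrite -ler_pdivlMl//; apply: (le_trans (ltW h)).
  by rewrite invfM mulrCA mulrC [r^-1 * _]mulrC -mulrA mulrC; lra.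
- by rewrite lerD2l.
Qed.

(** Truncation at level [1 / e] changes [f] only where [|f| > 1 / e], and there by at most
    [|f| <= e * f ^ 2 <= e * W]. It carries the convergence from bounded functions to monomials. *)
Lemma cvgE_growth (f W : 'rV[R]_k -> R) :
  continuous f -> cv W -> (forall x, f x ^+ 2 <= W x) -> cv f.
Proof.
move=> cf cW fW; apply: (cvgE_approx cW) => e e0.
pose A : R := e^-1.
have A0 : 0 < A by rewrite invr_gt0.
have AA : - A <= A by rewrite ge0_cp// ltW.
pose g x := clamp (- A) A (f x).
exists g.
  apply: (@cvgE_bounded g A).
    move=> x; apply: (@continuous_comp _ _ _ f (clamp (- A) A)); first exact: cf.
    exact: continuous_clamp.
  by move=> x; rewrite /g ler_norml clamp_itv.
move=> x; apply: (@le_trans _ _ (e * f x ^+ 2)); last by rewrite ler_pM2l.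
have [fA|fA] := leP `|f x| A.
  rewrite /g clamp_id -?ler_norml// subrr normr0.
  by rewrite mulr_ge0 ?sqr_ge0 ?ltW.
apply: (@le_trans _ _ `|f x|).
  exact/clampB_le/ltW.
rewrite -(real_normK (num_real (f x))) expr2 mulrA ler_peMl//.
by rewrite -ler_pdivrMl// mulr1 ltW.
Qed.

End exponential_determining.

(** * Gaussian vectors *)

Section gaussian.
Context {R : realType}.

Lemma normal_mgf (s a : R) : s != 0 ->
  (\int[normal_prob 0 s]_x (expR (a * x))%:E)%E = (expR (a ^+ 2 * s ^+ 2 / 2))%:E.
Proof.
move=> s0.
have mexp : measurable_fun setT (fun x : R => expR (a * x)).
  by apply: measurableT_comp => //; apply: measurable_funM.
rewrite (@integral_density _ _ R (normal_prob 0 s) lebesgue_measure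
  (normal_pdf 0 s)) //; last 2 first.
- exact: measurable_normal_pdf.
- by move=> x; exact: normal_pdf_ge0.
(* Completing the square: the exponential factor shifts the mean from 0 to [a * s ^ 2]. *)
have E x : expR (a * x) * normal_pdf 0 s x =
    expR (a ^+ 2 * s ^+ 2 / 2) * normal_pdf (a * s ^+ 2) s x.
  rewrite !normal_pdfE// mulrCA [RHS]mulrCA; congr (_ * _).
  rewrite /normal_fun -!expRD; congr expR.
  by field.
under eq_integral => x _ do rewrite E EFinM.
rewrite ge0_integralZl//=.
- by rewrite integral_normal_pdf mule1.
- by apply/measurable_EFinP; exact: measurable_normal_pdf.
- by move=> x _; rewrite lee_fin normal_pdf_ge0.
Qed.

Lemma gaussian_vector_mgf {d : measure_display} {Om : measurableType d}
    (Q : probability Om R) k (xi : 'I_k -> Om -> R) (s a : 'I_k -> R) :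
  (forall j, s j != 0) ->
  (forall j, measurable_fun setT (xi j)) ->
  (forall B : 'I_k -> set R, (forall j, measurable (B j)) ->
     Q [set w | forall j, B j (xi j w)] =
     (\prod_(j < k) fine (normal_prob 0 (s j) (B j)))%:E) ->
  (\int[Q]_w (expR (\sum_j a j * xi j w))%:E)%E =
  (expR (\sum_j a j ^+ 2 * s j ^+ 2 / 2))%:E.
Proof.
move=> s0 mxi QB; under eq_integral do rewrite expR_sum.
rewrite (@integral_prod_indep _ _ _ Q _ (measurableTypeR R) _ xi (fun j => normal_prob 0 (s j))
  (fun j x => expR (a j * x)) (fun j => expR (a j ^+ 2 * s j ^+ 2 / 2)))//.
- by rewrite expR_sum.
- by move=> j B mB; exact: fin_num_measure.
- by move=> j; apply: measurableT_comp => //; apply: measurable_funM.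
- by move=> j; exact: normal_mgf.
Qed.

End gaussian.

(** * Compensated Poisson integrals *)

Section calculus.
Context {R : realType}.
Implicit Types (f g F : R -> R) (a b u v s : R).

(** [u] and [v] may come in either order, and the intermediate point is located relative to [u], as
    a second application in [taylor2] requires. *)
Lemma MVT_between f df a b u v : a <= u <= b -> a <= v <= b ->
  (forall x, a <= x <= b -> is_derive x 1 f (df x)) ->
  exists2 c, [/\ a <= c <= b & `|c - u| <= `|v - u|] & f v - f u = df c * (v - u).
Proof.
have key x y : a <= x <= b -> a <= y <= b -> x <= y ->
    (forall x, a <= x <= b -> is_derive x 1 f (df x)) ->
    exists2 c, x <= c <= y & f y - f x = df c * (y - x).
  move=> /andP[ax xb] /andP[ay yb] xy dff.
  have sub z : x <= z <= y -> a <= z <= b.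
    by move=> /andP[h1 h2]; rewrite (le_trans ax h1) (le_trans h2 yb).
  have [||c] := @MVT_segment R f df x y xy.
  - move=> z; rewrite in_itv/= => /andP[h1 h2]; apply: dff; apply: sub.
    by rewrite !ltW.
  - apply: derivable_within_continuous => z; rewrite in_itv/= => /sub h.
    by have [] := dff _ h.
  by rewrite in_itv/= => h E; exists c.
move=> hu hv dff; have [uv|vu] := leP u v.
  have [c /andP[c1 c2] E] := key u v hu hv uv dff; exists c => //; split.
    by move/andP: hu => [? _]; move/andP: hv => [_ ?]; apply/andP; split; lra.
  by rewrite !ger0_norm; lra.
have [c /andP[c1 c2] E] := key v u hv hu (ltW vu) dff; exists c.
  split; last by rewrite !ler0_norm; lra.
  by move/andP: hv => [? _]; move/andP: hu => [_ ?]; apply/andP; split; lra.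
by rewrite -opprB E -mulrN opprB.
Qed.

(** The mean value theorem is applied to [f] minus its quadratic polynomial at [u], then to [f1].
    With two derivatives only, the remainder is measured by the oscillation [w] of the second
    one. *)
Lemma taylor2 f f1 f2 a b u v (w : R) : a <= u <= b -> a <= v <= b ->
  (forall x, a <= x <= b -> is_derive x 1 f (f1 x)) ->
  (forall x, a <= x <= b -> is_derive x 1 f1 (f2 x)) ->
  (forall x, a <= x <= b -> `|x - u| <= `|v - u| -> `|f2 x - f2 u| <= w) ->
  `|f v - f u - (v - u) * f1 u - (v - u) ^+ 2 / 2 * f2 u| <= w * (v - u) ^+ 2.
Proof.
move=> hu hv d1 d2 hw.
pose phi x := f x - (f1 u * x + f2 u / 2 * (x - u) ^+ 2).
have dphi x : a <= x <= b -> is_derive x 1 phi (f1 x - (f1 u + f2 u * (x - u))).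
  move=> hx; have := d1 x hx => df; rewrite /phi.
  by apply: is_derive_eq; rewrite /GRing.scale /=; field.
have [c [hc cu] E] := MVT_between hu hv dphi.
have [e [he eu] E'] := MVT_between hu hc d2.
have -> : f v - f u - (v - u) * f1 u - (v - u) ^+ 2 / 2 * f2 u = phi v - phi u.
  by rewrite /phi; field.
rewrite E (_ : f1 c - _ = (f2 e - f2 u) * (c - u)); last first.
  by rewrite mulrBl -E'; ring.
have w0 : 0 <= w.
  by have := hw u hu; rewrite !subrr normr0; apply.
rewrite !normrM -mulrA -(real_normK (num_real (v - u))).
apply: ler_pM; rewrite ?mulr_ge0//; first by apply: hw => //; exact: le_trans cu.
by rewrite expr2 ler_wpM2r.
Qed.

Notation mu := (@lebesgue_measure R).

Lemma FTC_shift F f a b s : a < b -> continuous f ->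
  (forall u, a - s <= u <= b - s -> is_derive u 1 F (f u)) ->
  \int[mu]_(t in `]a, b]) f (t - s) = F (b - s) - F (a - s).
Proof.
move=> ab cf dF.
have csh : continuous (fun t => f (t - s)).
  move=> t; apply: (@continuous_comp _ _ _ (fun t => t - s) f); last exact: cf.
  by apply: cvgB; [exact: cvg_id|exact: cvg_cst].
have dG t : a <= t <= b -> is_derive t 1 (fun t => F (t - s)) (f (t - s)).
  move=> /andP[h1 h2]; have dFt := dF (t - s) _.
  have {}dFt : is_derive (t - s) 1 F (f (t - s)) by apply: dFt; rewrite !lerD2r h1.
  have dsh : is_derive t 1 (fun t => t - s) 1.
    by apply: is_derive_eq; rewrite subr0.
  by have := @is_derive1_comp R F (fun t => t - s) t _ _ dFt dsh; rewrite mulr1.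
have cG : {within `[a, b], continuous (fun t => F (t - s))}.
  apply: derivable_within_continuous => t; rewrite in_itv/= => /dG[].
  by [].
have := @continuous_FTC2 R (fun t => f (t - s)) (fun t => F (t - s)) a b ab
  (continuous_subspaceT csh).
move/(continuous_within_itvP _ ab) : cG => [_ c1 c2].
move=> /(_ _ _)H; rewrite Rintegral_itv_obnd_cbnd; last exact: continuous_integrable.
rewrite /Rintegral H//.
  by split => // t; rewrite in_itv/= => /andP[h1 h2]; have [] := dG t; rewrite ?ltW.
move=> t; rewrite in_itv/= => /andP[h1 h2].
have [] := dG t; first by rewrite !ltW.
by rewrite derive1E.
Qed.

Lemma antiderivative f a b : continuous f ->
  exists F, forall u, a <= u <= b -> is_derive u 1 F (f u).
Proof.
(* Integrating from [a - 1] makes [a] an interior point, so that the derivative there is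
   two-sided. *)
move=> cf; exists (fun x => \int[mu]_(t in `[a - 1, x]) f t) => u /andP[au ub].
have ub1 : u < b + 1 by rewrite (le_lt_trans ub)// ltrDl.
have [] := @continuous_FTC1_closed R f (a - 1) u (b + 1) ub1 _ _ (cf u).
- apply: continuous_compact_integrable; first exact: segment_compact.
  exact: continuous_subspaceT.
- by rewrite ltrBlDr (le_lt_trans au)// ltrDl.
move=> h1 h2; split => //; by rewrite -derive1E.
Qed.

End calculus.

(** * Moment generating functions of compensated integrals *)

Section poisson_observation.
Context {d : measure_display} {Om : measurableType d} {R : realType}.
Variable T : R.
Hypothesis T0 : 0 < T.
Notation mu := (@lebesgue_measure R).
Implicit Types (P : probability Om R) (Y : Om -> seq R) (m f : R -> R).

(* The law of the process enters only through its Laplace functional. *)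
Definition poisson_obs P Y m : Prop :=
  (forall f, continuous f -> measurable_fun setT (fun w => pint T f (Y w))) /\
  (forall f, continuous f ->
     (\int[P]_w (expR (pint T f (Y w)))%:E)%E =
     (expR (\int[mu]_(t in `]0, T]) ((expR (f t) - 1) * m t)))%:E).

Lemma poisson_model_obs P k (X : 'I_k -> Om -> seq R) (m : 'I_k -> R -> R) j :
  (forall j, continuous (m j)) -> (forall j t, 0 < t <= T -> 0 <= m j t) ->
  poisson_model P X m T -> poisson_obs P (X j) (m j).
Proof.
move=> cm m0 PX; split; first by move=> f cf; exact: measurable_pint PX _ _ cf.
(* The other processes are tested against 0, so that they drop out of the joint Laplace
   functional. *)
move=> f cf; pose g i := if i == j then f else fun=> 0.
have cg i : continuous (g i).
  by rewrite /g; case: eqP => // _; exact: cst_continuous.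
have := poisson_mgf T0 cm m0 PX cg.
have -> : \sum_i \int[mu]_(t in `]0, T]) ((expR (g i t) - 1) * m i t) =
    \int[mu]_(t in `]0, T]) ((expR (f t) - 1) * m j t).
  rewrite (bigD1 j)//= /g eqxx big1 ?addr0// => i /negbTE ->.
  rewrite (@Rintegral_itv_eq _ _ (fun=> 0)); last by move=> t _; rewrite expR0 subrr mul0r.
  by rewrite Rintegral_itv_cst ?mul0r// ltW.
move=> <-; apply: eq_integral => w _; congr (expR _)%:E.
rewrite (bigD1 j)//= /g eqxx big1 ?addr0// => i /negbTE ->.
by rewrite /pint big1.
Qed.

Lemma continuousM_fun f m : continuous f -> continuous m ->
  continuous (fun t => f t * m t).
Proof. by move=> cf cm t; apply: cvgM; [exact: cf|exact: cm]. Qed.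

Lemma continuousZ_fun (c : R) f : continuous f -> continuous (fun t => c * f t).
Proof. by move=> cf t; apply: cvgM; [exact: cvg_cst|exact: cf]. Qed.

Lemma continuous_expR_fun f : continuous f -> continuous (fun t => expR (f t)).
Proof.
move=> cf t; apply: (@continuous_comp _ _ _ f expR); first exact: cf.
exact: continuous_expR.
Qed.

Section one_observation.
Variables (P : probability Om R) (Y : Om -> seq R) (m : R -> R).
Hypothesis cm : continuous m.
Hypothesis PY : poisson_obs P Y m.

Definition centered f w : R := pint T f (Y w) - \int[mu]_(t in `]0, T]) (f t * m t).

Lemma measurable_centered f : continuous f -> measurable_fun setT (centered f).
Proof. by move=> cf; apply: measurable_funB => //; exact: PY.1. Qed.

Lemma centered_mgf f (z : R) : continuous f ->
  (\int[P]_w (expR (z * centered f w))%:E)%E =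
  (expR (\int[mu]_(t in `]0, T]) ((expR (z * f t) - 1 - z * f t) * m t)))%:E.
Proof.
move=> cf; have cz := continuousZ_fun (c := z) cf.
have ce := continuous_expR_fun cz.
have ce1 : continuous (fun t => expR (z * f t) - 1).
  by move=> t; apply: cvgB; [exact: ce|exact: cvg_cst].
set I := \int[mu]_(t in `]0, T]) (f t * m t).
have E w : expR (z * centered f w) =
    expR (- (z * I)) * expR (pint T (fun t => z * f t) (Y w)).
  by rewrite -expRD /centered -/I pintZ; congr expR; ring.
under eq_integral do rewrite E EFinM.
rewrite ge0_integralZl//=; first last.
- apply/measurable_EFinP; apply: measurableT_comp => //; exact: PY.1.
rewrite PY.2// -EFinM -expRD; congr (expR _)%:E.
have -> : \int[mu]_(t in `]0, T]) ((expR (z * f t) - 1 - z * f t) * m t) =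
    \int[mu]_(t in `]0, T]) ((expR (z * f t) - 1) * m t) -
    \int[mu]_(t in `]0, T]) (z * (f t * m t)).
  rewrite -Rintegral_itv_subf//; last 2 first.
  - exact: continuousM_fun.
  - by apply: continuousZ_fun; exact: continuousM_fun.
  by apply: Rintegral_itv_eq => t _; ring.
rewrite Rintegral_itv_scale; last exact: continuousM_fun.
by rewrite addrC.
Qed.

Lemma integrable_centered_exp f (z : R) : continuous f ->
  P.-integrable setT (fun w => (expR (z * centered f w))%:E).
Proof.
move=> cf; apply/integrableP; split.
  apply/measurable_EFinP; apply: measurableT_comp => //.
  by apply: measurable_funM => //; exact: measurable_centered.
under eq_integral do rewrite gee0_abs ?lee_fin ?expR_ge0//.
by rewrite centered_mgf// ltry.
Qed.

Lemma centered_Rmgf f (z : R) : continuous f ->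
  \int[P]_w (expR (z * centered f w)) =
  expR (\int[mu]_(t in `]0, T]) ((expR (z * f t) - 1 - z * f t) * m t)).
Proof. by move=> cf; rewrite /Rintegral centered_mgf. Qed.

End one_observation.

Lemma centeredZ Y m f (z : R) w : continuous f -> continuous m ->
  z * centered Y m f w = centered Y m (fun t => z * f t) w.
Proof.
move=> cf cm; rewrite /centered pintZ mulrBr; congr (_ - _).
rewrite -Rintegral_itv_scale; last exact: continuousM_fun.
by apply: Rintegral_itv_eq => t _; rewrite mulrA.
Qed.

Lemma joint_centered_mgf P k (X : 'I_k -> Om -> seq R) (m f : 'I_k -> R -> R) :
  (forall j, continuous (m j)) -> (forall j t, 0 < t <= T -> 0 <= m j t) ->
  (forall j, continuous (f j)) -> poisson_model P X m T ->
  (\int[P]_w (expR (\sum_j centered (X j) (m j) (f j) w))%:E)%E =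
  (expR (\sum_j \int[mu]_(t in `]0, T]) ((expR (f j t) - 1 - f j t) * m j t)))%:E.
Proof.
move=> cm m0 cf PX; pose I j := \int[mu]_(t in `]0, T]) (f j t * m j t).
have E w : expR (\sum_j centered (X j) (m j) (f j) w) =
    expR (- \sum_j I j) * expR (\sum_j pint T (f j) (X j w)).
  by rewrite -expRD /centered sumrB addrC.
under eq_integral do rewrite E EFinM.
rewrite ge0_integralZl//=; last first.
  apply/measurable_EFinP; apply: measurableT_comp => //.
  apply: measurable_sum => j; exact: measurable_pint PX _ _ (cf j).
rewrite (poisson_mgf T0 cm m0 PX cf) -EFinM -expRD; congr (expR _)%:E.
rewrite addrC -sumrB; apply: eq_bigr => j _; rewrite /I.
have ce : continuous (fun t => expR (f j t) - 1).
  by move=> t; apply: cvgB; [exact: (continuous_expR_fun (cf j))|exact: cvg_cst].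
rewrite -Rintegral_itv_subf; [|exact: continuousM_fun|exact: continuousM_fun].
by apply: Rintegral_itv_eq => t _; ring.
Qed.

Lemma poisson_model_ext P k (X : 'I_k -> Om -> seq R) (m m' : 'I_k -> R -> R) :
  (forall j t, 0 < t <= T -> m j t = m' j t) ->
  poisson_model P X m T -> poisson_model P X m' T.
Proof.
move=> mm' [mX PX]; split=> // N J a b c hab sep; rewrite PX//.
apply: eq_bigr => i _; congr (pois _ _); apply: Rintegral_itv_eq => t /andP[at_ tb].
have [a0 [_ bT]] := hab i.
by apply: mm'; rewrite (le_lt_trans a0 at_) (le_trans tb bT).
Qed.

Lemma measurable_ge_set (S : Om -> R) (y : R) : measurable_fun setT S ->
  measurable [set w | (y <= S w)%R].
Proof.
move=> mS; rewrite -[X in measurable X]setTI.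
have -> : [set w | (y <= S w)%R] = S @^-1` `[y, +oo[%classic.
  by apply/seteqP; split => w /=; rewrite in_itv/= andbT.
exact: mS.
Qed.

Lemma measure_bigsetU_le P (I : Type) (r : seq I) (E : I -> set Om) (b : I -> R) :
  (forall i, measurable (E i)) -> (forall i, (P (E i) <= (b i)%:E)%E) ->
  measurable (\big[setU/set0]_(i <- r) E i) /\
  (P (\big[setU/set0]_(i <- r) E i) <= (\sum_(i <- r) b i)%:E)%E.
Proof.
move=> mE hE; elim: r => [|i r [mI hI]].
  by rewrite !big_nil measure0; split; [exact: measurable0|exact: lexx].
rewrite !big_cons; split; first exact: measurableU.
apply: (le_trans (measureU2 _ (mE i) mI)).
by rewrite EFinD; apply: leeD; [exact: hE|exact: hI].
Qed.

(** Markov's inequality for [expR S]; the exponent to be optimised is part of [S]. *)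
Lemma chernoff P (S : Om -> R) (y : R) : measurable_fun setT S ->
  (P [set w | (y <= S w)%R] <= (expR (- y))%:E * \int[P]_w (expR (S w))%:E)%E.
Proof.
move=> mS.
have mA := measurable_ge_set y mS.
have mE : measurable_fun setT (fun w => (expR (S w))%:E).
  by apply/measurable_EFinP; exact: measurableT_comp.
rewrite -ge0_integralZl//=.
rewrite -[X in P X]setIT -integral_indic//.
apply: ge0_le_integral => //=.
- by apply/measurable_EFinP; exact: measurable_indic.
- by apply: emeasurable_funM.
- move=> w _; rewrite -EFinM -expRD lee_fin indicE.
  have [/set_mem /= h|_] := boolP (w \in [set w | (y <= S w)%R]); last exact: expR_ge0.
  by rewrite -expR0 ler_expR; lra.
Qed.

End poisson_observation.

Lemma continuous_sqr {R : realType} (g : R -> R) :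
  continuous g -> continuous (fun t => g t ^+ 2).
Proof.
move=> cg t; apply: (@continuous_comp _ _ _ g (fun x => x ^+ 2)); first exact: cg.
exact: exprn_continuous.
Qed.

(** * Exponential deviations and variance of compensated integrals *)

Section deviation.
Context {d : measure_display} {Om : measurableType d} {R : realType}.
Variable T : R.
Hypothesis T0 : 0 < T.
Notation mu := (@lebesgue_measure R).
Implicit Types (P : probability Om R) (Y : Om -> seq R) (m f : R -> R).

Lemma cumulant_bound f m (z Cf L n : R) : continuous f -> continuous m ->
  0 <= Cf -> 0 <= n -> 0 <= L -> `|z| <= 1 ->
  (forall t, 0 < t <= T -> `|f t| <= Cf) ->
  (forall t, 0 < t <= T -> 0 <= m t <= n * L) ->
  \int[mu]_(t in `]0, T]) ((expR (z * f t) - 1 - z * f t) * m t) <=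
    n * (z ^+ 2 * (T * L * Cf ^+ 2 * expR Cf)).
Proof.
move=> cf cm Cf0 n0 L0 z1 fC mL.
have cz := continuousZ_fun (c := z) cf.
have c1 : continuous (fun t => (expR (z * f t) - 1 - z * f t) * m t).
  apply: continuousM_fun => // t; apply: cvgB; last exact: cz.
  by apply: cvgB; [exact: (continuous_expR_fun cz)|exact: cvg_cst].
have cc : continuous (fun _ : R => z ^+ 2 * Cf ^+ 2 * expR Cf * (n * L)).
  exact: cst_continuous.
apply: (@le_trans _ _ (\int[mu]_(t in `]0, T]) (z ^+ 2 * Cf ^+ 2 * expR Cf * (n * L)))).
  apply: Rintegral_itv_le => // t ht.
  have /andP[m0 mn] := mL t ht.
  apply: ler_pM => //; first by have := expR_ge1Dx (z * f t); lra.
  apply: (le_trans (ler_norm _)); apply: (le_trans (expR_tail2 _)).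
  rewrite exprMn; apply: ler_pM; rewrite ?expR_ge0//.
  - by rewrite mulr_ge0// sqr_ge0.
  - rewrite ler_wpM2l ?sqr_ge0// -(real_normK (num_real (f t))) lerXn2r// ?nnegrE//.
    exact: fC.
  - rewrite ler_expR normrM (le_trans _ (fC t ht))// ler_piMl//.
rewrite (Rintegral_itv_cst _ (ltW T0)) subr0.
by rewrite le_eqVlt; apply/orP; left; apply/eqP; ring.
Qed.

(** The rate [c] depends on [T], [Cf], [L] and [eta] alone, not on the law, the intensity or [f]:
    the uniformity in the true delay originates here. *)
Lemma deviation_tail (Cf L eta : R) : 0 <= Cf -> 0 <= L -> 0 < eta ->
  exists2 c : R, 0 < c & forall P Y (n : R) m f, poisson_obs T P Y m ->
    continuous m -> continuous f -> 0 <= n ->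
    (forall t, 0 < t <= T -> `|f t| <= Cf) ->
    (forall t, 0 < t <= T -> 0 <= m t <= n * L) ->
    (P [set w | (eta * n <= `|centered T Y m f w|)%R] <= (2 * expR (- (c * n)))%:E)%E.
Proof.
move=> Cf0 L0 eta0.
pose K := T * L * Cf ^+ 2 * expR Cf.
have K0 : 0 <= K by rewrite !mulr_ge0 ?sqr_ge0 ?expR_ge0// ltW.
have K1 : 0 < 2 * (K + 1) by rewrite mulr_gt0// ltr_wpDl.
(* The gain [z * eta] has to beat the cost [z ^ 2 * K] from [cumulant_bound]; this choice keeps at
   least half of the gain. *)
pose z := Num.min 1 (eta / (2 * (K + 1))).
have z0 : 0 < z by rewrite lt_min ltr01 divr_gt0.
have z1 : z <= 1 by rewrite ge_min lexx.
have zK : z * (2 * (K + 1)) <= eta by rewrite -ler_pdivlMr// ge_min lexx orbT.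
exists (z * eta / 2); first by rewrite divr_gt0// mulr_gt0.
move=> P Y n m f PY cm cf n0 fC mL.
have mcen := measurable_centered PY cf.
have one (y : R) : `|y| = z ->
    (P [set w | (z * (eta * n) <= y * centered T Y m f w)%R] <=
      (expR (- (z * eta / 2 * n)))%:E)%E.
  move=> yz; apply: (le_trans (chernoff _ _ _)).
    by apply: measurable_funM.
  rewrite centered_mgf// -EFinM -expRD lee_fin ler_expR.
  apply: (@le_trans _ _ (- (z * (eta * n)) + n * (y ^+ 2 * K))).
    by rewrite lerD2l; apply: cumulant_bound => //; rewrite yz.
  rewrite -(real_normK (num_real y)) yz.
  have : z ^+ 2 * K * n <= z * (eta / 2) * n.
    rewrite ler_wpM2r// expr2 -mulrA ler_wpM2l ?(ltW z0)//.
    by nra.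
  by lra.
have mA (y : R) : measurable [set w | (z * (eta * n) <= y * centered T Y m f w)%R].
  by apply: measurable_ge_set; apply: measurable_funM.
apply: (@le_trans _ _ (P ([set w | (z * (eta * n) <= z * centered T Y m f w)%R] `|`
    [set w | (z * (eta * n) <= - z * centered T Y m f w)%R]))).
  apply: le_measure; rewrite ?inE.
  - by apply: measurable_ge_set; exact: measurableT_comp.
  - by apply: measurableU.
  - move=> w /=; rewrite ler_normr => /orP[h|h]; [left|right].
      by rewrite ler_wpM2l// ltW.
    by rewrite mulNr -mulrN ler_wpM2l// ltW.
apply: (le_trans (measureU2 _ (mA z) (mA (- z)))).
rewrite mulr_natl mulr2n EFinD; apply: leeD; apply: one; rewrite ?normrN;
  exact: gtr0_norm.
Qed.

(** The law being known through its Laplace functional only, the second moment is read off the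
    symmetric second difference of the moment generating function at 0. The mean of
    [expR (z * N) + expR (- z * N) - 2] and its explicit value are [z ^ 2] times the two quantities
    to compare, up to a term of order [z ^ 3]. *)
Lemma centered_variance P Y m f : poisson_obs T P Y m ->
  continuous m -> continuous f -> (forall t, 0 < t <= T -> 0 <= m t) ->
  P.-integrable setT (fun w => ((centered T Y m f w) ^+ 2)%:E) /\
  \int[P]_w ((centered T Y m f w) ^+ 2) = \int[mu]_(t in `]0, T]) ((f t) ^+ 2 * m t).
Proof.
move=> PY cm cf m0.
set N := centered T Y m f; have mN : measurable_fun setT N := measurable_centered PY cf.
have iexp z : P.-integrable setT (fun w => (expR (z * N w))%:E).
  exact: integrable_centered_exp.
have ic (c : R) : P.-integrable setT (fun=> c%:E).
  exact: finite_measure_integrable_cst.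
pose W w := expR (2 * N w) + expR (-2 * N w).
have iW : P.-integrable setT (fun w => (W w)%:E).
  exact: (integrableD measurableT (iexp 2) (iexp (-2))).
have absW w : expR (2 * `|N w|) <= W w.
  by rewrite (le_trans (expRM_norm_le _ _))// /W mulNr.
have W0 w : 0 <= W w by rewrite addr_ge0 ?expR_ge0.
have NW w : N w ^+ 2 <= 2 * W w.
  have := @expr_le_expR R `|N w| 2 (normr_ge0 _).
  rewrite real_normK ?num_real// => h; apply: (le_trans h).
  rewrite ler_wpM2l// (le_trans _ (absW w))// ler_expR ler_peMl//.
  by rewrite ler1n.
have iN2 : P.-integrable setT (fun w => (N w ^+ 2)%:E).
  apply: (le_integrable _ _ _ (integrableZl measurableT 2 iW)) => //.
    by apply/measurable_EFinP; exact: measurable_funX.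
  move=> w _; rewrite -EFinM !abse_EFin lee_fin ger0_norm ?sqr_ge0//.
  by rewrite ger0_norm ?mulr_ge0.
split=> //.
pose psi z := \int[mu]_(t in `]0, T]) ((expR (z * f t) - 1 - z * f t) * m t).
have cfm2 : continuous (fun t => f t ^+ 2 * m t).
  by apply: continuousM_fun => //; exact: continuous_sqr.
set V := \int[mu]_(t in `]0, T]) (f t ^+ 2 * m t).
have [Cf Cf0 hf] := continuous_itv_bounded 0 T cf.
have [Cm Cm0 hm] := continuous_itv_bounded 0 T cm.
pose C1 := T * (Cf ^+ 3 * expR Cf * Cm).
have C10 : 0 <= C1 by rewrite !mulr_ge0 ?exprn_ge0 ?expR_ge0 ?(ltW T0).
have psiE z : `|z| <= 1 -> `|psi z - z ^+ 2 / 2 * V| <= `|z| ^+ 3 * C1.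
  move=> z1; have cz := continuousZ_fun (c := z) cf.
  have c1 : continuous (fun t => (expR (z * f t) - 1 - z * f t) * m t).
    apply: continuousM_fun => // t; apply: cvgB; last exact: cz.
    by apply: cvgB; [exact: (continuous_expR_fun cz)|exact: cvg_cst].
  have c2 : continuous (fun t => z ^+ 2 / 2 * (f t ^+ 2 * m t)).
    exact: continuousZ_fun.
  rewrite /psi /V -(Rintegral_itv_scale _ _ _ cfm2) -(Rintegral_itv_subf _ _ c1 c2).
  have cc : continuous (fun _ : R => `|z| ^+ 3 * (Cf ^+ 3 * expR Cf * Cm)).
    exact: cst_continuous.
  have cb : continuous (fun t => (expR (z * f t) - 1 - z * f t) * m t -
      z ^+ 2 / 2 * (f t ^+ 2 * m t)).
    by move=> t; apply: cvgB; [exact: c1|exact: c2].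
  have bd t : 0 < t <= T -> `|(expR (z * f t) - 1 - z * f t) * m t -
      z ^+ 2 / 2 * (f t ^+ 2 * m t)| <= `|z| ^+ 3 * (Cf ^+ 3 * expR Cf * Cm).
    move=> /andP[t0 tT]; have t0T : 0 <= t <= T by rewrite ltW.
    rewrite (_ : _ - _ = (expR (z * f t) - 1 - z * f t - (z * f t) ^+ 2 / 2) * m t);
      last by ring.
    rewrite normrM.
    rewrite [leRHS](_ : _ = (`|z| ^+ 3 * Cf ^+ 3 * expR Cf) * Cm); last by ring.
    apply: ler_pM => //; last exact: hm.
    apply: (le_trans (expR_tail3 _)); rewrite normrM exprMn.
    apply: ler_pM; rewrite ?expR_ge0//.
    - rewrite ler_wpM2l ?exprn_ge0// lerXn2r// ?nnegrE//.
      exact: hf.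
    - by rewrite ler_expR (le_trans _ (hf t t0T))// ler_piMl.
  apply: (le_trans (Rintegral_itv_abs cb cc bd)).
  by rewrite (Rintegral_itv_cst _ (ltW T0)) subr0 /C1 le_eqVlt; apply/orP; left; apply/eqP; ring.
pose C2 := `|V| + C1.
have C20 : 0 <= C2 by rewrite addr_ge0.
have epsi z : `|z| <= 1 ->
    `|expR (psi z) - 1 - z ^+ 2 / 2 * V| <= `|z| ^+ 3 * (C1 + C2 ^+ 2 * expR C2).
  move=> z1; have h := psiE z z1.
  have z23 : `|z| ^+ 3 <= `|z| ^+ 2 by rewrite exprS ler_piMl ?exprn_ge0.
  have z21 : `|z| ^+ 2 <= 1 by rewrite exprn_ile1.
  have z2E : `|z| ^+ 2 = z ^+ 2 by rewrite real_normK// num_real.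
  have pz : `|psi z| <= `|z| ^+ 2 * C2.
    rewrite -(subrK (z ^+ 2 / 2 * V) (psi z)) (le_trans (ler_normD _ _))//.
    rewrite /C2 mulrDr addrC; apply: lerD.
      rewrite normrM ger0_norm ?divr_ge0 ?sqr_ge0// z2E ler_wpM2r//.
      by have := sqr_ge0 z; lra.
    by rewrite (le_trans h)// ler_wpM2r.
  have pz1 : `|psi z| <= C2 by rewrite (le_trans pz)// ler_piMl.
  rewrite -(subrKA (psi z)) (_ : _ - 1 - _ + _ = (expR (psi z) - 1 - psi z) +
    (psi z - z ^+ 2 / 2 * V)); last by ring.
  rewrite (le_trans (ler_normD _ _))// mulrDr addrC lerD//.
  apply: (le_trans (expR_tail2 _)).
  rewrite mulrA; apply: ler_pM; rewrite ?sqr_ge0 ?expR_ge0 ?ler_expR//.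
  rewrite -(real_normK (num_real (psi z))).
  apply: (@le_trans _ _ ((`|z| ^+ 2 * C2) ^+ 2)); first by rewrite lerXn2r// nnegrE ?mulr_ge0 ?exprn_ge0.
  rewrite exprMn ler_wpM2r ?sqr_ge0// -exprM.
  by rewrite -[X in _ <= X]mul1r [in leLHS](_ : (2 * 2 = 1 + 3)%N)// exprD expr1 ler_wpM2r ?exprn_ge0.
set kap := \int[P]_w W w.
pose C3 := 2 * (C1 + C2 ^+ 2 * expR C2) + 12 * kap.
have kap0 : 0 <= kap by apply: Rintegral_ge0.
have C30 : 0 <= C3.
  by rewrite addr_ge0 ?mulr_ge0// addr_ge0// mulr_ge0 ?sqr_ge0 ?expR_ge0.
have key z : 0 < z -> z <= 1 -> `|\int[P]_w (N w ^+ 2) - V| <= z * C3.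
  move=> z0 z1; have nz : `|z| = z := gtr0_norm z0.
  pose Qz w := expR (z * N w) + expR (- z * N w) - 2.
  have iQ : P.-integrable setT (fun w => (Qz w)%:E).
    exact: (integrableB measurableT (integrableD measurableT (iexp z) (iexp (- z))) (ic 2)).
  have EQ : \int[P]_w Qz w = expR (psi z) + expR (psi (- z)) - 2.
    have iS : P.-integrable setT (fun w => (expR (z * N w) + expR (- z * N w))%:E).
      exact: (integrableD measurableT (iexp z) (iexp (- z))).
    rewrite /Qz (RintegralB measurableT iS (ic 2)).
    rewrite (RintegralD measurableT (iexp z) (iexp (- z))).
    rewrite !centered_Rmgf// Rintegral_cst//.
    by rewrite (_ : fine _ = 1) ?mulr1//= probability_setT.
  have h1 : `|expR (psi z) + expR (psi (- z)) - 2 - z ^+ 2 * V| <=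
      z ^+ 3 * (2 * (C1 + C2 ^+ 2 * expR C2)).
    have := epsi z; have := epsi (- z); rewrite normrN nz sqrrN => /(_ z1) e1 /(_ z1) e2.
    move: e1 e2; move: (expR (psi z)) (expR (psi (- z))) => a b.
    by rewrite !ler_norml => /andP[? ?] /andP[? ?]; apply/andP; split; lra.
  have h2 : `|\int[P]_w Qz w - z ^+ 2 * \int[P]_w (N w ^+ 2)| <= z ^+ 3 * (12 * kap).
    rewrite -RintegralZl// -RintegralB//; last exact: (integrableZl measurableT _ iN2).
    have iD : P.-integrable setT (fun w => (Qz w - z ^+ 2 * N w ^+ 2)%:E).
      exact: (integrableB measurableT iQ (integrableZl measurableT (z ^+ 2) iN2)).
    apply: (le_trans (le_normr_Rintegral measurableT iD)).
    rewrite -RintegralZl// -RintegralZl//; last exact: (integrableZl measurableT 12 iW).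
    apply: le_Rintegral => //.
    - exact: (integrable_abse iD).
    - exact: (integrableZl measurableT (z ^+ 3) (integrableZl measurableT 12 iW)).
    move=> w _; set x := N w.
    have t1 := expR_tail3 (z * x); have t2 := expR_tail3 (- z * x).
    have nn : `|- z * x| = `|z * x| by rewrite mulNr normrN.
    rewrite nn in t2.
    have b3 : `|z * x| ^+ 3 * expR `|z * x| <= z ^+ 3 * (6 * W w).
      rewrite normrM nz exprMn -mulrA ler_wpM2l ?exprn_ge0 ?(ltW z0)//.
      apply: (@le_trans _ _ (6 * expR `|x| * expR `|x|)).
        apply: ler_pM; rewrite ?exprn_ge0 ?expR_ge0//.
          by have := @expr_le_expR R `|x| 3 (normr_ge0 _).
        by rewrite ler_expR ler_piMl.
      rewrite -mulrA ler_wpM2l// -expRD (le_trans _ (absW w))//.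
      by rewrite ler_expR -mulr2n mulr_natl.
    have {}t1 := le_trans t1 b3; have {}t2 := le_trans t2 b3.
    move: t1 t2; rewrite /Qz -/x; move: (expR (z * x)) (expR (- z * x)) => a b.
    by rewrite !ler_norml => /andP[? ?] /andP[? ?]; apply/andP; split; lra.
  have h3 : z ^+ 2 * `|\int[P]_w (N w ^+ 2) - V| <= z ^+ 2 * (z * C3).
    rewrite -{1}(ger0_norm (sqr_ge0 z)) -normrM.
    move: h1 h2; rewrite EQ /C3; move: (expR _ + _ - _) (\int[P]_w _) => a b.
    by rewrite !ler_norml => /andP[? ?] /andP[? ?]; apply/andP; split; lra.
  by rewrite ler_pM2l ?exprn_gt0 in h3.
apply/eqP; rewrite -subr_eq0 -normr_eq0 eq_le normr_ge0 andbT.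
apply/ler_addgt0Pl => e e0; rewrite addr0.
have C31 : 0 < C3 + 1 by rewrite ltr_wpDl.
pose z := Num.min 1 (e / (C3 + 1)).
have z0 : 0 < z by rewrite lt_min ltr01 divr_gt0.
apply: (le_trans (key z z0 _)); first by rewrite ge_min lexx.
apply: (@le_trans _ _ (z * (C3 + 1))); first by rewrite ler_wpM2l ?lerDl// ltW.
by rewrite -ler_pdivlMr// ge_min lexx orbT.
Qed.

End deviation.

Lemma exp_decay (R : realType) (c D e : R) : 0 < c -> 0 < e -> exists N, forall n, (N <= n)%N ->
  expR (D * Num.sqrt n%:R - c * n%:R) <= e.
Proof.
(* Beyond [(2 * D / c) ^ 2] the term [D * sqrt n] is at most [c * n / 2]; beyond [2 / (c * e)] one
   has [c * n / 2 >= 1 / e], and [expR y >= 1 + y] concludes. *)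
move=> c0 e0; pose x := (2 * D / c) ^+ 2 + 2 / (c * e).
have x1 : 0 <= (2 * D / c) ^+ 2 := sqr_ge0 _.
have x2 : 0 < 2 / (c * e) by rewrite divr_gt0// mulr_gt0.
have x0 : 0 <= x by rewrite addr_ge0// ltW.
exists (Num.truncn x).+1 => n nN.
have xn : x <= n%:R.
  rewrite ltW//; apply: (@lt_le_trans _ _ (Num.truncn x).+1%:R).
    by have /andP[] := truncn_itv x0.
  by rewrite ler_nat.
have n0 : 0 <= n%:R :> R by [].
have nn : 0 < n%:R :> R by apply: lt_le_trans xn; rewrite /x; lra.
set r := Num.sqrt n%:R; have r0 : 0 <= r := sqrtr_ge0 _.
have rE : r ^+ 2 = n%:R by rewrite sqr_sqrtr.
have Dr : D * r <= c / 2 * n%:R.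
  have h : 2 * D / c <= r.
    apply: (le_trans (ler_norm _)); rewrite -(ler_pXn2r (n := 2)) ?nnegrE//.
    by rewrite real_normK ?num_real// rE; apply: le_trans xn; rewrite /x; lra.
  rewrite -rE expr2 mulrA ler_wpM2r//.
  by move: h; rewrite ler_pdivrMr//; lra.
apply: (@le_trans _ _ (expR (- (c / 2 * n%:R)))).
  by rewrite ler_expR; lra.
have y0 : 0 < c / 2 * n%:R by rewrite mulr_gt0// divr_gt0.
rewrite expRN -[leRHS]invrK lef_pV2 ?posrE ?invr_gt0 ?expR_gt0//.
apply: (le_trans _ (expR_ge1Dx _)).
have : 2 / (c * e) <= n%:R by apply: le_trans xn; rewrite /x; lra.
rewrite ler_pdivrMr ?mulr_gt0// => h.
have : e^-1 <= c / 2 * n%:R by rewrite -[leLHS]mul1r ler_pdivrMr//; lra.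
by lra.
Qed.

(* e1 is the indicator of the exceptional event and e2 an a priori bound on the
   squared error z^2; x stands for the linear approximation of z. *)
Lemma sq_distance_bound (R : realType) (d z x K e1 e2 : R) : 0 < d <= 1 -> 0 < K ->
  0 <= e1 <= 1 -> (e1 = 0 -> (z - x) ^+ 2 <= d ^+ 2 * x ^+ 2) ->
  (e1 = 0 \/ e1 = 1) -> z ^+ 2 <= e2 ->
  `|z ^+ 2 - x ^+ 2| <= 3 * d * x ^+ 2 + (e2 + K) * e1 +
     24 / K * (expR x + expR (- x)).
Proof.
move=> /andP[d0 d1] K0 he1 h0 he ze2.
have W0 : 0 <= 24 / K * (expR x + expR (- x)).
  by rewrite mulr_ge0 ?divr_ge0 ?(ltW K0)// addr_ge0 ?expR_ge0.
have x20 := sqr_ge0 x; have z20 := sqr_ge0 z.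
have e20 : 0 <= e2 := le_trans z20 ze2.
have [e10|e11] := he.
  rewrite e10 mulr0 addr0.
  have {}h0 := h0 e10.
  have zx : `|z - x| <= d * `|x|.
    rewrite -(ler_pXn2r (n := 2)) ?nnegrE ?mulr_ge0 ?(ltW d0)//.
    by rewrite exprMn !real_normK ?num_real.
  have -> : z ^+ 2 - x ^+ 2 = (z - x) ^+ 2 + 2 * (x * (z - x)) by ring.
  rewrite (le_trans (ler_normD _ _))// (ger0_norm (sqr_ge0 (z - x))).
  have h1 : `|2 * (x * (z - x))| <= 2 * (d * x ^+ 2).
    rewrite normrM ger0_norm// ler_wpM2l// normrM.
    apply: (le_trans (ler_wpM2l (normr_ge0 x) zx)).
    by rewrite mulrCA -expr2 real_normK ?num_real.
  have h2 : d ^+ 2 * x ^+ 2 <= d * x ^+ 2 by rewrite ler_wpM2r// expr2 ler_piMl// ltW.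
  by lra.
rewrite e11 mulr1.
(* On the exceptional event [x ^ 2] is cut at [K]: above this level [x ^ 2 <= x ^ 4 / K], and
   [x ^ 4 <= 4! * expR |x|]. *)
have x4 : x ^+ 2 <= K + 24 / K * (expR x + expR (- x)).
  have [xK|Kx] := leP (x ^+ 2) K; first by lra.
  have h : x ^+ 4 <= 24 * (expR x + expR (- x)).
    have := @expr_le_expR R `|x| 4 (normr_ge0 _).
    rewrite (_ : `|x| ^+ 4 = x ^+ 4); last first.
      by rewrite -normrX ger0_norm// (_ : 4%N = (2 * 2)%N)// exprM sqr_ge0.
    move=> /le_trans; apply.
    by rewrite (_ : 4`! = 24%N)// ler_wpM2l// expR_norm_le.
  have : x ^+ 2 <= x ^+ 4 / K.
    rewrite ler_pdivlMr// (_ : x ^+ 4 = x ^+ 2 * x ^+ 2); last by ring.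
    by rewrite ler_wpM2l// ltW.
  have : x ^+ 4 / K <= 24 * (expR x + expR (- x)) / K by rewrite ler_wpM2r// invr_ge0 ltW.
  by lra.
have dx : 0 <= 3 * d * x ^+ 2 by rewrite mulr_ge0// mulr_ge0 ?(ltW d0).
by rewrite ler_norml; apply/andP; split; lra.
Qed.

(** * One detector: likelihood, consistency and linearisation *)

Lemma derivable_continuous_at {R : realType} (f : R -> R) (x : R) :
  derivable f x 1 -> {for x, continuous f}.
Proof. by move=> /derivable1_diffP/differentiable_continuous. Qed.

Section signal.
Context {R : realType}.
Variables (T lam0 A B : R) (lam : R -> R).
Hypotheses (T0 : 0 < T) (l00 : 0 < lam0) (A0 : 0 < A) (AB : A < B) (BT : B < T).
Hypothesis lam_zero : forall t, - B <= t <= 0 -> lam t = 0.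
Hypothesis lam_pos : forall t, 0 < t <= T - A -> 0 < lam t.
Hypothesis lam_C2 : forall t, - B <= t <= T - A ->
  derivable lam t 1 /\ derivable (derive1 lam) t 1 /\
  {for t, continuous (derive1n 2 lam)}.
Implicit Types (s t u v h : R) (n : nat).
Notation mu := (@lebesgue_measure R).

(* The signal and its derivatives are frozen outside of [- B, T - A], the only
   arguments that occur: this makes them continuous on the whole line. *)
Definition sig0 u := lam (clamp (- B) (T - A) u).
Definition sig1 u := derive1 lam (clamp (- B) (T - A) u).
Definition sig2 u := derive1n 2 lam (clamp (- B) (T - A) u).
Definition rate s t := sig0 (t - s) + lam0.
(** The logarithm of the intensity relative to the background [lam0], as a function of the lag,
    followed by its first two derivatives on the domain [[- B, T - A]]. *)
Definition logr0 u := ln (1 + sig0 u / lam0).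
Definition logr1 u := sig1 u / (sig0 u + lam0).
Definition logr2 u := sig2 u / (sig0 u + lam0) - (sig1 u / (sig0 u + lam0)) ^+ 2.
Definition info_dens u := sig1 u ^+ 2 / (sig0 u + lam0).
(** The derivative of the signal vanishes at negative lags, so the Fisher information can be
    integrated over []0, T]], a domain that does not depend on [s]. *)
Definition info s := \int[mu]_(t in `]0, T]) info_dens (t - s).

Let BA : - B <= T - A.
Proof. by move: A0 AB BT => ? ? ?; lra. Qed.

Lemma dom_clamp u : - B <= clamp (- B) (T - A) u <= T - A.
Proof. exact: clamp_itv. Qed.

Lemma sig0E u : - B <= u <= T - A -> sig0 u = lam u.
Proof. by move=> h; rewrite /sig0 clamp_id. Qed.

Lemma sig0_zero u : u <= 0 -> sig0 u = 0.
Proof.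
move=> u0; rewrite /sig0 lam_zero// (andP (dom_clamp u)).1 /=.
by rewrite /clamp ge_max ge_min u0 orbT andbT; move: A0 AB => ? ?; lra.
Qed.

Lemma sig0_gt0 u : 0 < u <= T - A -> 0 < sig0 u.
Proof.
move=> /andP[u0 uA]; rewrite sig0E ?lam_pos ?u0//.
by move: A0 AB => ? ?; apply/andP; split; lra.
Qed.

Lemma sig0_ge0 u : 0 <= sig0 u.
Proof.
have := dom_clamp u; rewrite /sig0; move: (clamp _ _ u) => v /andP[v1 v2].
have [v0|v0] := leP v 0; first by rewrite lam_zero ?v1.
by rewrite ltW// lam_pos// v0.
Qed.

Lemma den_gt0 u : 0 < sig0 u + lam0.
Proof. by rewrite ltr_wpDl// sig0_ge0. Qed.

Lemma rate_gt0 s t : 0 < rate s t. Proof. exact: den_gt0. Qed.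

Lemma is_derive_lam u : - B <= u <= T - A -> is_derive u 1 lam (sig1 u).
Proof.
move=> hu; have [d1 _] := lam_C2 hu.
by have := derivableP d1; rewrite -derive1E /sig1 (clamp_id hu).
Qed.

Lemma is_derive_dlam u : - B <= u <= T - A -> is_derive u 1 (derive1 lam) (sig2 u).
Proof.
move=> hu; have [_ [d2 _]] := lam_C2 hu.
have := derivableP d2; rewrite -derive1E.
by rewrite /sig2 (clamp_id hu) derive1nS derive1n1.
Qed.

Lemma continuous_sig0 : continuous sig0.
Proof.
move=> u; apply: (@continuous_comp _ _ _ (clamp (- B) (T - A)) lam).
  exact: continuous_clamp.
have [d1 _] := lam_C2 (dom_clamp u).
exact: derivable_continuous_at.
Qed.

Lemma continuous_sig1 : continuous sig1.
Proof.
move=> u; apply: (@continuous_comp _ _ _ (clamp (- B) (T - A)) (derive1 lam)).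
  exact: continuous_clamp.
have [_ [d2 _]] := lam_C2 (dom_clamp u).
exact: derivable_continuous_at.
Qed.

Lemma continuous_sig2 : continuous sig2.
Proof.
move=> u; apply: (@continuous_comp _ _ _ (clamp (- B) (T - A)) (derive1n 2 lam)).
  exact: continuous_clamp.
by have [_ [_]] := lam_C2 (dom_clamp u).
Qed.

Lemma continuous_invden : continuous (fun u => (sig0 u + lam0)^-1).
Proof.
move=> u; apply: cvgV; first by rewrite gt_eqF// den_gt0.
by apply: cvgD; [exact: continuous_sig0|exact: cvg_cst].
Qed.

Lemma continuous_logr0 : continuous logr0.
Proof.
move=> u; have p0 : 0 < 1 + sig0 u / lam0.
  by rewrite ltr_pwDl// divr_ge0 ?sig0_ge0// ltW.
have c1 : {for u, continuous (fun u => 1 + sig0 u / lam0)}.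
  apply: cvgD; first exact: cvg_cst.
  by apply: cvgM; [exact: continuous_sig0|exact: cvg_cst].
exact: (@continuous_comp _ _ _ (fun u => 1 + sig0 u / lam0) (@ln R) u c1
  (continuous_ln p0)).
Qed.

Lemma continuous_logr1 : continuous logr1.
Proof.
by move=> u; apply: cvgM; [exact: continuous_sig1|exact: continuous_invden].
Qed.

Lemma continuous_logr2 : continuous logr2.
Proof.
move=> u; apply: cvgB.
  by apply: cvgM; [exact: continuous_sig2|exact: continuous_invden].
exact: (continuous_sqr continuous_logr1).
Qed.

Lemma continuous_info_dens : continuous info_dens.
Proof.
move=> u; apply: cvgM; last exact: continuous_invden.
exact: (continuous_sqr continuous_sig1).
Qed.

Lemma continuous_shift (f : R -> R) s : continuous f -> continuous (fun t => f (t - s)).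
Proof.
move=> cf t; apply: (@continuous_comp _ _ _ (fun t => t - s) f); last exact: cf.
by apply: cvgB; [exact: cvg_id|exact: cvg_cst].
Qed.

Lemma continuous_rate s : continuous (rate s).
Proof.
move=> t; apply: cvgD; last exact: cvg_cst.
exact: (continuous_shift (s := s) continuous_sig0).
Qed.

Lemma is_derive_logr0 u : - B <= u <= T - A ->
  is_derive u 1 (fun v => ln (1 + lam v / lam0)) (sig1 u / (lam u + lam0)).
Proof.
move=> hu; have := is_derive_lam hu => dl.
have lu : 0 <= lam u by rewrite -sig0E// sig0_ge0.
have p0 : 0 < 1 + lam u / lam0.
  by rewrite ltr_pwDl// divr_ge0// ltW.
have d1 : is_derive u 1 (fun v => 1 + lam v / lam0) (sig1 u / lam0).
  apply: is_derive_eq; rewrite /GRing.scale /=; field.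
  by rewrite gt_eqF.
have := @is_derive1_comp R (@ln R) (fun v => 1 + lam v / lam0) u _ _ (is_derive1_ln p0) d1.
rewrite (_ : (1 + lam u / lam0)^-1 * (sig1 u / lam0) = sig1 u / (lam u + lam0))//.
have p1 : 0 < lam u + lam0 by rewrite ltr_wpDl.
by field; rewrite !gt_eqF.
Qed.

Lemma is_derive_logr1 u : - B <= u <= T - A ->
  is_derive u 1 (fun v => derive1 lam v / (lam v + lam0)) (logr2 u).
Proof.
move=> hu; have dl := is_derive_lam hu; have ddl := is_derive_dlam hu.
have p0 : 0 < lam u + lam0 by rewrite -sig0E// den_gt0.
have pn : lam u + lam0 != 0 by rewrite gt_eqF.
have d1 : is_derive u 1 (fun v => lam v + lam0) (sig1 u).
  by apply: is_derive_eq; rewrite addr0.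
have d2 := @is_deriveV _ (fun v => lam v + lam0) _ _ _ pn d1.
apply: is_derive_eq.
rewrite /logr2 /GRing.scale /= sig0E// /sig1 clamp_id//.
by field.
Qed.

Lemma shift_dom s t : A <= s <= B -> 0 < t <= T -> - B <= t - s <= T - A.
Proof.
by move=> /andP[? ?] /andP[? ?]; apply/andP; split; lra.
Qed.

Lemma sig_bounded : exists2 C, 1 <= C & forall u, - B <= u <= T - A ->
  [/\ `|sig0 u| <= C, `|sig1 u| <= C, `|logr0 u| <= C, `|logr1 u| <= C &
      `|logr2 u| <= C /\ `|info_dens u| <= C].
Proof.
have [C0 c0 h0] := continuous_itv_bounded (- B) (T - A) continuous_sig0.
have [C1 c1 h1] := continuous_itv_bounded (- B) (T - A) continuous_sig1.
have [C2 c2 h2] := continuous_itv_bounded (- B) (T - A) continuous_logr0.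
have [C3 c3 h3] := continuous_itv_bounded (- B) (T - A) continuous_logr1.
have [C4 c4 h4] := continuous_itv_bounded (- B) (T - A) continuous_logr2.
have [C5 c5 h5] := continuous_itv_bounded (- B) (T - A) continuous_info_dens.
exists (1 + C0 + C1 + C2 + C3 + C4 + C5); first by lra.
move=> u hu; move: (h0 u hu) (h1 u hu) (h2 u hu) (h3 u hu) (h4 u hu) (h5 u hu).
by move=> *; do !split; lra.
Qed.

Lemma sig_unif (w : R) : 0 < w -> exists2 r : R, 0 < r & forall u v,
  - B <= u <= T - A -> - B <= v <= T - A -> `|u - v| <= r ->
  [/\ `|sig0 u - sig0 v| <= w, `|sig2 u - sig2 v| <= w,
      `|logr0 u - logr0 v| <= w, `|logr2 u - logr2 v| <= w &
      `|info_dens u - info_dens v| <= w].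
Proof.
move=> w0.
have cpt := @segment_compact R (- B) (T - A).
have unif (f : R -> R) : continuous f -> exists2 r, 0 < r & forall u v,
    - B <= u <= T - A -> `|u - v| <= r -> `|f u - f v| <= w.
  move=> cf; have [r r0 h] := compact_unif_continuous cpt (fun x _ => cf x) w0.
  exists (r / 2); first by rewrite divr_gt0.
  move=> u v hu uv; apply/ltW/h; first by rewrite /= in_itv.
  by rewrite (le_lt_trans uv)// ltr_pdivrMr// ltr_pMr// ltr1n.
have [r0 ? h0] := unif _ continuous_sig0.
have [r1 ? h1] := unif _ continuous_sig2.
have [r2 ? h2] := unif _ continuous_logr0.
have [r3 ? h3] := unif _ continuous_logr2.
have [r4 ? h4] := unif _ continuous_info_dens.
exists (Num.min r0 (Num.min r1 (Num.min r2 (Num.min r3 r4)))).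
  by rewrite !lt_min; do !(apply/andP; split).
move=> u v hu hv; rewrite !le_min => /andP[? /andP[? /andP[? /andP[? ?]]]].
by split; [exact: h0|exact: h1|exact: h2|exact: h3|exact: h4].
Qed.

Lemma logr_taylor u v (w : R) : - B <= u <= T - A -> - B <= v <= T - A ->
  (forall x, - B <= x <= T - A -> `|x - u| <= `|v - u| ->
     `|logr2 x - logr2 u| <= w) ->
  `|logr0 v - logr0 u - (v - u) * logr1 u - (v - u) ^+ 2 / 2 * logr2 u| <=
    w * (v - u) ^+ 2.
Proof.
move=> hu hv hw.
have d1 x : - B <= x <= T - A -> is_derive x 1 (fun v => ln (1 + lam v / lam0))
    (derive1 lam x / (lam x + lam0)).
  by move=> hx; have := is_derive_logr0 hx; rewrite /sig1 (clamp_id hx).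
have := taylor2 hu hv d1 is_derive_logr1 hw.
by rewrite /logr0 (sig0E hu) (sig0E hv) /logr1 /sig1 (clamp_id hu) (sig0E hu).
Qed.

Lemma sig_taylor u v (w : R) : - B <= u <= T - A -> - B <= v <= T - A ->
  (forall x, - B <= x <= T - A -> `|x - u| <= `|v - u| ->
     `|sig2 x - sig2 u| <= w) ->
  `|sig0 v - sig0 u - (v - u) * sig1 u - (v - u) ^+ 2 / 2 * sig2 u| <=
    w * (v - u) ^+ 2.
Proof.
move=> hu hv hw.
have d1 x : - B <= x <= T - A -> is_derive x 1 lam (derive1 lam x).
  by move=> hx; have := is_derive_lam hx; rewrite /sig1 (clamp_id hx).
have := taylor2 hu hv d1 is_derive_dlam hw.
by rewrite !sig0E// /sig1 !clamp_id.
Qed.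

(** The log-likelihood with both integrals extended to []0, T]], their integrands being zero at lags
    below 0. The delay then occurs in the integrands only, which can be expanded pointwise. *)
Definition ell n s (x : seq R) : R :=
  pint T (fun t => logr0 (t - s)) x - n%:R * \int[mu]_(t in `]0, T]) sig0 (t - s).

Lemma lik_ell n s x : A <= s <= B -> lik n lam lam0 T s x = expR (ell n s x).
Proof.
move=> /[dup] hs /andP[As sB]; have s0 : 0 < s := lt_le_trans A0 As.
have sT : s < T := le_lt_trans sB BT.
have S1 : \sum_(t <- x | (s < t) && (t <= T)) ln (1 + lam (t - s) / lam0) =
    pint T (fun t => logr0 (t - s)) x.
  rewrite /pint [LHS]big_mkcond [RHS]big_mkcond /=; apply: eq_bigr => t _.
  have [st|ts] := ltP s t; rewrite /= ?(lt_trans s0 st) /=.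
    case: ifPn => // tT; rewrite /logr0 sig0E//.
    by apply: shift_dom => //; rewrite (lt_trans s0 st).
  case: ifPn => // /andP[t0 _]; rewrite /logr0 sig0_zero ?mul0r ?addr0 ?ln1//.
  by rewrite subr_le0.
have S2 : Rintegral lebesgue_measure `[s, T] (fun t => lam (t - s)) =
    \int[mu]_(t in `]0, T]) sig0 (t - s).
  have csh := continuous_shift (s := s) continuous_sig0.
  rewrite (Rintegral_itvD csh (ltW s0) (ltW sT)).
  rewrite (@Rintegral_itv_eq _ _ (fun=> 0) 0 s); last first.
    by move=> t /andP[_ ts]; rewrite sig0_zero// subr_le0.
  rewrite Rintegral_itv_cst ?ltW// mul0r add0r.
  rewrite Rintegral_itv_obnd_cbnd; last exact: continuous_integrable.
  apply: eq_Rintegral => t; rewrite inE/= in_itv/= => /andP[st tT].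
  by rewrite sig0E//; apply/andP; split; move: As sB A0 tT st => ? ? ? ? ?; lra.
by rewrite /lik /ell S1 S2.
Qed.

(** Pathwise version of [centered] for the delay [s]: the expansion of the likelihood becomes a
    deterministic statement about a path [x]. *)
Definition dev (f : R -> R) s n (x : seq R) : R :=
  pint T f x - n%:R * \int[mu]_(t in `]0, T]) (f t * rate s t).

Lemma logr1_rate s t : logr1 (t - s) * rate s t = sig1 (t - s).
Proof. by rewrite /logr1 /rate mulfVK// gt_eqF// den_gt0. Qed.

Lemma logr2_rate s t :
  logr2 (t - s) * rate s t = sig2 (t - s) - info_dens (t - s).
Proof.
rewrite /logr2 /rate /info_dens; have := den_gt0 (t - s) => d0.
by field; rewrite gt_eqF.
Qed.

(** Taylor expansion under both integrals. Since [logr1 * rate = sig1] and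
    [logr2 * rate = sig2 - info_dens], the linear term is centred, and the quadratic one is minus
    the information up to a centred fluctuation. The minus sign of the linear term comes from the
    lag [t - s]. *)
Lemma ell_expand n s h (w r : R) x :
  A <= s <= B -> A <= s + h <= B -> `|h| <= r ->
  (forall u v, - B <= u <= T - A -> - B <= v <= T - A -> `|u - v| <= r ->
     `|logr2 u - logr2 v| <= w /\ `|sig2 u - sig2 v| <= w) ->
  `|ell n (s + h) x - ell n s x -
    (- h * dev (fun t => logr1 (t - s)) s n x +
     h ^+ 2 / 2 * (dev (fun t => logr2 (t - s)) s n x - n%:R * info s))| <=
    h ^+ 2 * w * (pint T (fun=> 1) x + n%:R * T).
Proof.
move=> hs hsh hr hw.
have cs0 a := continuous_shift (s := a) continuous_sig0.
have cs1 := continuous_shift (s := s) continuous_sig1.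
have cs2 := continuous_shift (s := s) continuous_sig2.
have cq := continuous_shift (s := s) continuous_info_dens.
have hwT t : 0 < t <= T -> forall x, - B <= x <= T - A ->
    `|x - (t - s)| <= `|(t - (s + h)) - (t - s)| -> `|logr2 x - logr2 (t - s)| <= w /\
    `|sig2 x - sig2 (t - s)| <= w.
  move=> ht y hy; rewrite (_ : t - (s + h) - (t - s) = - h); last by ring.
  rewrite normrN => hyr; apply: hw => //; first exact: shift_dom.
  exact: le_trans hr.
pose e0 t := logr0 (t - (s + h)) - logr0 (t - s) - (- h * logr1 (t - s)) -
  h ^+ 2 / 2 * logr2 (t - s).
pose e1 t := sig0 (t - (s + h)) - sig0 (t - s) - (- h * sig1 (t - s)) -
  h ^+ 2 / 2 * sig2 (t - s).
have he0 t : 0 < t <= T -> `|e0 t| <= w * h ^+ 2.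
  move=> ht; have := @logr_taylor (t - s) (t - (s + h)) w _ _ _.
  rewrite (_ : t - (s + h) - (t - s) = - h); last by ring.
  rewrite sqrrN; apply; [exact: shift_dom|exact: shift_dom|].
  move=> y hy hyh; apply: (hwT t ht y hy _).1.
  by rewrite (_ : t - (s + h) - (t - s) = - h)//; ring.
have he1 t : 0 < t <= T -> `|e1 t| <= w * h ^+ 2.
  move=> ht; have := @sig_taylor (t - s) (t - (s + h)) w _ _ _.
  rewrite (_ : t - (s + h) - (t - s) = - h); last by ring.
  rewrite sqrrN; apply; [exact: shift_dom|exact: shift_dom|].
  move=> y hy hyh; apply: (hwT t ht y hy _).2.
  by rewrite (_ : t - (s + h) - (t - s) = - h)//; ring.
have ce1 : continuous e1.
  move=> t; apply: cvgB.
    apply: cvgB; first by apply: cvgB; exact: cs0.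
    by apply: cvgM; [exact: cvg_cst|exact: cs1].
  by apply: cvgM; [exact: cvg_cst|exact: cs2].
have -> : ell n (s + h) x - ell n s x -
    (- h * dev (fun t => logr1 (t - s)) s n x +
     h ^+ 2 / 2 * (dev (fun t => logr2 (t - s)) s n x - n%:R * info s)) =
   pint T e0 x - n%:R * \int[mu]_(t in `]0, T]) e1 t.
  rewrite /e0 !pintB !pintZ /e1 /ell /dev /info.
  have cZ c (f : R -> R) : continuous f -> continuous (fun t => c * f t).
    by move=> cf t; apply: cvgM; [exact: cvg_cst|exact: cf].
  have cB (f g : R -> R) : continuous f -> continuous g -> continuous (fun t => f t - g t).
    by move=> cf cg t; apply: cvgB; [exact: cf|exact: cg].
  have c1 := cB _ _ (cs0 (s + h)) (cs0 s).
  have c2 := cB _ _ c1 (cZ (- h) _ cs1).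
  rewrite (Rintegral_itv_subf _ _ c2 (cZ (h ^+ 2 / 2) _ cs2)).
  rewrite (Rintegral_itv_subf _ _ c1 (cZ (- h) _ cs1)).
  rewrite (Rintegral_itv_subf _ _ (cs0 (s + h)) (cs0 s)).
  rewrite (Rintegral_itv_scale (- h) _ _ cs1) (Rintegral_itv_scale (h ^+ 2 / 2) _ _ cs2).
  rewrite (@Rintegral_itv_eq _ (fun t => logr1 (t - s) * rate s t)
    (fun t => sig1 (t - s))); last by move=> t _; exact: logr1_rate.
  rewrite (@Rintegral_itv_eq _ (fun t => logr2 (t - s) * rate s t)
    (fun t => sig2 (t - s) - info_dens (t - s))); last by move=> t _; exact: logr2_rate.
  rewrite (Rintegral_itv_subf _ _ cs2 cq).
  do 4 move: (pint _ _ _) => ?.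
  do 5 move: (Rintegral _ _ _) => ?.
  by ring.
apply: (le_trans (ler_normB _ _)); rewrite mulrDr; apply: lerD.
  apply: (le_trans (pint_le x (g := fun=> w * h ^+ 2) he0)).
  by rewrite pint_cst [h ^+ 2 * w]mulrC.
rewrite normrM ger0_norm// mulrCA ler_wpM2l//.
have cc : continuous (fun _ : R => w * h ^+ 2) by exact: cst_continuous.
apply: (le_trans (Rintegral_itv_abs ce1 cc he1)).
by rewrite (Rintegral_itv_cst _ (ltW T0)) subr0 [w * _]mulrC.
Qed.

(** The comparison of the two values amounts to [(g - gs) ^ 2 * I / 2 <= e * (g ^ 2 + gs ^ 2)]. As
    [g ^ 2 <= 2 * (g - gs) ^ 2 + 2 * gs ^ 2], the part in [(g - gs) ^ 2] is absorbed on the left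
    once [e] is small relative to [I]; the constant 12 leaves room for this. *)
Lemma quadratic_argmax (I e eps g gs : R) :
  0 < I -> 0 <= e -> 0 < eps <= 1 -> e <= I * eps / 12 ->
  gs ^+ 2 * I / 2 - gs ^+ 2 * e <= g * gs * I - g ^+ 2 * I / 2 + g ^+ 2 * e ->
  (g - gs) ^+ 2 <= eps * gs ^+ 2.
Proof.
move=> I0 e0 /andP[eps0 eps1] eI H.
have key : (g - gs) ^+ 2 * (I / 2) <= e * (g ^+ 2 + gs ^+ 2).
  by move: H; rewrite sqrrB; nra.
have g2 : g ^+ 2 <= 2 * (g - gs) ^+ 2 + 2 * gs ^+ 2.
  by have := sqr_ge0 (g - 2 * gs); rewrite !sqrrB; nra.
have D0 := sqr_ge0 (g - gs); have S0 := sqr_ge0 gs.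
have E0 := sqr_ge0 g.
move: ((g - gs) ^+ 2) (gs ^+ 2) (g ^+ 2) key g2 D0 S0 E0 => D S G key g2 D0 S0 E0.
have h1 : e * (G + S) <= I * eps / 12 * (2 * D + 3 * S).
  apply: ler_pM => //; first by rewrite addr_ge0.
  by lra.
have h2 : I * (eps * D) <= I * D by rewrite ler_wpM2l ?(ltW I0)// ler_piMl.
have h3 : I * D <= I * (eps * S).
  have : 0 <= I * (eps * S) by rewrite !mulr_ge0// ltW.
  by nra.
by rewrite -(ler_pM2l I0).
Qed.

(* The one-step estimate s + gs built from the score is compared with the
   maximiser s + g through the value of the likelihood at both points. *)
Lemma argmax_linearisation n s g (w r Cn eps : R) x :
  let gs := - dev (fun t => logr1 (t - s)) s n x / (n%:R * info s) in
  (0 < n)%N -> 0 < info s -> 0 < eps <= 1 -> 0 <= Cn ->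
  A <= s <= B -> A <= s + g <= B -> A <= s + gs <= B -> `|g| <= r -> `|gs| <= r ->
  (forall u v, - B <= u <= T - A -> - B <= v <= T - A -> `|u - v| <= r ->
     `|logr2 u - logr2 v| <= w /\ `|sig2 u - sig2 v| <= w) ->
  ell n (s + gs) x <= ell n (s + g) x ->
  pint T (fun=> 1) x <= Cn * n%:R ->
  `|dev (fun t => logr2 (t - s)) s n x| <= w * n%:R ->
  w * (Cn + T + 1) <= info s * eps / 12 ->
  (g - gs) ^+ 2 <= eps * gs ^+ 2.
Proof.
move=> gs n0 I0 heps Cn0 hs hg hgs gr gsr hw le cnt d2 wI.
have n0' : 0 < n%:R :> R by rewrite ltr0n.
have w0 : 0 <= w.
  by have := le_trans (normr_ge0 _) d2; rewrite pmulr_lge0.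
have D1 : dev (fun t => logr1 (t - s)) s n x = - (n%:R * info s * gs).
  by rewrite /gs; field; rewrite !gt_eqF.
have := ell_expand n x hs hg gr hw; have := ell_expand n x hs hgs gsr hw.
rewrite D1; set I := info s in I0 wI *.
set N : R := n%:R in n0' cnt d2 *.
move: (pint T (fun=> 1) x) (pint1_ge0 T x) cnt => K K0 cnt.
move: (dev (fun t => logr2 (t - s)) s n x) d2 => D2 d2.
move: (ell n (s + gs) x) (ell n (s + g) x) (ell n s x) le => L1 L2 L0 le H1 H2.
(* In the relative error [w * (Cn + T + 1)], the part [Cn + T] comes from the Taylor remainder and 1
   from the fluctuation of the second derivative. *)
apply: (@quadratic_argmax I (w * (Cn + T + 1)) eps) => //.
  by rewrite mulr_ge0// !addr_ge0// ltW.
rewrite -(ler_pM2l n0').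
have Tge := ltW T0.
have d2h (h : R) : `|h ^+ 2 / 2 * D2| <= h ^+ 2 * (w * N).
  rewrite normrM ger0_norm; last by rewrite divr_ge0// sqr_ge0.
  apply: ler_pM => //; first by rewrite divr_ge0// sqr_ge0.
  by rewrite ler_pdivrMr// ler_peMr ?sqr_ge0// ler1n.
have bK (h : R) : h ^+ 2 * w * (K + N * T) <= h ^+ 2 * w * (N * (Cn + T)).
  rewrite (ler_wpM2l (mulr_ge0 (sqr_ge0 h) w0))//; lra.
have := d2h g; have := d2h gs; have := bK g; have := bK gs.
move: H1 H2; rewrite !ler_norml.
move=> /andP[? ?] /andP[? ?] ? ? /andP[? ?] /andP[? ?].
by lra.
Qed.

(** * Separation of delays and lower bound on the information *)

Lemma Rintegral_sqr_ge (g : R -> R) : continuous g ->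
  (\int[mu]_(t in `]0, T]) g t) ^+ 2 <= T * \int[mu]_(t in `]0, T]) (g t) ^+ 2.
Proof.
move=> cg; set D := \int[mu]_(t in `]0, T]) g t.
have cg2 : continuous (fun t => g t ^+ 2).
  exact: continuous_sqr.
(* Cauchy-Schwarz against the constant 1: the square of [g] minus its mean [c] is nonnegative. *)
pose c := D / T.
have cl : continuous (fun t => 2 * c * g t).
  by move=> t; apply: cvgM; [exact: cvg_cst|exact: cg].
have cc : continuous (fun _ : R => c ^+ 2) by exact: cst_continuous.
have cb : continuous (fun t => 2 * c * g t - c ^+ 2).
  by move=> t; apply: cvgB; [exact: cl|exact: cvg_cst].
have h : \int[mu]_(t in `]0, T]) (2 * c * g t - c ^+ 2) <=
    \int[mu]_(t in `]0, T]) (g t) ^+ 2.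
  by apply: Rintegral_itv_le => // t _; have := sqr_ge0 (g t - c); rewrite sqrrB; lra.
move: h; rewrite (Rintegral_itv_subf _ _ cl cc) (Rintegral_itv_scale _ _ _ cg).
rewrite (Rintegral_itv_cst _ (ltW T0)) subr0 -/D => h.
rewrite -ler_pdivrMl//; apply: (le_trans _ h); rewrite le_eqVlt; apply/orP; left.
by apply/eqP; rewrite /c; field; rewrite gt_eqF.
Qed.

(** These are the lags seen at time [T] for delays in [[A, B]]; they are positive because [B < T],
    and compactness does the rest. *)
Lemma sig0_lb : exists2 m, 0 < m & forall u, T - B <= u <= T - A -> m <= sig0 u.
Proof.
have le : T - B <= T - A by move: AB => ?; lra.
have [c] := EVT_min le (continuous_subspaceT (A := `[T - B, T - A]) continuous_sig0).
rewrite in_itv/= => /andP[c1 c2] h; exists (sig0 c).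
  by apply: sig0_gt0; rewrite c2 andbT; move: BT => ?; lra.
by move=> u hu; apply: h; rewrite in_itv.
Qed.

(** By Cauchy-Schwarz it suffices to compare the masses received up to time [T]. At negative lags
    the antiderivative [F] is constant, so the masses differ by [F (T - s) - F (T - s')]: the longer
    delay pushes beyond [T] a stretch of signal of level at least [m]. *)
Lemma shift_gap : exists2 m, 0 < m & forall s s', A <= s <= B -> A <= s' <= B ->
  m * (s - s') ^+ 2 <= \int[mu]_(t in `]0, T]) (sig0 (t - s) - sig0 (t - s')) ^+ 2.
Proof.
have [m m0 hm] := sig0_lb.
have [F dF] := antiderivative (- B) (T - A) continuous_sig0.
exists (m ^+ 2 / T) => [|s s' hs hs']; first by rewrite divr_gt0// exprn_gt0.
have cs a := continuous_shift (s := a) continuous_sig0.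
have E a : A <= a <= B ->
    \int[mu]_(t in `]0, T]) sig0 (t - a) = F (T - a) - F (0 - a).
  move=> /andP[h1 h2]; apply: FTC_shift => //; first exact: continuous_sig0.
  move=> u /andP[u1 u2]; apply: dF; apply/andP; split; lra.
have d1 : exists2 c, T - B <= c <= T - A &
    F (T - s) - F (T - s') = sig0 c * ((T - s) - (T - s')).
  have [|||c [hc _] h] := @MVT_between _ F sig0 (T - B) (T - A) (T - s') (T - s).
  - by move: hs' => /andP[? ?]; apply/andP; split; lra.
  - by move: hs => /andP[? ?]; apply/andP; split; lra.
  - move=> x /andP[? ?]; apply: dF; move: T0 => ?; apply/andP; split; lra.
  by exists c.
have d2 : F (0 - s) - F (0 - s') = 0.
  have [|||c [hc _] ->] := @MVT_between _ F sig0 (- B) (- A) (0 - s') (0 - s).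
  - by move: hs' => /andP[? ?]; apply/andP; split; lra.
  - by move: hs => /andP[? ?]; apply/andP; split; lra.
  - move=> x /andP[? ?]; apply: dF; move: T0 => ?; apply/andP; split; lra.
  rewrite sig0_zero ?mul0r//.
  by case/andP: hc => _; move: A0 => ? ?; lra.
have cg : continuous (fun t => sig0 (t - s) - sig0 (t - s')).
  by move=> t; apply: cvgB; exact: cs.
have := Rintegral_sqr_ge cg.
rewrite (Rintegral_itv_subf _ _ (cs s) (cs s')) (E s hs) (E s' hs').
have [c hc Ec] := d1.
rewrite (_ : F (T - s) - F (0 - s) - _ = sig0 c * (s' - s)); last first.
  rewrite (_ : s' - s = T - s - (T - s')) -?Ec; last by ring.
  by rewrite (subr0_eq d2); ring.
move=> h; rewrite mulrAC ler_pdivrMr// [leRHS]mulrC; apply: le_trans h.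
rewrite exprMn -(sqrrN (s - s')) opprB ler_wpM2r ?sqr_ge0//.
by rewrite lerXn2r ?nnegrE ?sig0_ge0 ?(ltW m0)// hm.
Qed.

(** The same Cauchy-Schwarz bound, applied to the derivative: its integral over []0, T]] is the
    increment of [lam] from [- s] to [T - s], that is [lam (T - s)], which is at least [m]. *)
Lemma info_lb : exists2 i0, 0 < i0 & forall s, A <= s <= B -> i0 <= info s.
Proof.
have [m m0 hm] := sig0_lb; have [C C1 hC] := sig_bounded.
have C0 : 0 < C := lt_le_trans ltr01 C1.
have L0 : 0 < C + lam0 by rewrite addr_gt0.
exists (m ^+ 2 / (T * (C + lam0))) => [|s hs].
  by rewrite divr_gt0 ?exprn_gt0// mulr_gt0.
have c1 := continuous_shift (s := s) continuous_sig1.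
have cq := continuous_shift (s := s) continuous_info_dens.
have := Rintegral_sqr_ge c1.
have As : A <= s by case/andP: hs.
have sB : s <= B by case/andP: hs.
have -> : \int[mu]_(t in `]0, T]) sig1 (t - s) = lam (T - s) - lam (0 - s).
  apply: FTC_shift => //; first exact: continuous_sig1.
  move=> u /andP[u1 u2]; apply: is_derive_lam; apply/andP; split; lra.
rewrite (@lam_zero (0 - s)) ?subr0; last first.
  by move: A0 => ?; apply/andP; split; lra.
move=> h; rewrite ler_pdivrMr ?mulr_gt0//.
apply: (@le_trans _ _ (lam (T - s) ^+ 2)).
  rewrite -sig0E; last by move: T0 A0 => ? ?; apply/andP; split; lra.
  rewrite lerXn2r ?nnegrE ?sig0_ge0 ?(ltW m0)// hm//.
  by apply/andP; split; lra.
apply: (le_trans h); rewrite mulrCA ler_wpM2l ?(ltW T0)//.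
have cq' : continuous (fun t => (C + lam0) * info_dens (t - s)).
  by move=> t; apply: cvgM; [exact: cvg_cst|exact: cq].
rewrite /info mulrC -(Rintegral_itv_scale _ _ _ cq); apply: Rintegral_itv_le => //.
  exact: continuous_sqr.
move=> t ht; have [h0 _ _ _ _] := hC _ (shift_dom hs ht).
rewrite /info_dens mulrCA ler_peMr ?sqr_ge0// ler_pdivlMr ?den_gt0// mul1r.
by rewrite lerD2r (le_trans (ler_norm _)).
Qed.

Lemma info_unif (w : R) : 0 < w -> exists2 r : R, 0 < r & forall s s',
  A <= s <= B -> A <= s' <= B -> `|s - s'| <= r -> `|info s - info s'| <= w.
Proof.
move=> w0; have wT : 0 < w / T by rewrite divr_gt0.
have [r r0 hr] := sig_unif wT; exists r => // s s' hs hs' ss'.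
have cq a := continuous_shift (s := a) continuous_info_dens.
rewrite /info -(Rintegral_itv_subf _ _ (cq s) (cq s')).
have cg : continuous (fun t => info_dens (t - s) - info_dens (t - s')).
  by move=> t; apply: cvgB; exact: cq.
have cc : continuous (fun _ : R => w / T) by exact: cst_continuous.
have bd t : 0 < t <= T -> `|info_dens (t - s) - info_dens (t - s')| <= w / T.
  move=> ht; have [|_ _ _ _ //] := hr (t - s) (t - s') (shift_dom hs ht) (shift_dom hs' ht).
  by rewrite (_ : t - s - (t - s') = - (s - s')) ?normrN//; ring.
apply: (le_trans (Rintegral_itv_abs cg cc bd)).
by rewrite (Rintegral_itv_cst _ (ltW T0)) subr0 mulfVK// gt_eqF.
Qed.

(** The signal is zero on all of [[- B, 0]], so a Taylor expansion between two points of this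
    interval at distance [h] gives [|sig1 u| <= 3 * C * h] for arbitrarily small [h]. The
    derivatives at the endpoints [- B] and 0 are covered as well. *)
Lemma sig1_zero u : u <= 0 -> sig1 u = 0.
Proof.
move=> u0; wlog hu : u u0 / - B <= u => [hw|].
  have B0 : 0 < B := lt_trans A0 AB.
  have [uB|/ltW Bu] := leP (- B) u; first exact: hw.
  rewrite -(hw (- B)) ?lexx// ?oppr_le0 ?ltW// /sig1; congr (derive1 lam _).
  rewrite [RHS]clamp_id ?lexx//.
  by rewrite /clamp (min_idPr _) ?(le_trans Bu BA)// (max_idPl Bu).
have hD x : - B <= x -> x <= 0 -> - B <= x <= T - A.
  by move=> h1 h2; rewrite h1 (le_trans h2)// subr_ge0 ltW// (lt_trans AB).
have [C C0 hC] := continuous_itv_bounded (- B) (T - A) continuous_sig2.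
apply/eqP; rewrite -normr_eq0 eq_le normr_ge0 andbT; apply/ler_addgt0Pl => e e0.
rewrite addr0; have B0 : 0 < B := lt_trans A0 AB.
(* With [h <= B / 2], at least one of the points [u - h] and [u + h] lies in [[- B, 0]]. *)
pose h := Num.min (B / 2) (e / (3 * (C + 1))).
have C1 : 0 < 3 * (C + 1) by rewrite mulr_gt0// ltr_wpDl.
have h0 : 0 < h by rewrite lt_min !divr_gt0.
have hB : h <= B / 2 by rewrite ge_min lexx.
have he : h * (3 * (C + 1)) <= e by rewrite -ler_pdivlMr// ge_min lexx orbT.
have [v [v1 v2 uv]] : exists v, [/\ - B <= v, v <= 0 & `|v - u| = h].
  have [uB|Bu] := leP (- B + h) u.
    exists (u - h); split; [lra|lra|].
    by rewrite (_ : u - h - u = - h) ?normrN ?gtr0_norm//; ring.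
  exists (u + h); split; [lra|lra|].
  by rewrite (_ : u + h - u = h) ?gtr0_norm//; ring.
have := @sig_taylor u v (2 * C) (hD u hu u0) (hD v v1 v2).
move=> /(_ _)H; have {}H := H _.
have {H} : `|sig0 v - sig0 u - (v - u) * sig1 u - (v - u) ^+ 2 / 2 * sig2 u| <=
    2 * C * (v - u) ^+ 2.
  apply: H => x hx _; rewrite (le_trans (ler_normB _ _))// mulr_natl mulr2n.
  by apply: lerD; apply: hC => //; exact: hD.
rewrite (sig0_zero u0) (sig0_zero v2) subrr sub0r -opprD normrN.
have c2 : `|(v - u) ^+ 2 / 2 * sig2 u| <= h ^+ 2 * C.
  have q : `|(v - u) ^+ 2 / 2| <= h ^+ 2.
    rewrite normrM normrX uv ger0_norm ?sqr_ge0//.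
    by have := sqr_ge0 h; lra.
  by rewrite normrM ler_pM//; exact/hC/hD.
have E : (v - u) ^+ 2 = h ^+ 2 by rewrite -uv real_normK// num_real.
rewrite E in c2 * => c1.
have c3 : h * `|sig1 u| <= h * (3 * C * h).
  rewrite -{1}uv -normrM.
  move: ((v - u) * sig1 u) (h ^+ 2 / 2 * sig2 u) c1 c2 => a b c1 c2.
  by have := lerB_normD a b; lra.
rewrite (ler_pM2l h0) in c3; apply: (le_trans c3).
by apply: (le_trans _ he); nra.
Qed.

Lemma fisher_tauE s : A <= s <= B -> fisher_tau lam lam0 T s = info s.
Proof.
move=> /[dup] hs /andP[As sB]; have s0 : 0 < s := lt_le_trans A0 As.
have sT : s < T := le_lt_trans sB BT.
have cq := continuous_shift (s := s) continuous_info_dens.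
rewrite /info (Rintegral_itvD cq (ltW s0) (ltW sT)).
rewrite (@Rintegral_itv_eq _ _ (fun=> 0) 0 s); last first.
  by move=> t /andP[_ ts]; rewrite /info_dens sig1_zero ?expr0n ?mul0r// subr_le0.
rewrite (Rintegral_itv_cst _ (ltW s0)) mul0r add0r.
rewrite Rintegral_itv_obnd_cbnd; last exact: continuous_integrable.
apply: eq_Rintegral => t; rewrite inE/= in_itv/= => /andP[st tT].
have D : - B <= t - s <= T - A.
  by apply/andP; split; move: As sB A0 tT st => ? ? ? ? ?; lra.
by rewrite /info_dens (sig0E D) /sig1 (clamp_id D).
Qed.

Lemma rate_bound : exists2 L, 1 <= L & forall s t, A <= s <= B -> 0 < t <= T ->
  0 < rate s t <= L.
Proof.
have [C C1 hC] := sig_bounded; exists (C + lam0) => [|s t hs ht].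
  by rewrite (le_trans C1)// lerDl ltW.
rewrite rate_gt0 /rate lerD2r (le_trans (ler_norm _))//.
by have [] := hC _ (shift_dom hs ht).
Qed.

Lemma expR_logr0 u : expR (logr0 u) = (sig0 u + lam0) / lam0.
Proof.
rewrite /logr0 lnK ?posrE; last by rewrite ltr_pwDl// divr_ge0 ?sig0_ge0// ltW.
by rewrite mulrDl divff ?gt_eqF// addrC.
Qed.

(** * Deviations of the likelihood and consistency of the estimator *)

Context {d : measure_display} {Om : measurableType d}.
Implicit Types (P : probability Om R) (Y : Om -> seq R) (that : Om -> R).

Definition obs P Y n s := poisson_obs T P Y (fun t => n%:R * rate s t).

Lemma continuous_nrate n s : continuous (fun t => n%:R * rate s t).
Proof. by apply: continuousZ_fun; exact: continuous_rate. Qed.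

Lemma centered_dev Y f s n w : continuous f ->
  centered T Y (fun t => n%:R * rate s t) f w = dev f s n (Y w).
Proof.
move=> cf; rewrite /centered /dev; congr (_ - _).
rewrite -Rintegral_itv_scale; last by apply: continuousM_fun => //; exact: continuous_rate.
by apply: Rintegral_itv_eq => t _; ring.
Qed.

Lemma measurable_ell P Y n s a : obs P Y n s ->
  measurable_fun setT (fun w => ell n a (Y w)).
Proof.
move=> PY; apply: measurable_funB => //.
by apply: PY.1; apply: continuous_shift; exact: continuous_logr0.
Qed.

(* Chernoff's bound at exponent 1/2: the moment generating function of the log
   likelihood ratio is there the Hellinger affinity. *)
Lemma hellinger_bound : exists2 c0, 0 < c0 & forall P Y n s a (y : R),
  A <= s <= B -> A <= a <= B -> obs P Y n s ->
  (P [set w | (ell n s (Y w) - n%:R * y <= ell n a (Y w))%R] <=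
    (expR (n%:R * (y / 2 - c0 * (a - s) ^+ 2)))%:E)%E.
Proof.
have [m m0 hm] := shift_gap; have [L L1 hL] := rate_bound.
have L0 : 0 < L := lt_le_trans ltr01 L1.
exists (m / (8 * L)) => [|P Y n s a y hs ha PY]; first by rewrite divr_gt0// mulr_gt0.
pose S w := 2^-1 * (ell n a (Y w) - ell n s (Y w)).
have mS : measurable_fun setT S.
  apply: measurable_funM => //; apply: measurable_funB; exact: measurable_ell PY.
have -> : [set w | (ell n s (Y w) - n%:R * y <= ell n a (Y w))%R] =
    [set w | (- (n%:R * y / 2) <= S w)%R].
  by apply/seteqP; split=> w; rewrite /= /S; lra.
apply: (le_trans (chernoff _ _ mS)).
pose f t := 2^-1 * (logr0 (t - a) - logr0 (t - s)).
have cl b := continuous_shift (s := b) continuous_logr0.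
have cs b := continuous_shift (s := b) continuous_sig0.
have cf : continuous f.
  by apply: continuousZ_fun => t; apply: cvgB; exact: cl.
pose D := \int[mu]_(t in `]0, T]) sig0 (t - a) - \int[mu]_(t in `]0, T]) sig0 (t - s).
have SE w : expR (S w) = expR (- (n%:R / 2 * D)) * expR (pint T f (Y w)).
  rewrite -expRD /S /ell /f pintZ pintB /D; congr expR.
  do 2 move: (pint _ _ _) => ?; do 2 move: (Rintegral _ _ _) => ?; by field.
under eq_integral do rewrite SE EFinM.
rewrite ge0_integralZl//=; last by apply/measurable_EFinP/measurableT_comp => //; exact: PY.1.
rewrite PY.2// -!EFinM -!expRD lee_fin ler_expR opprK.
have cg : continuous (fun t => (sig0 (t - a) - sig0 (t - s)) ^+ 2).
  by apply: continuous_sqr => t; apply: cvgB; exact: cs.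
have cdiff : continuous (fun t => sig0 (t - a) - sig0 (t - s)).
  by move=> t; apply: cvgB; exact: cs.
have cnr : continuous (fun t => n%:R * rate s t) by exact: continuous_nrate.
have ce : continuous (fun t => (expR (f t) - 1) * (n%:R * rate s t)).
  apply: continuousM_fun => // t; apply: cvgB; last exact: cvg_cst.
  exact: (continuous_expR_fun cf).
have key : \int[mu]_(t in `]0, T]) ((expR (f t) - 1) * (n%:R * rate s t)) <=
    n%:R / 2 * D - n%:R * (m / (8 * L) * (a - s) ^+ 2).
  apply: (@le_trans _ _ (\int[mu]_(t in `]0, T])
    (n%:R / 2 * (sig0 (t - a) - sig0 (t - s)) -
     n%:R / (8 * L) * (sig0 (t - a) - sig0 (t - s)) ^+ 2))).
    have cZ1 := continuousZ_fun (c := n%:R / 2) cdiff.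
    have cZ2 := continuousZ_fun (c := n%:R / (8 * L)) cg.
    apply: Rintegral_itv_le => //.
      by move=> t; apply: cvgB; [exact: cZ1|exact: cZ2].
    move=> t ht; have /andP[a0 aL] := hL a t ha ht; have /andP[b0 bL] := hL s t hs ht.
    (* [p] and [q] are the square roots of the two intensities over [lam0]. The inequality rests on
       [p * q - q ^ 2 = (p ^ 2 - q ^ 2) / 2 - (p - q) ^ 2 / 2] and on [lam0 * (p + q) ^ 2 <= 4 * L],
       which bounds [(p - q) ^ 2] below by the squared difference of the intensities. *)
    pose p := expR (2^-1 * logr0 (t - a)); pose q := expR (2^-1 * logr0 (t - s)).
    have q0 : 0 < q := expR_gt0 _.
    have sqE u : expR (2^-1 * logr0 u) ^+ 2 = (sig0 u + lam0) / lam0.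
      by rewrite -expRM_natl mulrA divff// mul1r expR_logr0.
    have pE : rate a t = lam0 * p ^+ 2 by rewrite /p sqE mulrC mulfVK ?gt_eqF.
    have qE : rate s t = lam0 * q ^+ 2 by rewrite /q sqE mulrC mulfVK ?gt_eqF.
    have fE : expR (f t) = p / q by rewrite /f mulrBr expRB.
    have dE : sig0 (t - a) - sig0 (t - s) = lam0 * p ^+ 2 - lam0 * q ^+ 2.
      by rewrite -pE -qE /rate; ring.
    rewrite dE fE qE (_ : (p / q - 1) * (n%:R * (lam0 * q ^+ 2)) =
      n%:R * (lam0 * (p * q - q ^+ 2))); last by field; rewrite gt_eqF.
    rewrite -[leRHS](_ : n%:R * ((lam0 * p ^+ 2 - lam0 * q ^+ 2) / 2 -
      (lam0 * p ^+ 2 - lam0 * q ^+ 2) ^+ 2 / (8 * L)) = _); last first.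
      by field; rewrite gt_eqF.
    rewrite ler_wpM2l//.
    have : (lam0 * p ^+ 2 - lam0 * q ^+ 2) ^+ 2 / (8 * L) <= lam0 * (p - q) ^+ 2 / 2.
      rewrite ler_pdivrMr ?mulr_gt0//.
      have -> : (lam0 * p ^+ 2 - lam0 * q ^+ 2) ^+ 2 =
        lam0 * (p - q) ^+ 2 * (lam0 * (p + q) ^+ 2) by ring.
      have pq0 : 0 <= lam0 * (p - q) ^+ 2 := mulr_ge0 (ltW l00) (sqr_ge0 _).
      rewrite [leRHS](_ : _ = lam0 * (p - q) ^+ 2 * (4 * L)); last by field.
      rewrite (ler_wpM2l pq0)//; move: pq0.
      by move: aL bL; rewrite pE qE; lra.
    by lra.
  have cZ1 := continuousZ_fun (c := n%:R / 2) cdiff.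
  have cZ2 := continuousZ_fun (c := n%:R / (8 * L)) cg.
  rewrite (Rintegral_itv_subf _ _ cZ1 cZ2) (Rintegral_itv_scale _ _ _ cdiff).
  rewrite (Rintegral_itv_scale _ _ _ cg) (Rintegral_itv_subf _ _ (cs a) (cs s)) -/D.
  rewrite lerD2l lerN2 [leLHS](_ : _ = n%:R / (8 * L) * (m * (a - s) ^+ 2)); last first.
    by field; rewrite gt_eqF.
  by rewrite ler_wpM2l ?divr_ge0 ?mulr_ge0 ?(ltW L0)// hm.
by move: key; move: (Rintegral _ _ _) => I; clearbody D => key; lra.
Qed.

(** Controls the log-likelihood between the nodes of a grid; the path enters through its number of
    events only. *)
Lemma ell_lipschitz (w : R) : 0 < w -> exists2 r, 0 < r & forall n a b x,
  A <= a <= B -> A <= b <= B -> `|a - b| <= r ->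
  `|ell n a x - ell n b x| <= w * (pint T (fun=> 1) x + n%:R * T).
Proof.
move=> w0; have [r r0 hr] := sig_unif w0; exists r => // n a b x ha hb ab.
have cs c := continuous_shift (s := c) continuous_sig0.
have sh t : 0 < t <= T -> `|(t - a) - (t - b)| <= r.
  by move=> _; rewrite (_ : _ - _ = - (a - b)) ?normrN//; ring.
have cc : continuous (fun _ : R => w) by exact: cst_continuous.
have cg : continuous (fun t => sig0 (t - a) - sig0 (t - b)).
  by move=> t; apply: cvgB; exact: cs.
have -> : ell n a x - ell n b x = pint T (fun t => logr0 (t - a) - logr0 (t - b)) x -
    n%:R * \int[mu]_(t in `]0, T]) (sig0 (t - a) - sig0 (t - b)).
  rewrite (Rintegral_itv_subf _ _ (cs a) (cs b)) pintB /ell.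
  do 2 move: (pint _ _ _) => ?; do 2 move: (Rintegral _ _ _) => ?; by ring.
rewrite (le_trans (ler_normB _ _))// mulrDr lerD//.
  rewrite -pint_cst; apply: pint_le => t ht.
  by have [] := hr _ _ (shift_dom ha ht) (shift_dom hb ht) (sh t ht).
rewrite normrM ger0_norm// mulrCA ler_wpM2l//.
have bd t : 0 < t <= T -> `|sig0 (t - a) - sig0 (t - b)| <= w.
  move=> ht.
  by have [] := hr _ _ (shift_dom ha ht) (shift_dom hb ht) (sh t ht).
apply: (le_trans (Rintegral_itv_abs cg cc bd)).
by rewrite (Rintegral_itv_cst _ (ltW T0)) subr0.
Qed.

Definition mle Y n that := measurable_fun setT that /\
  forall w, A <= that w <= B /\
    forall s, A <= s <= B -> ell n s (Y w) <= ell n (that w) (Y w).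

Lemma grid_cover (r : R) : 0 < r -> exists N, forall s, A <= s <= B ->
  exists i : 'I_N.+2, A <= A + (B - A) * (i%:R / N.+1%:R) <= B /\
    `|A + (B - A) * (i%:R / N.+1%:R) - s| <= r.
Proof.
move=> r0; have BA0 : 0 < B - A by rewrite subr_gt0.
have q0 : 0 < r / (B - A) by rewrite divr_gt0.
have [N hN] : exists N, N.+1%:R^-1 < r / (B - A).
  have /cvgrPdist_lt/(_ _ q0) := @cvg_harmonic R.
  by case=> N _ /(_ N (leqnn N)) /=; rewrite sub0r normrN ger0_norm// => h; exists N.
exists N => s /andP[sA sB].
have N0 : 0 < N.+1%:R :> R by rewrite ltr0n.
pose v := (s - A) / (B - A) * N.+1%:R.
have v0 : 0 <= v by rewrite mulr_ge0// divr_ge0 ?subr_ge0// ltW.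
have vN : v <= N.+1%:R.
  by rewrite ler_piMl// ler_pdivrMr// mul1r lerD2r.
have /andP[t1 t2] := truncn_itv v0.
have tN : (Num.truncn v < N.+2)%N.
  by rewrite ltnS -(ler_nat R) (le_trans t1).
exists (Ordinal tN) => /=; set c : R := (Num.truncn v)%:R / N.+1%:R.
have c0 : 0 <= c by rewrite divr_ge0.
have c1 : c <= 1 by rewrite ler_pdivrMr// mul1r ler_nat.
split.
  rewrite lerDl mulr_ge0 ?(ltW BA0)//=.
  by rewrite -lerBrDl ler_piMr// ltW.
have sE : s = A + (B - A) * (v / N.+1%:R).
  by rewrite /v; field; rewrite !gt_eqF.
rewrite [X in `|_ - X|]sE (_ : A + (B - A) * c - _ = (B - A) * (c - v / N.+1%:R)); last by ring.
rewrite normrM (gtr0_norm BA0) -ler_pdivlMl// [leRHS]mulrC (le_trans _ (ltW hN))//.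
rewrite distrC /c -mulrBl ger0_norm ?divr_ge0 ?subr_ge0//.
rewrite ler_pdivrMr// mulVf ?gt_eqF// lerBlDl natr1.
exact: ltW.
Qed.

Lemma deviation_bound (eta Cf : R) : 0 < eta -> 0 <= Cf ->
  exists2 c, 0 < c & forall P Y n s f, A <= s <= B -> obs P Y n s -> continuous f ->
    (forall t, 0 < t <= T -> `|f t| <= Cf) ->
    measurable [set w | (eta * n%:R <= `|dev f s n (Y w)|)%R] /\
    (P [set w | (eta * n%:R <= `|dev f s n (Y w)|)%R] <=
      (2 * expR (- (c * n%:R)))%:E)%E.
Proof.
move=> eta0 Cf0; have [L L1 hL] := rate_bound.
have L0 : 0 <= L := le_trans ler01 L1.
have [c c0 hc] := @deviation_tail d Om R T T0 Cf L eta Cf0 L0 eta0.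
exists c => // P Y n s f hs PY cf fC.
have cnr : continuous (fun t => n%:R * rate s t) by exact: continuous_nrate.
have E : [set w | (eta * n%:R <= `|dev f s n (Y w)|)%R] =
    [set w | (eta * n%:R <= `|centered T Y (fun t => n%:R * rate s t) f w|)%R].
  by apply/seteqP; split=> w /=; rewrite centered_dev.
rewrite E; split.
  have mc := measurable_centered PY cf.
  apply: measurable_ge_set; exact: (measurableT_comp (@normr_measurable R setT) mc).
apply: (hc P Y n%:R _ f PY cnr cf) => // t ht.
by have /andP[r0 rL] := hL s t hs ht; rewrite mulr_ge0 ?ler_wpM2l// ltW.
Qed.

Lemma count_bound : exists2 Cn, 0 < Cn & forall n s x, A <= s <= B ->
  `|dev (fun=> 1) s n x| <= n%:R -> pint T (fun=> 1) x <= Cn * n%:R.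
Proof.
have [L L1 hL] := rate_bound; have L0 : 0 < L := lt_le_trans ltr01 L1.
exists (T * L + 1) => [|n s x hs]; first by rewrite addr_gt0 ?mulr_gt0.
rewrite /dev ler_norml => /andP[_ h].
have I1 : \int[mu]_(t in `]0, T]) (1 * rate s t) <= T * L.
  apply: (@le_trans _ _ (\int[mu]_(t in `]0, T]) L)).
    apply: Rintegral_itv_le; first by apply: continuousZ_fun; exact: continuous_rate.
      exact: cst_continuous.
    by move=> t ht; rewrite mul1r; have /andP[] := hL s t hs ht.
  by rewrite (Rintegral_itv_cst _ (ltW T0)) subr0 mulrC.
have : n%:R * \int[mu]_(t in `]0, T]) (1 * rate s t) <= n%:R * (T * L).
  by rewrite ler_wpM2l.
by move: h; move: (n%:R * Rintegral _ _ _) (pint _ _ _) => u v; lra.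
Qed.

(** Union bound over a finite grid. If the error is at least [rho], the node nearest to the
    estimator is at distance at least [rho / 2] from [s], and its log-likelihood is at least
    [ell n s - n * y] unless there are too many events; [hellinger_bound] applies to each such
    node. *)
Lemma consistency (rho : R) : 0 < rho ->
  exists2 K, 0 <= K & exists2 c, 0 < c & forall P Y n s that,
    A <= s <= B -> obs P Y n s -> mle Y n that ->
    measurable [set w | (rho <= `|that w - s|)%R] /\
    (P [set w | (rho <= `|that w - s|)%R] <= (K * expR (- (c * n%:R)))%:E)%E.
Proof.
move=> rho0; have [c0 c00 hell] := hellinger_bound.
have [Cn Cn0 hcnt] := count_bound.
have [c1 c10 hdev] := deviation_bound ltr01 ler01.
have CT : 0 < Cn + T by rewrite addr_gt0.
(* Calibrated so that [y = wl * (Cn + T)] equals [c0 * rho ^ 2 / 4], the Hellinger exponent at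
   distance [rho / 2]. As [y] enters with the factor [1 / 2], half of this exponent is left, which
   is [c2]. *)
pose wl := c0 * rho ^+ 2 / (4 * (Cn + T)).
have wl0 : 0 < wl by rewrite divr_gt0 ?mulr_gt0// exprn_gt0.
have [r r0 hlip] := ell_lipschitz wl0.
have r'0 : 0 < Num.min r (rho / 2) by rewrite lt_min r0 divr_gt0.
have [N hN] := grid_cover r'0.
pose c2 := c0 * rho ^+ 2 / 8.
have c20 : 0 < c2 by rewrite divr_gt0 ?mulr_gt0 ?exprn_gt0.
(* One term per node of the grid, and 2 for the deviation of the number of events. *)
exists (N.+2%:R + 2); first by rewrite addr_ge0.
exists (Num.min c1 c2); first by rewrite lt_min c10.
move=> P Y n s that hs PY [mthat hthat].
have mbad : measurable [set w | (rho <= `|that w - s|)%R].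
  apply: measurable_ge_set; apply: measurableT_comp => //.
  exact: measurable_funB.
split=> //.
pose gp (i : 'I_N.+2) := A + (B - A) * (i%:R / N.+1%:R).
have cst1 : continuous (fun _ : R => 1 : R) by exact: cst_continuous.
have n1 t : 0 < t <= T -> `|1 : R| <= 1 by rewrite normr1.
have [mD hD] := hdev P Y n s (fun=> 1) hs PY cst1 n1.
rewrite mul1r in mD hD.
pose y := wl * (Cn + T).
pose E i : set Om := if (A <= gp i <= B) && (rho / 2 <= `|gp i - s|)
  then [set w | (ell n s (Y w) - n%:R * y <= ell n (gp i) (Y w))%R] else set0.
have mE i : measurable (E i).
  rewrite /E; case: ifPn => // _.
  have -> : [set w | (ell n s (Y w) - n%:R * y <= ell n (gp i) (Y w))%R] =
      [set w | (- (n%:R * y) <= ell n (gp i) (Y w) - ell n s (Y w))%R].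
    by apply/seteqP; split=> w /=; lra.
  apply: measurable_ge_set; apply: measurable_funB; exact: measurable_ell PY.
have hE i : (P (E i) <= (expR (- (c2 * n%:R)))%:E)%E.
  rewrite /E; case: ifPn => [/andP[hg hd]|_]; last by rewrite measure0 lee_fin expR_ge0.
  apply: (le_trans (hell P Y n s (gp i) y hs hg PY)).
  rewrite lee_fin ler_expR [leLHS]mulrC -[leRHS]mulNr ler_wpM2r//.
  have d2 : rho ^+ 2 / 4 <= (gp i - s) ^+ 2.
    rewrite -(real_normK (num_real (gp i - s))) (_ : rho ^+ 2 / 4 = (rho / 2) ^+ 2).
      by rewrite lerXn2r ?nnegrE// divr_ge0// ltW.
    by field.
  have : c0 * (rho ^+ 2 / 4) <= c0 * (gp i - s) ^+ 2 by rewrite ler_wpM2l// ltW.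
  have yE : y = c0 * rho ^+ 2 / 4 by rewrite /y /wl; field; rewrite gt_eqF.
  by rewrite yE /c2; lra.
have [mU hU] := measure_bigsetU_le (index_enum _) mE hE.
apply: (@le_trans _ _ (P ([set w | (n%:R <= `|dev (fun=> 1) s n (Y w)|)%R] `|`
    \big[setU/set0]_i E i))).
  apply: le_measure; rewrite ?inE//; first exact: measurableU.
  move=> w /= bad; have [hw1 hw2] := hthat w.
  have [i [gi1 gi2]] := hN _ hw1; rewrite -/(gp i) in gi1 gi2.
  have [hc|hc] := leP n%:R `|dev (fun=> 1) s n (Y w)|; [by left|right].
  rewrite -bigcup_seq; exists i; first by rewrite /= mem_index_enum.
  have gr : `|gp i - that w| <= r by rewrite (le_trans gi2)// ge_min lexx.
  have gr2 : `|gp i - that w| <= rho / 2 by rewrite (le_trans gi2)// ge_min lexx orbT.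
  rewrite /E gi1 /=; case: ifPn => [_|]; last first.
    rewrite -ltNge => hlt; exfalso; have := ler_distD (gp i) (that w) s.
    by rewrite distrC in gr2; lra.
  have cnt : pint T (fun=> 1) (Y w) <= Cn * n%:R by apply: hcnt hs (ltW hc).
  have := hlip n _ _ (Y w) gi1 hw1 gr; have := hw2 s hs.
  have : wl * (pint T (fun=> 1) (Y w) + n%:R * T) <= n%:R * y.
    rewrite /y mulrCA ler_wpM2l ?(ltW wl0)//.
    by rewrite mulrDr lerD2r [leRHS]mulrC.
  rewrite /=; move: (wl * _) (n%:R * y) => u v; move: (ell n s (Y w)) => a.
  move: (ell n (gp i) (Y w)) (ell n (that w) (Y w)) => b e /=.
  by rewrite ler_norml => ? ? /andP[? ?]; lra.
apply: (le_trans (measureU2 _ mD mU)).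
apply: (le_trans (leeD hD hU)); rewrite -EFinD lee_fin.
have e1 : expR (- (c1 * n%:R)) <= expR (- (Num.min c1 c2 * n%:R)).
  by rewrite ler_expR lerN2 ler_wpM2r// ge_min lexx.
have e2 : expR (- (c2 * n%:R)) <= expR (- (Num.min c1 c2 * n%:R)).
  by rewrite ler_expR lerN2 ler_wpM2r// ge_min lexx orbT.
rewrite sumr_const card_ord -[X in _ + X <= _]mulr_natl [leRHS]mulrDl [leRHS]addrC.
by apply: lerD; rewrite ler_wpM2l.
Qed.

(** The maximiser of the quadratic part of [ell_expand] once the second derivative is replaced by
    its mean. *)
Definition step n s x : R :=
  - dev (fun t => logr1 (t - s)) s n x / (n%:R * info s).

(** The exceptional event is a union of four: the estimator is at distance at least [rho] from [s],
    or one of the number of events, the second derivative and the score deviates too much. The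
    margin [mgn] keeps [s + step] inside [[A, B]], where the maximiser can be compared with it. *)
Lemma linearisation (eps mgn : R) : 0 < eps <= 1 -> 0 < mgn ->
  exists2 K, 0 <= K & exists2 c, 0 < c & forall P Y n s that, (0 < n)%N ->
    A + mgn <= s <= B - mgn -> obs P Y n s -> mle Y n that ->
    exists E : set Om, [/\ measurable E, (P E <= (K * expR (- (c * n%:R)))%:E)%E &
      forall w, ~ E w ->
        (that w - s - step n s (Y w)) ^+ 2 <= eps * (step n s (Y w)) ^+ 2].
Proof.
move=> heps mgn0; have [i0 i00 hi] := info_lb.
have [C C1 hC] := sig_bounded; have C0 : 0 <= C := le_trans ler01 C1.
have [Cn Cn0 hcnt] := count_bound.
have CT : 0 < Cn + T + 1 by rewrite !addr_gt0.
(* The oscillation allowed by [argmax_linearisation], made uniform in [s] by the lower bound [i0] on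
   the information. *)
pose om := i0 * eps / (12 * (Cn + T + 1)).
have om0 : 0 < om by rewrite divr_gt0 ?mulr_gt0//; case/andP: heps.
have [r r0 hr] := sig_unif om0.
pose rho := Num.min r mgn.
have rho0 : 0 < rho by rewrite lt_min r0.
have [K1 K10 [c1 c10 h1]] := consistency rho0.
have [c2 c20 h2] := deviation_bound ltr01 ler01.
have [c3 c30 h3] := deviation_bound om0 C0.
(* A score below [rho * i0 * n] in absolute value makes [step] smaller than [rho]. *)
have eta0 : 0 < rho * i0 by rewrite mulr_gt0.
have [c4 c40 h4] := deviation_bound eta0 C0.
pose c := Num.min (Num.min c1 c2) (Num.min c3 c4).
exists (K1 + 2 + 2 + 2); first by rewrite !addr_ge0.
exists c; first by rewrite !lt_min c10 c20 c30 c40.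
move=> P Y n s that n0 hsm PY hm.
have n0' : 0 < n%:R :> R by rewrite ltr0n.
have hs : A <= s <= B by move/andP: hsm => [? ?]; apply/andP; split; lra.
have cl1 := continuous_shift (s := s) continuous_logr1.
have cl2 := continuous_shift (s := s) continuous_logr2.
have cst1 : continuous (fun _ : R => 1 : R) by exact: cst_continuous.
have n1 t : 0 < t <= T -> `|1 : R| <= 1 by rewrite normr1.
have bl1 t : 0 < t <= T -> `|logr1 (t - s)| <= C.
  by move=> ht; have [] := hC _ (shift_dom hs ht).
have bl2 t : 0 < t <= T -> `|logr2 (t - s)| <= C.
  by move=> ht; have [_ _ _ _ []] := hC _ (shift_dom hs ht).
have [m1 p1] := h1 P Y n s that hs PY hm.
have [m2 p2] := h2 P Y n s _ hs PY cst1 n1.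
have [m3 p3] := h3 P Y n s _ hs PY cl2 bl2.
have [m4 p4] := h4 P Y n s _ hs PY cl1 bl1.
set E1 := [set w | _] in m1 p1; set E2 := [set w | _] in m2 p2.
set E3 := [set w | _] in m3 p3; set E4 := [set w | _] in m4 p4.
exists (E1 `|` E2 `|` E3 `|` E4); split.
- by do !apply: measurableU.
- have ce (a : R) : c <= a -> expR (- (a * n%:R)) <= expR (- (c * n%:R)).
    by move=> ca; rewrite ler_expR lerN2 ler_wpM2r.
  have le1 : c <= c1 by rewrite !ge_min lexx.
  have le2 : c <= c2 by rewrite !ge_min lexx !orbT.
  have le3 : c <= c3 by rewrite !ge_min lexx !orbT.
  have le4 : c <= c4 by rewrite !ge_min lexx !orbT.
  have u3 : measurable (E1 `|` E2 `|` E3) by do !apply: measurableU.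
  have u2 : measurable (E1 `|` E2) by apply: measurableU.
  have q (a K : R) (E : set Om) : c <= a -> 0 <= K ->
      (P E <= (K * expR (- (a * n%:R)))%:E)%E ->
      (P E <= (K * expR (- (c * n%:R)))%:E)%E.
    move=> ca K0 h; apply: (le_trans h); rewrite lee_fin.
    by apply: ler_wpM2l => //; exact: ce.
  apply: (le_trans (measureU2 _ u3 m4)).
  rewrite mulrDl EFinD; apply: leeD; last exact: q p4.
  apply: (le_trans (measureU2 _ u2 m3)).
  rewrite mulrDl EFinD; apply: leeD; last exact: q p3.
  apply: (le_trans (measureU2 _ m1 m2)).
  by rewrite mulrDl EFinD; apply: leeD; [exact: q p1|exact: q p2].
move=> w /not_orP[/not_orP[/not_orP[e1 e2] e3] e4].
have {}e1 : `|that w - s| < rho by rewrite ltNge; apply/negP.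
have {}e2 : `|dev (fun=> 1) s n (Y w)| < 1 * n%:R by rewrite ltNge; apply/negP.
have {}e3 : `|dev (fun t => logr2 (t - s)) s n (Y w)| < om * n%:R.
  by rewrite ltNge; apply/negP.
have {}e4 : `|dev (fun t => logr1 (t - s)) s n (Y w)| < rho * i0 * n%:R.
  by rewrite ltNge; apply/negP.
have I0 : 0 < info s := lt_le_trans i00 (hi s hs).
have gs : `|step n s (Y w)| < rho.
  rewrite /step normrM normrN normfV (gtr0_norm (mulr_gt0 n0' I0)).
  rewrite ltr_pdivrMr ?mulr_gt0// (lt_le_trans e4)//.
  rewrite -mulrA [i0 * _]mulrC; apply: ler_wpM2l; first exact: ltW.
  by apply: ler_wpM2l; [exact: ltW|exact: hi].
have rr : rho <= r by rewrite ge_min lexx.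
have rm : rho <= mgn by rewrite ge_min lexx orbT.
have [_ hmw] := hm; have [ht hmax] := hmw w.
have hst : A <= s + step n s (Y w) <= B.
  move: gs; rewrite ltr_norml => /andP[? ?].
  by move/andP: hsm => [? ?]; apply/andP; split; lra.
have sE : s + (that w - s) = that w by rewrite addrC subrK.
apply: (@argmax_linearisation n s (that w - s) om r Cn eps (Y w)) => //.
- exact: ltW.
- by rewrite sE.
- by rewrite ltW// (lt_le_trans e1).
- by rewrite ltW// (lt_le_trans gs).
- by move=> u v hu hv huv; have [_ ? _ ? _] := hr u v hu hv huv.
- by rewrite sE; exact: hmax.
- by apply: hcnt hs _; rewrite ltW// -[ltRHS]mul1r.
- exact: ltW.
- rewrite (_ : om * (Cn + T + 1) = i0 * eps / 12); last first.
    by rewrite /om; field; rewrite gt_eqF.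
  by rewrite !ler_wpM2r//; [case/andP: heps => /ltW|exact: hi].
Qed.

(** The factor that turns the compensated integral of [logr1] into [a * sqrt n * step]; it is of
    order [1 / sqrt n]. *)
Definition tilt n s (a : R) : R := - (a * (Num.sqrt n%:R / (n%:R * info s))).

(** Logarithm of the moment generating function of [sqrt n * step] at [a]. *)
Definition cumulant n s (a : R) : R :=
  \int[mu]_(t in `]0, T]) ((expR (tilt n s a * logr1 (t - s)) - 1 -
     tilt n s a * logr1 (t - s)) * (n%:R * rate s t)).

Lemma step_centered Y n s (a : R) w :
  a * (Num.sqrt n%:R * step n s (Y w)) =
  tilt n s a * centered T Y (fun t => n%:R * rate s t) (fun t => logr1 (t - s)) w.
Proof.
rewrite centered_dev; last by apply: continuous_shift; exact: continuous_logr1.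
by rewrite /step /tilt; ring.
Qed.

Lemma step_mgf P Y n s (a : R) : obs P Y n s ->
  P.-integrable setT (fun w => (expR (a * (Num.sqrt n%:R * step n s (Y w))))%:E) /\
  \int[P]_w expR (a * (Num.sqrt n%:R * step n s (Y w))) = expR (cumulant n s a).
Proof.
move=> PY; have cl1 := continuous_shift (s := s) continuous_logr1.
have cnr : continuous (fun t => n%:R * rate s t) by exact: continuous_nrate.
have E : (fun w => expR (a * (Num.sqrt n%:R * step n s (Y w)))) =
    (fun w => expR (tilt n s a * centered T Y (fun t => n%:R * rate s t)
       (fun t => logr1 (t - s)) w)).
  by apply/funext => w; rewrite step_centered.
split; last by rewrite E (centered_Rmgf cnr PY _ cl1).
have i := integrable_centered_exp cnr PY (tilt n s a) cl1.
rewrite (_ : (fun w => _) = (fun w => (expR (tilt n s a *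
  centered T Y (fun t => n%:R * rate s t) (fun t => logr1 (t - s)) w))%:E)) //.
by apply/funext => w; rewrite step_centered.
Qed.

Lemma tilt_bound (a : R) : exists N, forall n s, (N <= n)%N -> A <= s <= B ->
  [/\ (0 < n)%N, `|tilt n s a| <= 1 & n%:R * (tilt n s a) ^+ 2 = (a / info s) ^+ 2].
Proof.
have [i0 i00 hi] := info_lb.
exists (Num.truncn ((a / i0) ^+ 2)).+1 => n s nN hs.
have n0 : (0 < n)%N by exact: leq_trans nN.
have n0' : 0 < n%:R :> R by rewrite ltr0n.
have s0 : 0 < Num.sqrt n%:R :> R by rewrite sqrtr_gt0.
have I0 : 0 < info s := lt_le_trans i00 (hi s hs).
have an : (a / i0) ^+ 2 <= n%:R.
  rewrite ltW//; apply: (@lt_le_trans _ _ (Num.truncn ((a / i0) ^+ 2)).+1%:R).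
    by have /andP[] := truncn_itv (sqr_ge0 (a / i0)).
  by rewrite ler_nat.
have tE : n%:R * (tilt n s a) ^+ 2 = (a / info s) ^+ 2.
  rewrite /tilt sqrrN exprMn expr_div_n sqr_sqrtr ?ltW// !expr_div_n exprMn.
  by field; rewrite !gt_eqF.
split=> //.
have : n%:R * (tilt n s a) ^+ 2 <= n%:R.
  rewrite tE (le_trans _ an)// !expr_div_n ler_wpM2l ?sqr_ge0//.
  rewrite lef_pV2 ?posrE ?exprn_gt0// lerXn2r ?nnegrE ?(ltW i00) ?(ltW I0) ?hi//.
rewrite -[leRHS]mulr1 ler_pM2l// -(real_normK (num_real (tilt n s a))).
by rewrite -[in leRHS](expr1n R 2) ler_pXn2r ?nnegrE.
Qed.

Lemma cumulant_ub (a : R) : exists N (Cb : R), forall n s, (N <= n)%N ->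
  A <= s <= B -> cumulant n s a <= Cb.
Proof.
have [i0 i00 hi] := info_lb; have [N hN] := tilt_bound a.
have [C C1 hC] := sig_bounded; have C0 : 0 <= C := le_trans ler01 C1.
have [L L1 hL] := rate_bound; have L0 : 0 <= L := le_trans ler01 L1.
have K0 : 0 <= T * L * C ^+ 2 * expR C.
  by rewrite !mulr_ge0 ?sqr_ge0 ?expR_ge0// ltW.
exists N, ((a / i0) ^+ 2 * (T * L * C ^+ 2 * expR C)) => n s nN hs.
have [n0 t1 tE] := hN n s nN hs.
have I0 : 0 < info s := lt_le_trans i00 (hi s hs).
have cl1 := continuous_shift (s := s) continuous_logr1.
have cnr : continuous (fun t => n%:R * rate s t) by exact: continuous_nrate.
have fC t : 0 < t <= T -> `|logr1 (t - s)| <= C.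
  by move=> ht; have [] := hC _ (shift_dom hs ht).
have mL t : 0 < t <= T -> 0 <= n%:R * rate s t <= n%:R * L.
  by move=> ht; have /andP[r0 rL] := hL s t hs ht; rewrite mulr_ge0 ?ler_wpM2l// ltW.
apply: (le_trans (cumulant_bound T0 cl1 cnr C0 (ler0n R n) L0 t1 fC mL)).
rewrite mulrA tE ler_wpM2r// !expr_div_n ler_wpM2l ?sqr_ge0//.
by rewrite lef_pV2 ?posrE ?exprn_gt0// lerXn2r ?nnegrE ?(ltW i00) ?(ltW I0) ?hi//.
Qed.

Lemma logr1_sq_rate s : \int[mu]_(t in `]0, T]) (logr1 (t - s) ^+ 2 * rate s t) = info s.
Proof.
apply: Rintegral_itv_eq => t _; rewrite /logr1 /rate /info_dens.
by have := den_gt0 (t - s) => d0; field; rewrite gt_eqF.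
Qed.

(** The quadratic part of the integrand integrates exactly to the limit. What remains is of third
    order, that is [|z|] times the bounded quantity [n * z ^ 2], uniformly in [s]. *)
Lemma cumulant_cvg (a e : R) : 0 < e -> exists N, forall n s, (N <= n)%N ->
  A <= s <= B -> `|cumulant n s a - a ^+ 2 / (2 * info s)| <= e.
Proof.
move=> e0; have [i0 i00 hi] := info_lb; have [N hN] := tilt_bound a.
have [C C1 hC] := sig_bounded; have C0 : 0 <= C := le_trans ler01 C1.
have [L L1 hL] := rate_bound; have L0 : 0 <= L := le_trans ler01 L1.
have Q0 : 0 <= T * (C ^+ 3 * expR C * L).
  by rewrite mulr_ge0 ?(ltW T0)// mulr_ge0// mulr_ge0 ?exprn_ge0 ?expR_ge0.
pose K := T * (C ^+ 3 * expR C * L) * (a / i0) ^+ 2.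
have K0 : 0 <= K := mulr_ge0 Q0 (sqr_ge0 _).
pose z0 := e / (K + 1); have z00 : 0 < z0 by rewrite divr_gt0// ltr_wpDl.
(* [tilt] is linear in its last argument: the bound by 1 at [a / z0] is the bound by [z0] at [a]. *)
have [N' hN'] := tilt_bound (a / z0).
exists (maxn N N') => n s; rewrite geq_max => /andP[nN nN'] hs.
have [n0 t1 tE] := hN n s nN hs; have [_ t1' _] := hN' n s nN' hs.
have I0 : 0 < info s := lt_le_trans i00 (hi s hs).
have cl1 := continuous_shift (s := s) continuous_logr1.
have cr : continuous (rate s) by exact: continuous_rate.
have cnr : continuous (fun t => n%:R * rate s t) by exact: continuous_nrate.
set z := tilt n s a in t1 tE.
have zz0 : `|z| <= z0.
  move: t1'; rewrite (_ : tilt n s (a / z0) = z / z0); last by rewrite /z /tilt; ring.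
  by rewrite normrM normfV (gtr0_norm z00) ler_pdivrMr// mul1r.
have fC t : 0 < t <= T -> `|logr1 (t - s)| <= C.
  by move=> ht; have [] := hC _ (shift_dom hs ht).
have cz := continuousZ_fun (c := z) cl1.
have c1 : continuous (fun t => (expR (z * logr1 (t - s)) - 1 - z * logr1 (t - s)) *
    (n%:R * rate s t)).
  apply: continuousM_fun => // t; apply: cvgB; last exact: cz.
  by apply: cvgB; [exact: (continuous_expR_fun cz)|exact: cvg_cst].
have c2 : continuous (fun t => logr1 (t - s) ^+ 2 * rate s t).
  by apply: continuousM_fun => //; exact: continuous_sqr.
have c3 := continuousZ_fun (c := n%:R * z ^+ 2 / 2) c2.
have -> : a ^+ 2 / (2 * info s) =
    \int[mu]_(t in `]0, T]) (n%:R * z ^+ 2 / 2 * (logr1 (t - s) ^+ 2 * rate s t)).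
  rewrite (Rintegral_itv_scale _ _ _ c2) logr1_sq_rate tE expr_div_n.
  by field; rewrite gt_eqF.
rewrite /cumulant -/z -(Rintegral_itv_subf _ _ c1 c3).
have cd : continuous (fun t => (expR (z * logr1 (t - s)) - 1 - z * logr1 (t - s)) *
    (n%:R * rate s t) - n%:R * z ^+ 2 / 2 * (logr1 (t - s) ^+ 2 * rate s t)).
  by move=> t; apply: cvgB; [exact: c1|exact: c3].
have cc : continuous (fun _ : R => n%:R * `|z| ^+ 3 * (C ^+ 3 * expR C * L)).
  exact: cst_continuous.
have bd t : 0 < t <= T -> `|(expR (z * logr1 (t - s)) - 1 - z * logr1 (t - s)) *
    (n%:R * rate s t) - n%:R * z ^+ 2 / 2 * (logr1 (t - s) ^+ 2 * rate s t)| <=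
    n%:R * `|z| ^+ 3 * (C ^+ 3 * expR C * L).
  move=> ht; have := fC t ht; move: (logr1 (t - s)) => l lC.
  have /andP[r0 rL] := hL s t hs ht.
  rewrite (_ : _ - _ = n%:R * ((expR (z * l) - 1 - z * l - (z * l) ^+ 2 / 2) * rate s t));
    last by field.
  rewrite normrM normr_nat -[leRHS]mulrA ler_wpM2l// normrM (gtr0_norm r0) mulrA.
  apply: ler_pM; rewrite ?(ltW r0)//; apply: (le_trans (expR_tail3 _)).
  rewrite mulrA; apply: ler_pM; rewrite ?exprn_ge0 ?expR_ge0//.
    by rewrite normrM exprMn ler_wpM2l ?exprn_ge0// lerXn2r ?nnegrE.
  by rewrite ler_expR normrM (le_trans _ lC)// ler_piMl.
apply: (le_trans (Rintegral_itv_abs cd cc bd)).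
rewrite (Rintegral_itv_cst _ (ltW T0)) subr0.
have -> : n%:R * `|z| ^+ 3 * (C ^+ 3 * expR C * L) * T =
    `|z| * (T * (C ^+ 3 * expR C * L) * (n%:R * `|z| ^+ 2)) by ring.
rewrite real_normK ?num_real// tE.
apply: (@le_trans _ _ (z0 * K)).
  apply: ler_pM => //; first exact: mulr_ge0 Q0 (sqr_ge0 _).
  rewrite /K; apply: ler_wpM2l => //.
  rewrite !expr_div_n ler_wpM2l ?sqr_ge0//.
  by rewrite lef_pV2 ?posrE ?exprn_gt0// lerXn2r ?nnegrE ?(ltW i00) ?(ltW I0) ?hi//.
rewrite /z0 mulrAC ler_pdivrMr ?ltr_wpDl// ler_wpM2l ?(ltW e0)//.
by rewrite lerDl.
Qed.

(** Exact for every positive [n]: the score has variance [n * info], is divided by [n * info] and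
    multiplied by [sqrt n]. *)
Lemma step_variance P Y n s : (0 < n)%N -> A <= s <= B -> obs P Y n s ->
  P.-integrable setT (fun w => ((Num.sqrt n%:R * step n s (Y w)) ^+ 2)%:E) /\
  \int[P]_w ((Num.sqrt n%:R * step n s (Y w)) ^+ 2) = (info s)^-1.
Proof.
move=> n0 hs PY; have [i0 i00 hi] := info_lb.
have I0 : 0 < info s := lt_le_trans i00 (hi s hs).
have n0' : 0 < n%:R :> R by rewrite ltr0n.
have cl1 := continuous_shift (s := s) continuous_logr1.
have cr : continuous (rate s) by exact: continuous_rate.
have cnr : continuous (fun t => n%:R * rate s t) by exact: continuous_nrate.
have m0 t : 0 < t <= T -> 0 <= n%:R * rate s t.
  by move=> _; rewrite mulr_ge0// ltW// rate_gt0.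
have [int var] := centered_variance T0 PY cnr cl1 m0.
have E w : (Num.sqrt n%:R * step n s (Y w)) ^+ 2 = (n%:R * (info s) ^+ 2)^-1 *
    centered T Y (fun t => n%:R * rate s t) (fun t => logr1 (t - s)) w ^+ 2.
  rewrite -[_ * step _ _ _]mul1r step_centered exprMn /tilt sqrrN mul1r expr_div_n.
  rewrite sqr_sqrtr ?ltW//; congr (_ * _).
  by field; rewrite !gt_eqF.
split.
  under eq_fun do rewrite E EFinM.
  exact: integrableZl.
under eq_Rintegral do rewrite E.
rewrite RintegralZl// var.
have c2 : continuous (fun t => logr1 (t - s) ^+ 2 * rate s t).
  by apply: continuousM_fun => //; exact: continuous_sqr.
rewrite (@Rintegral_itv_eq _ _ (fun t => n%:R * (logr1 (t - s) ^+ 2 * rate s t)));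
  last by move=> t _; ring.
rewrite (Rintegral_itv_scale _ _ _ c2) logr1_sq_rate.
by field; rewrite !gt_eqF.
Qed.

(** [sq_distance_bound] splits the error into a relative term, the exceptional event and an
    exponential moment; each is brought below [eps / 3], uniformly in the law and the delay. *)
Lemma uniform_mse (eps mgn : R) : 0 < eps -> 0 < mgn -> exists N,
  forall n P Y s that, (N <= n)%N -> A + mgn <= s <= B - mgn ->
    obs P Y n s -> mle Y n that ->
    P.-integrable setT (fun w => ((that w - s) ^+ 2)%:E) /\
    `|n%:R * \int[P]_w ((that w - s) ^+ 2) - (info s)^-1| <= eps.
Proof.
move=> eps0 mgn0; have [i0 i00 hi] := info_lb.
(* The relative term is [3 * dl / info], at most [eps / 3] since [info >= i0]. *)
pose dl := Num.min 1 (eps * i0 / 9).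
have dl0 : 0 < dl by rewrite lt_min ltr01 divr_gt0 ?mulr_gt0.
have dl1 : dl <= 1 by rewrite ge_min lexx.
have dle : dl <= eps * i0 / 9 by rewrite ge_min lexx orbT.
have dl2 : 0 < dl ^+ 2 <= 1 by rewrite exprn_gt0//= exprn_ile1// ltW.
have [K K0 [c c0 hlin]] := linearisation dl2 mgn0.
have [N1 [Cb1 hC1]] := cumulant_ub 1; have [N2 [Cb2 hC2]] := cumulant_ub (-1).
pose W0 := expR Cb1 + expR Cb2.
have W00 : 0 < W0 by rewrite addr_gt0 ?expR_gt0.
(* Makes [24 / K' * W0] equal to [eps / 3]. *)
pose K' := 72 * W0 / eps.
have K'0 : 0 < K' by rewrite divr_gt0// mulr_gt0.
(* Since [n <= 2 * expR (sqrt n)], the contribution of the exceptional event is at most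
   [M * expR (sqrt n - c * n)]. *)
pose M := (2 * (B - A) ^+ 2 + K') * K + 1.
have AB2 : 0 <= (B - A) ^+ 2 := sqr_ge0 _.
have M0 : 0 < M.
  by rewrite ltr_wpDl// mulr_ge0// addr_ge0 ?(ltW K'0)// mulr_ge0.
have eM : 0 < eps / 3 / M by rewrite !divr_gt0.
have [N3 hN3] := exp_decay 1 c0 eM.
exists (maxn (maxn N1 N2) (maxn N3 1)) => n P Y s that.
rewrite !geq_max => /andP[/andP[nN1 nN2] /andP[nN3 n0]] hsm PY hm.
have n0' : 0 < n%:R :> R by rewrite ltr0n.
have hs : A <= s <= B by move/andP: hsm => [? ?]; apply/andP; split; lra.
have I0 : 0 < info s := lt_le_trans i00 (hi s hs).
have [E [mE PE hE]] := hlin P Y n s that n0 hsm PY hm.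
have [iS2 ES2] := step_variance n0 hs PY.
have [i1 E1] := step_mgf 1 PY; have [i2 E2] := step_mgf (-1) PY.
pose S w := Num.sqrt n%:R * step n s (Y w).
pose z w := Num.sqrt n%:R * (that w - s).
have [mthat hmw] := hm.
have sqn : Num.sqrt n%:R ^+ 2 = n%:R :> R by rewrite sqr_sqrtr// ltW.
have zB w : z w ^+ 2 <= n%:R * (B - A) ^+ 2.
  rewrite /z exprMn sqn ler_wpM2l//; have [/andP[t1 t2] _] := hmw w.
  move/andP: hs => [s1 s2].
  rewrite -(real_normK (num_real (that w - s))) lerXn2r ?nnegrE ?subr_ge0 ?(ltW AB)//.
  by rewrite ler_norml; apply/andP; split; lra.
have mz2 : measurable_fun setT (fun w => (that w - s) ^+ 2).
  by apply: measurable_funX; apply: measurable_funB.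
have bounded (g : Om -> R) (b : R) : measurable_fun setT g ->
    (forall w, `|g w| <= b) -> P.-integrable setT (fun w => (g w)%:E).
  move=> mg gb; have ib : P.-integrable setT (EFin \o cst b).
    exact: finite_measure_integrable_cst.
  apply: (le_integrable _ _ _ ib) => //; first exact/measurable_EFinP.
  by move=> w _; rewrite !abse_EFin lee_fin (le_trans (gb w))// ler_norm.
have iz2 : P.-integrable setT (fun w => ((that w - s) ^+ 2)%:E).
  apply: (bounded _ ((B - A) ^+ 2)) => // w; rewrite ger0_norm ?sqr_ge0//.
  by have := zB w; rewrite /z exprMn sqn ler_pM2l.
split=> //.
have iZ : P.-integrable setT (fun w => (z w ^+ 2)%:E).
  rewrite (_ : (fun w => _) = (fun w => (n%:R%:E * ((that w - s) ^+ 2)%:E)%E)).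
    exact: integrableZl.
  by apply/funext => w; rewrite /z exprMn sqn EFinM.
have EZ : \int[P]_w (z w ^+ 2) = n%:R * \int[P]_w ((that w - s) ^+ 2).
  rewrite -RintegralZl//; apply: eq_Rintegral => w _.
  by rewrite /z exprMn sqn.
rewrite -EZ -ES2 -RintegralB//.
have iD : P.-integrable setT (fun w => (z w ^+ 2 - S w ^+ 2)%:E).
  exact: (integrableB measurableT iZ iS2).
apply: (le_trans (le_normr_Rintegral measurableT iD)).
pose W w := expR (1 * S w) + expR (-1 * S w).
have iW : P.-integrable setT (fun w => (W w)%:E).
  exact: (integrableD measurableT i1 i2).
have i1E : P.-integrable setT (fun w => (\1_E w)%:E).
  exact: integrable_indic.
have iB1 := integrableZl measurableT (3 * dl) iS2.
have iB2 := integrableZl measurableT (n%:R * (B - A) ^+ 2 + K') i1E.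
have iB3 := integrableZl measurableT (24 / K') iW.
have iB12 := integrableD measurableT iB1 iB2.
have iB := integrableD measurableT iB12 iB3.
apply: (@le_trans _ _ (\int[P]_w (3 * dl * S w ^+ 2 +
    (n%:R * (B - A) ^+ 2 + K') * \1_E w + 24 / K' * W w))).
  apply: le_Rintegral => //.
  - exact: (integrable_abse iD).
  move=> w _; rewrite /W mul1r mulN1r; apply: sq_distance_bound => //.
  - by rewrite dl0.
  - by rewrite indicE ler0n lern1 leq_b1.
  - rewrite indicE; case: (boolP (w \in E)) => [_ /eqP|/negP wE _].
      by rewrite oner_eq0.
    have /hE h : ~ E w by move=> /mem_set.
    rewrite /z /S -mulrBr exprMn sqn [X in _ <= _ * X]exprMn sqn [leRHS]mulrCA.
    by rewrite ler_wpM2l.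
  - by rewrite indicE; case: (w \in E); [right|left].
rewrite (RintegralD measurableT iB12 iB3) (RintegralD measurableT iB1 iB2).
rewrite (RintegralZl _ measurableT iS2) (RintegralZl _ measurableT i1E).
rewrite (RintegralZl _ measurableT iW) (RintegralD measurableT i1 i2).
rewrite E1 E2 ES2.
have PEfin : \int[P]_w \1_E w <= K * expR (- (c * n%:R)).
  rewrite /Rintegral integral_indic// setIT -lee_fin fineK ?fin_num_measure//.
have t1 : 3 * dl * (info s)^-1 <= eps / 3.
  rewrite ler_pdivrMr//; have := hi s hs => his.
  have : eps / 3 * i0 <= eps / 3 * info s by rewrite ler_wpM2l// divr_ge0// ltW.
  by lra.
have t2 : (n%:R * (B - A) ^+ 2 + K') * \int[P]_w \1_E w <= eps / 3.
  apply: (@le_trans _ _ ((n%:R * (B - A) ^+ 2 + K') * (K * expR (- (c * n%:R))))).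
    by rewrite ler_wpM2l// addr_ge0 ?(ltW K'0)// mulr_ge0.
  have ns : n%:R <= 2 * expR (Num.sqrt n%:R) :> R.
    by have := @expr_le_expR R (Num.sqrt n%:R) 2 (sqrtr_ge0 _); rewrite sqn.
  have es1 : 1 <= expR (Num.sqrt n%:R) :> R by rewrite -expR0 ler_expR sqrtr_ge0.
  apply: (@le_trans _ _ ((2 * (B - A) ^+ 2 + K') * expR (Num.sqrt n%:R) *
      (K * expR (- (c * n%:R))))).
    rewrite ler_wpM2r ?mulr_ge0 ?expR_ge0// [leRHS]mulrDl; apply: lerD.
      by rewrite mulrAC ler_wpM2r.
    by rewrite ler_peMr// ltW.
  rewrite (_ : _ * _ * _ = (2 * (B - A) ^+ 2 + K') * K *
    (expR (Num.sqrt n%:R) * expR (- (c * n%:R)))); last by ring.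
  have := hN3 n nN3; rewrite mul1r expRD => h.
  apply: (@le_trans _ _ (M * (expR (Num.sqrt n%:R) * expR (- (c * n%:R))))).
    by rewrite ler_wpM2r ?mulr_ge0 ?expR_ge0// lerDl.
  by rewrite mulrC -ler_pdivlMr.
have t3 : 24 / K' * (expR (cumulant n s 1) + expR (cumulant n s (-1))) <= eps / 3.
  apply: (@le_trans _ _ (24 / K' * W0)).
    rewrite ler_wpM2l ?(divr_ge0 _ (ltW K'0))//.
    by apply: lerD; rewrite ler_expR; [exact: hC1|exact: hC2].
  rewrite /K' le_eqVlt; apply/orP; left; apply/eqP; field.
  by rewrite !gt_eqF.
by lra.
Qed.

End signal.

(** * All detectors: limit law and risk *)

Lemma Rintegral_sum {d} {T : measurableType d} {R : realType}
    (mu : {measure set T -> \bar R}) (I : Type) (r : seq I) (f : I -> T -> R) :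
  (forall i, mu.-integrable setT (fun w => (f i w)%:E)) ->
  mu.-integrable setT (fun w => (\sum_(i <- r) f i w)%:E) /\
  \int[mu]_w (\sum_(i <- r) f i w) = \sum_(i <- r) \int[mu]_w f i w.
Proof.
move=> fi; elim: r => [|i r [IH1 IH2]].
  split; first by under eq_fun do rewrite big_nil; exact: integrable0.
  rewrite big_nil /Rintegral -[RHS]/(fine 0%E) -(integral0 mu setT); congr fine.
  by apply: eq_integral => w _; rewrite big_nil.
under eq_fun do rewrite big_cons.
split; first exact: (integrableD measurableT (fi i) IH1).
rewrite big_cons -IH2 -(RintegralD measurableT (fi i) IH1).
by apply: eq_Rintegral => w _; rewrite big_cons.
Qed.

(** The sum is at most [k] times its largest term; the summand 1 covers [k = 0]. *)
Lemma expR_sum_le {R : realType} k (b : 'I_k -> R) : (forall j, 0 <= b j) ->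
  expR (\sum_j b j) <= 1 + \sum_j expR (k%:R * b j).
Proof.
move=> b0; case: k b b0 => [|k] b b0; first by rewrite !big_ord0 expR0 addr0.
have [i _ hi] := @Order.TotalTheory.arg_maxP _ _ 'I_k.+1 ord0 xpredT b isT.
apply: (@le_trans _ _ (expR (k.+1%:R * b i))).
  rewrite ler_expR mulr_natl -[X in _ *+ X]card_ord -sumr_const.
  by apply: ler_sum => j _; exact: hi.
rewrite (bigD1 i)//= addrCA lerDl addr_ge0// sumr_ge0// => j _; exact: expR_ge0.
Qed.

Lemma expR_sum_close {R : realType} k (a x y : 'I_k -> R) (eps : R) :
  0 <= eps <= 1 -> (forall j, (x j - y j) ^+ 2 <= eps ^+ 2 * y j ^+ 2) ->
  `|expR (\sum_j a j * x j) - expR (\sum_j a j * y j)| <=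
  eps * expR (3 * \sum_j `|a j| * `|y j|).
Proof.
move=> /andP[e0 e1] h; set u := \sum_j _; set v := \sum_j a j * y j.
set s := \sum_j _; have s0 : 0 <= s by apply: sumr_ge0 => j _; exact: mulr_ge0.
have vs : v <= s.
  by apply: ler_sum => j _; rewrite -normrM ler_norm.
have uv : `|u - v| <= eps * s.
  rewrite /u /v -sumrB (le_trans (ler_norm_sum _ _ _))// mulr_sumr.
  apply: ler_sum => j _; rewrite -mulrBr normrM mulrCA ler_wpM2l//.
  rewrite -(ler_pXn2r (n := 2)) ?nnegrE ?mulr_ge0//.
  by rewrite exprMn !real_normK ?num_real.
have uvs : `|u - v| <= s by rewrite (le_trans uv)// ler_piMl.
have -> : expR u - expR v = expR v * (expR (u - v) - 1).
  by rewrite mulrBr mulr1 -expRD [v + _]addrC subrK.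
have h1 : `|expR (u - v) - 1| <= `|u - v| * expR `|u - v|.
  have [uv0|uv0] := leP 0 (u - v).
    rewrite (ger0_norm uv0) ger0_norm; last by rewrite subr_ge0 -expR0 ler_expR.
    have := @expR_ge1Dx R (- (u - v)); rewrite expRN.
    have p0 := expR_gt0 (u - v); move: (u - v) p0 => z p0 hz.
    have : (1 - z) * expR z <= 1 by rewrite -ler_pdivlMr// mul1r.
    by lra.
  rewrite (ltr0_norm uv0) ler0_norm; last by rewrite subr_le0 -expR0 ler_expR ltW.
  have := @expR_ge1Dx R (u - v).
  have : 1 <= expR (- (u - v)) by rewrite -expR0 ler_expR oppr_ge0 ltW.
  move: (u - v) uv0 => z z0 ez hz.
  have : - z * 1 <= - z * expR (- z) by rewrite ler_wpM2l// oppr_ge0 ltW.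
  by lra.
rewrite normrM (gtr0_norm (expR_gt0 _)).
apply: (@le_trans _ _ (expR s * (eps * s * expR s))).
  apply: ler_pM; rewrite ?expR_ge0// ?ler_expR//; apply: (le_trans h1).
  by apply: ler_pM => //; rewrite ?expR_ge0// ler_expR.
have ss : s <= expR s by rewrite (le_trans _ (expR_ge1Dx _))// lerDr.
rewrite (_ : 3 * s = s + s + s); last by ring.
rewrite !expRD (_ : _ * _ = eps * (expR s * s * expR s)); last by ring.
by rewrite ler_wpM2l// ler_wpM2r ?expR_ge0// ler_wpM2l ?expR_ge0.
Qed.

(** * Transfer of moment generating functions from the linear approximation to the error *)

Section linear_approximation.
Context {d : measure_display} {Om : measurableType d} {R : realType} (k : nat).
Variables (P : nat -> probability Om R) (S Z : nat -> 'I_k -> Om -> R) (b : R).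
Implicit Types (a : 'I_k -> R).
Hypothesis mZ : forall n j, measurable_fun setT (Z n j).
Hypothesis Zb : forall n j w, `|Z n j w| <= b * Num.sqrt n%:R.
Hypothesis S_exp : forall j c,
  (forall n, (P n).-integrable setT (fun w => (expR (c * S n j w))%:E)) /\
  exists N (C : R), forall n, (N <= n)%N -> \int[P n]_w expR (c * S n j w) <= C.
Hypothesis S_lin : forall j (eps : R), 0 < eps <= 1 ->
  exists2 K, 0 <= K & exists2 c, 0 < c & forall n, (0 < n)%N ->
    exists E : set Om, [/\ measurable E,
      ((P n) E <= (K * expR (- (c * n%:R)))%:E)%E & forall w, ~ E w ->
        (Z n j w - S n j w) ^+ 2 <= eps * S n j w ^+ 2].

Lemma integrable_expR_lin a n :
  (P n).-integrable setT (fun w => (expR (\sum_j a j * Z n j w))%:E).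
Proof.
pose C := expR (\sum_j `|a j| * (b * Num.sqrt n%:R)).
have ib : (P n).-integrable setT (EFin \o cst C).
  exact: finite_measure_integrable_cst.
apply: (le_integrable _ _ _ ib) => //.
  apply/measurable_EFinP; apply: measurableT_comp => //.
  by apply: measurable_sum => j; apply: measurable_funM.
move=> w _; rewrite !abse_EFin lee_fin !ger0_norm ?expR_ge0// ler_expR.
apply: ler_sum => j _; apply: (le_trans (ler_norm _)).
by rewrite normrM ler_wpM2l.
Qed.

(** The weight [V] has bounded expectation and dominates exponentials of [S] with room to spare: a
    small multiple of it bounds the difference off the exceptional events and the large values of
    [expR (\sum_j a j * S n j w)] on them. *)
Lemma linear_approximation_mgf a (L : R) :
  (forall n, (P n).-integrable setT (fun w => (expR (\sum_j a j * S n j w))%:E)) ->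
  (\int[P n]_w expR (\sum_j a j * S n j w)) @[n --> \oo] --> L ->
  (\int[P n]_w expR (\sum_j a j * Z n j w)) @[n --> \oo] --> L.
Proof.
(* The factor 3 is the exponent produced by [expR_sum_close], and [k] the one produced by
   [expR_sum_le]. *)
move=> iS cS; pose c j := k%:R * (3 * a j).
pose V n w : R := 1 + \sum_j (expR (c j * S n j w) + expR (- c j * S n j w)).
have i1 n : (P n).-integrable setT (EFin \o cst (1 : R)).
  exact: finite_measure_integrable_cst.
have iW j n := integrableD measurableT ((S_exp j (c j)).1 n) ((S_exp j (- c j)).1 n).
have iV n : (P n).-integrable setT (fun w => (V n w)%:E).
  exact: (integrableD measurableT (i1 n) (Rintegral_sum _ (iW^~ n)).1).
have [N1 [C C0 hC]] : exists N, exists2 C : R, 0 < C & forall n, (N <= n)%N ->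
    \int[P n]_w V n w <= C.
  have /choice[f hf] (j : 'I_k) : exists NC : nat * R, forall n, (NC.1 <= n)%N ->
      \int[P n]_w (expR (c j * S n j w) + expR (- c j * S n j w)) <= NC.2.
    have [j1 [M1 [D1 h1]]] := S_exp j (c j); have [j2 [M2 [D2 h2]]] := S_exp j (- c j).
    exists (maxn M1 M2, D1 + D2) => n; rewrite geq_max => /andP[n1 n2] /=.
    rewrite (RintegralD measurableT (j1 n) (j2 n)).
    by apply: lerD; [exact: h1|exact: h2].
  exists (\max_j (f j).1)%N, (1 + \sum_j `|(f j).2|).
    by rewrite ltr_pwDl// sumr_ge0.
  move=> n hn; have [i2 E2] := Rintegral_sum (index_enum 'I_k) (iW^~ n).
  rewrite (RintegralD measurableT (i1 n) i2) E2; apply: lerD.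
    by rewrite /cst Rintegral_cst// -[X in fine X]/(P n setT) probability_setT mul1r.
  apply: ler_sum => j _; apply: le_trans (ler_norm _); apply: hf.
  exact: leq_trans (leq_bigmax j) hn.
have Vge n w : 1 <= V n w.
  by rewrite /V lerDl sumr_ge0// => j _; rewrite addr_ge0// expR_ge0.
have VS n w : expR (3 * \sum_j `|a j| * `|S n j w|) <= V n w.
  rewrite mulr_sumr; apply: (le_trans (expR_sum_le _)) => [j|].
    by rewrite !mulr_ge0.
  rewrite lerD2l; apply: ler_sum => j _; rewrite mulNr.
  apply: le_trans (expR_norm_le _).
  by rewrite ler_expR /c !normrM normr_nat (ger0_norm (ler0n R 3)) !mulrA.
apply/cvgrPdist_le => e e0.
pose dl := Num.min 1 (e / (6 * C)).
have dl0 : 0 < dl by rewrite lt_min ltr01 divr_gt0// mulr_gt0.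
have dl1 : dl <= 1 by rewrite ge_min lexx.
have dle : 2 * dl * C <= e / 3.
  have : dl <= e / (6 * C) by rewrite ge_min lexx orbT.
  by rewrite ler_pdivlMr ?mulr_gt0//; lra.
have dl2 : 0 < dl ^+ 2 <= 1 by rewrite exprn_gt0//= exprn_ile1// ltW.
have /choice[f hf] (j : 'I_k) : exists Kc : R * R, [/\ 0 <= Kc.1, 0 < Kc.2 &
    forall n, (0 < n)%N -> exists E : set Om, [/\ measurable E,
      ((P n) E <= (Kc.1 * expR (- (Kc.2 * n%:R)))%:E)%E & forall w, ~ E w ->
        (Z n j w - S n j w) ^+ 2 <= dl ^+ 2 * S n j w ^+ 2]].
  by have [K K0 [c' c'0 h]] := S_lin j dl2; exists (K, c').
pose D := \sum_j `|a j| * b.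
have q1 : 0 < 1 + dl^-1 by rewrite addr_gt0// invr_gt0.
have qk : 0 < k%:R + 1 :> R by rewrite ltr_wpDl.
(* Each exceptional event is allotted the share [e / (3 * (k + 1))]; the other factor compensates
   its constant and [M <= (1 + 1 / dl) * expR (|D| * sqrt n)]. *)
pose e' j := e / (3 * (k%:R + 1) * ((1 + dl^-1) * ((f j).1 + 1))).
have e'0 j : 0 < e' j.
  have [K0 _ _] := hf j.
  by rewrite divr_gt0// !mulr_gt0// ltr_wpDl.
have g0 : forall j : 'I_k, exists N, forall n, (N <= n)%N ->
    expR (`|D| * Num.sqrt n%:R - (f j).2 * n%:R) <= e' j.
  by move=> j; have [_ c0 _] := hf j; exact: exp_decay.
have [g hg] := choice g0.
have e30 : 0 < e / 3 by rewrite divr_gt0.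
move/cvgrPdist_le : cS => /(_ _ e30)[N2 _ cS].
exists (maxn (maxn N1 N2) (\max_j g j).+1) => // n /=.
rewrite !geq_max => /andP[/andP[nN1 nN2] nN3].
have n0 : (0 < n)%N by exact: leq_trans nN3.
have E0 j := let: And3 _ _ h := hf j in h n n0.
have [E hE] := choice E0.
pose B w : R := \sum_j \1_(E j) w.
have iE j : (P n).-integrable setT (fun w => (\1_(E j) w)%:E).
  by have [mE _ _] := hE j; exact: integrable_indic.
have [iB EB] := Rintegral_sum (index_enum 'I_k) iE.
pose M := expR (`|D| * Num.sqrt n%:R) + dl^-1.
have M0 : 0 <= M by rewrite addr_ge0 ?expR_ge0// invr_ge0 ltW.
have iZ := integrable_expR_lin a n.
have pt w : `|expR (\sum_j a j * Z n j w) - expR (\sum_j a j * S n j w)| <=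
    2 * dl * V n w + M * B w.
  have B0 : 0 <= B w by apply: sumr_ge0 => j _; rewrite indicE.
  have V0 : 0 <= dl * V n w.
    by rewrite mulr_ge0 ?(ltW dl0)// (le_trans ler01 (Vge n w)).
  have [[j Ej]|nE] := pselect (exists j, E j w); last first.
    apply: (@le_trans _ _ (dl * V n w)); last by rewrite -subr_ge0 (_ : _ - _ =
      dl * V n w + M * B w) ?addr_ge0 ?(mulr_ge0 M0 B0)//; ring.
    apply: (le_trans (@expR_sum_close _ k a (Z n ^~ w) (S n ^~ w) dl _ _)).
    - by rewrite (ltW dl0).
    - by move=> j; have [_ _] := hE j; apply=> Ej; apply: nE; exists j.
    - by rewrite ler_wpM2l// ltW.
  have B1 : 1 <= B w.
    by rewrite /B (bigD1 j) //; rewrite {1}indicE mem_set// lerDl sumr_ge0.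
  have z1 : expR (\sum_j a j * Z n j w) <= expR (`|D| * Num.sqrt n%:R).
    rewrite ler_expR; apply: (@le_trans _ _ (D * Num.sqrt n%:R)); last first.
      by rewrite ler_wpM2r ?sqrtr_ge0// ler_norm.
    rewrite /D mulr_suml; apply: ler_sum => i _; apply: (le_trans (ler_norm _)).
    by rewrite normrM -mulrA ler_wpM2l.
  (* The exponential of [S] is unbounded on the exceptional event: either it is at most [1 / dl], or
     it is at most [dl] times its square, which [V] dominates. *)
  have z2 : expR (\sum_j a j * S n j w) <= dl^-1 + dl * V n w.
    set s := \sum_j `|a j| * `|S n j w|.
    have s0 : 0 <= s by apply: sumr_ge0 => i _; exact: mulr_ge0.
    apply: (@le_trans _ _ (expR s)).
      by rewrite ler_expR; apply: ler_sum => i _; rewrite -normrM ler_norm.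
    have [sd|ds] := leP (expR s) dl^-1; first by rewrite (le_trans sd)// lerDl.
    apply: (@le_trans _ _ (dl * V n w)); last by rewrite lerDr invr_ge0 ltW.
    apply: (@le_trans _ _ (dl * expR (2 * s))).
      rewrite expRM_natl expr2 mulrA ler_peMl ?expR_ge0//.
      by rewrite -ler_pdivrMl// mulr1 ltW.
    rewrite ler_wpM2l ?(ltW dl0)//; apply: le_trans (VS n w); rewrite ler_expR.
    by rewrite ler_wpM2r// ler_nat.
  have p1 := expR_gt0 (\sum_j a j * Z n j w); have p2 := expR_gt0 (\sum_j a j * S n j w).
  have MB : M <= M * B w by rewrite ler_peMr.
  move: z1 z2 p1 p2 MB; rewrite /M; move: (expR _) => u; move: (expR _) => v.
  move: (expR _) (M * B w) => x y ? ? ? ? ?.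
  by rewrite ler_norml; apply/andP; split; lra.
have key : `|\int[P n]_w expR (\sum_j a j * Z n j w) -
    \int[P n]_w expR (\sum_j a j * S n j w)| <= 2 * e / 3.
  rewrite -(RintegralB measurableT iZ (iS n)).
  have iD := integrableB measurableT iZ (iS n).
  apply: (le_trans (le_normr_Rintegral measurableT iD)).
  have iB1 := integrableZl measurableT (2 * dl) (iV n).
  have iB2 := integrableZl measurableT M iB.
  apply: (@le_trans _ _ (\int[P n]_w (2 * dl * V n w + M * B w))).
    apply: (le_Rintegral measurableT (integrable_abse iD)).
      exact: (integrableD measurableT iB1 iB2).
    by move=> w _; exact: pt.
  rewrite (RintegralD measurableT iB1 iB2) (RintegralZl _ measurableT (iV n)).
  rewrite (RintegralZl _ measurableT iB) EB.
  have t1 : 2 * dl * \int[P n]_w V n w <= e / 3.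
    by apply: (le_trans _ dle); rewrite ler_wpM2l ?hC// mulr_ge0// ltW.
  suff t2 : M * \sum_j \int[P n]_w \1_(E j) w <= e / 3 by lra.
  rewrite mulr_sumr.
  apply: (@le_trans _ _ (\sum_(j < k) (e / (3 * (k%:R + 1))))); last first.
    rewrite sumr_const card_ord -[_ *+ k]mulr_natr mulrAC ler_pdivrMr ?mulr_gt0//.
    by rewrite (_ : e / 3 * (3 * (k%:R + 1)) = e * k%:R + e) ?lerDl ?(ltW e0)//; field.
  apply: ler_sum => j _; have [K0 c0 _] := hf j; have [mE PE _] := hE j.
  have PEj : \int[P n]_w \1_(E j) w <= (f j).1 * expR (- ((f j).2 * n%:R)).
    by rewrite /Rintegral integral_indic// setIT -lee_fin fineK ?fin_num_measure//.
  have Q0 : 0 < (1 + dl^-1) * ((f j).1 + 1).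
    by rewrite mulr_gt0// ltr_wpDl.
  have hgj : expR (`|D| * Num.sqrt n%:R) * expR (- ((f j).2 * n%:R)) <= e' j.
    rewrite -expRD; apply: hg; apply: leq_trans (leq_bigmax j) _; exact: ltnW.
  have ME : M <= (1 + dl^-1) * expR (`|D| * Num.sqrt n%:R).
    rewrite mulrDl mul1r lerD2l ler_peMr ?invr_ge0 ?(ltW dl0)//.
    by rewrite -expR0 ler_expR mulr_ge0// sqrtr_ge0.
  apply: (@le_trans _ _ ((1 + dl^-1) * expR (`|D| * Num.sqrt n%:R) *
      (((f j).1 + 1) * expR (- ((f j).2 * n%:R))))).
    apply: ler_pM => //; first by apply: Rintegral_ge0 => w _; rewrite indicE.
    by apply: (le_trans PEj); rewrite ler_wpM2r ?expR_ge0// lerDl.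
  rewrite (_ : _ * _ * _ = (1 + dl^-1) * ((f j).1 + 1) *
    (expR (`|D| * Num.sqrt n%:R) * expR (- ((f j).2 * n%:R)))); last by ring.
  rewrite -ler_pdivlMl//; apply: (le_trans hgj).
  by rewrite /e' invfM mulrA mulrC.
have := cS n nN2; move: key; rewrite !ler_distl => /andP[? ?] /andP[? ?].
by apply/andP; split; lra.
Qed.

End linear_approximation.

(** * Interior delays, limits of suprema, monomials *)

Lemma dist2_scale {R : realType} (p q : R * R) (e : R) :
  dist2 p (q.1 + e * (q.1 - p.1), q.2 + e * (q.2 - p.2)) = `|1 + e| * dist2 p q.
Proof.
rewrite /dist2 -sqrtr_sqr -sqrtrM ?sqr_ge0//; congr Num.sqrt => /=.
by ring.
Qed.

(** Moving [th] by a small fraction [e] of its distance to the detector [p], towards [p] or away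
    from it, stays in the open set [Th] and multiplies the delay by [1 - e] or [1 + e]. The delay is
    positive, so it is neither the infimum nor the supremum. *)
Lemma delay_interior {R : realType} (nu : R) (Th : set (R * R)) (p th : R * R) :
  0 < nu -> open Th -> bounded2 Th -> Th th -> 0 < alpha nu Th p ->
  alpha nu Th p < delay nu p th < beta nu Th p.
Proof.
move=> nu0 oTh [M hM] thT al0; set S := [set delay nu p t | t in Th].
have lbS : has_lbound S.
  by exists 0 => _ [t _ <-]; rewrite divr_ge0 ?sqrtr_ge0// ltW.
have ubS : has_ubound S.
  exists (Num.sqrt ((`|p.1| + M) ^+ 2 + (`|p.2| + M) ^+ 2) / nu) => _ [t Tt <-].
  rewrite /delay ler_wpM2r ?invr_ge0 ?(ltW nu0)// ler_wsqrtr//.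
  have [h1 h2] := hM t Tt.
  have sq (u v : R) : `|v| <= M -> (u - v) ^+ 2 <= (`|u| + M) ^+ 2.
    move=> vM; rewrite -(real_normK (num_real (u - v))) lerXn2r ?nnegrE//.
      by rewrite addr_ge0// (le_trans _ vM).
    by rewrite (le_trans (ler_normB _ _))// lerD2l.
  by rewrite lerD// sq.
pose q e : R * R := (th.1 + e * (th.1 - p.1), th.2 + e * (th.2 - p.2)).
have cq : q e @[e --> (0 : R)] --> th.
  have c (u v : R) : u + e * v @[e --> (0 : R)] --> u.
    rewrite -[X in _ --> X]addr0 -[X in _ --> _ + X](mul0r v).
    by apply: cvgD; [exact: cvg_cst|apply: cvgM; [exact: cvg_id|exact: cvg_cst]].
  rewrite [X in _ --> X](surjective_pairing th); exact: (cvg_pair (c _ _) (c _ _)).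
have nT : nbhs th Th by exact: open_nbhs_nbhs.
have /nbhs_ballP[r /= r0 hr] := cq _ nT.
pose e := Num.min (r / 2) 2^-1.
have e0 : 0 < e by rewrite lt_min divr_gt0//= invr_gt0.
have er : e < r by rewrite gt_min ltr_pdivrMr// ltr_pMr// ltr1n.
have e1 : e <= 2^-1 by rewrite ge_min lexx orbT.
have T1 : Th (q e) by apply: hr; rewrite /ball/= sub0r normrN gtr0_norm.
have T2 : Th (q (- e)) by apply: hr; rewrite /ball/= sub0r opprK gtr0_norm.
have d0 : 0 < delay nu p th.
  by apply: (lt_le_trans al0); apply: ge_inf => //; exists th.
have dE x : delay nu p (q x) = `|1 + x| * delay nu p th.
  by rewrite /delay dist2_scale mulrA.
apply/andP; split.
  apply: (@le_lt_trans _ _ (delay nu p (q (- e)))); first by apply: ge_inf => //; exists (q (- e)).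
  rewrite dE ger0_norm; last by lra.
  by rewrite gtr_pMl//; lra.
apply: (@lt_le_trans _ _ (delay nu p (q e))); last by apply: ub_le_sup => //; exists (q e).
rewrite dE ger0_norm; last by lra.
by rewrite ltr_pMl//; lra.
Qed.

(** Uniform convergence passes to suprema. The values are extended reals, being integrals multiplied
    by [n]; the hypothesis makes them finite from some rank on. *)
Lemma cvg_ereal_sup {R : realType} {I : Type} (D : set I) (F : nat -> I -> \bar R)
    (g : I -> R) : D !=set0 -> has_ubound [set g t | t in D] ->
  (forall e, 0 < e -> exists N, forall n, (N <= n)%N -> forall t, D t ->
    exists2 r, F n t = r%:E & `|r - g t| <= e) ->
  ereal_sup [set F n t | t in D] @[n --> \oo] --> (sup [set g t | t in D])%:E.
Proof.
move=> [t0 Dt0] ub hF; set G := [set g t | t in D].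
have key e : 0 < e -> exists N, forall n, (N <= n)%N -> exists2 r,
    ereal_sup [set F n t | t in D] = r%:E & `|sup G - r| <= e.
  move=> e0; have [N hN] := hF e e0; exists N => n nN.
  set s := ereal_sup _.
  have s1 : (s <= (sup G + e)%:E)%E.
    apply: ge_ereal_sup => _ [t Dt <-]; have [r -> hr] := hN n nN t Dt.
    have : g t <= sup G by apply: ub_le_sup => //; exists t.
    by move: hr; rewrite lee_fin ler_distl => /andP[_ ?] ?; lra.
  have s2 t : D t -> ((g t - e)%:E <= s)%E.
    move=> Dt; have [r Fr hr] := hN n nN t Dt.
    apply: (@le_trans _ _ (F n t)).
      by rewrite Fr lee_fin; move: hr; rewrite ler_distl => /andP[? _].
    by apply: ereal_sup_ubound; exists t.
  have fs : s \is a fin_num.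
    rewrite fin_numE; apply/andP; split.
      by apply: contraTneq (s2 _ Dt0) => ->; rewrite leeNy_eq.
    by apply: contraTneq s1 => ->; rewrite leye_eq.
  exists (fine s); first by rewrite fineK.
  move: s1 s2; rewrite -(fineK fs) /=; move: (fine s) => r; rewrite lee_fin => s1 s2.
  have : sup G <= r + e.
    apply: ge_sup; first by exists (g t0), t0.
    by move=> _ [t Dt <-]; have := s2 t Dt; rewrite lee_fin; lra.
  by move=> s3; rewrite ler_distl; apply/andP; split; lra.
apply/fine_cvgP; split.
  have [N hN] := key 1 ltr01; exists N => // n /= nN.
  by have [r -> _] := hN n nN.
apply/cvgrPdist_le => e e0; have [N hN] := key e e0; exists N => // n /= nN.
by have [r /= -> ] := hN n nN.
Qed.

Lemma cvg_sumr {R : realType} (I : Type) (r : seq I) (f : I -> nat -> R) (l : I -> R) :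
  (forall i, f i n @[n --> \oo] --> l i) ->
  \sum_(i <- r) f i n @[n --> \oo] --> \sum_(i <- r) l i.
Proof.
move=> fl; elim: r => [|i r IH].
  by rewrite big_nil; under eq_fun do rewrite big_nil; exact: cvg_cst.
by rewrite big_cons; under eq_fun do rewrite big_cons; exact: cvgD (fl i) IH.
Qed.

Lemma continuous_coord_monomial {R : realType} k (p : 'I_k -> nat) (r : seq 'I_k) :
  continuous (fun x : 'rV[R]_k => \prod_(j <- r) x ord0 j ^+ p j).
Proof.
elim: r => [|j r IH].
  by rewrite (_ : (fun x => _) = fun=> 1);
    [exact: cst_continuous|apply/funext => x; rewrite big_nil].
rewrite (_ : (fun x => _) =
  (fun x : 'rV[R]_k => x ord0 j ^+ p j * \prod_(i <- r) x ord0 i ^+ p i)).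
  have cj : continuous (fun x : 'rV[R]_k => x ord0 j) by exact: coord_continuous.
  have cX m : continuous (fun x : 'rV[R]_k => x ord0 j ^+ m).
    elim: m => [|m IHm]; first exact: cst_continuous.
    rewrite (_ : (fun x => _) = (fun x : 'rV[R]_k => x ord0 j * x ord0 j ^+ m)).
      by move=> x; exact: (cvgM (cj x) (IHm x)).
    by apply/funext => x; rewrite exprS.
  by move=> x; exact: (cvgM (cX (p j) x) (IH x)).
by apply/funext => x; rewrite big_cons.
Qed.

(** The growth condition of [cvgE_growth] for monomials, from [|y| ^ (2 * p) <= (2 * p)! * expR |y|]
    in each coordinate. *)
Lemma monomial_sqr_le {R : realType} k (p : 'I_k -> nat) (x : 'rV[R]_k) :
  (\prod_j x ord0 j ^+ p j) ^+ 2 <= (\prod_j (p j * 2)`!%:R) *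
    (1 + \sum_j (expR (k%:R * x ord0 j) + expR (- (k%:R * x ord0 j)))).
Proof.
rewrite -prodrXl; apply: (@le_trans _ _ (\prod_j ((p j * 2)`!%:R * expR `|x ord0 j|))).
  apply: ler_prod => j _; rewrite -exprM exprM sqr_ge0/=.
  rewrite -[leLHS]ger0_norm ?sqr_ge0// -exprM normrX.
  exact: expr_le_expR.
rewrite big_split -expR_sum /= ler_wpM2l//.
  by apply: prodr_ge0 => j _.
apply: (le_trans (expR_sum_le _)) => [j|]; first exact: normr_ge0.
by rewrite lerD2l; apply: ler_sum => j _; exact: expRM_norm_le.
Qed.

(** * The vector of estimated delays *)

Section arrival_times.
Context {R : realType} (k : nat).
Variables (T lam0 : R) (A B : 'I_k -> R) (lam : 'I_k -> R -> R).
Hypotheses (T0 : 0 < T) (l00 : 0 < lam0) (A0 : forall j, 0 < A j).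
Hypotheses (AB : forall j, A j < B j) (BT : forall j, B j < T).
Hypothesis lam_zero : forall j t, - B j <= t <= 0 -> lam j t = 0.
Hypothesis lam_pos : forall j t, 0 < t <= T - A j -> 0 < lam j t.
Hypothesis lam_C2 : forall j t, - B j <= t <= T - A j ->
  derivable (lam j) t 1 /\ derivable (derive1 (lam j)) t 1 /\
  {for t, continuous (derive1n 2 (lam j))}.
Context {d : measure_display} {Om : measurableType d}.
Variables (P : nat -> ('I_k -> R) -> probability Om R) (X : 'I_k -> Om -> seq R).
Variable tauhat : nat -> 'I_k -> seq R -> R.
Implicit Types (tau : 'I_k -> R) (n : nat) (j : 'I_k).
Hypothesis PX : forall n tau, (forall j, A j <= tau j <= B j) ->
  poisson_model (P n tau) X (fun j t => n%:R * lam j (t - tau j) + n%:R * lam0) T.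
Hypothesis tauhat_meas : forall n j, measurable_fun setT (fun w => tauhat n j (X j w)).
Hypothesis tauhat_max : forall n j x, A j <= tauhat n j x <= B j /\
  forall s, A j <= s <= B j ->
    lik n (lam j) lam0 T s x <= lik n (lam j) lam0 T (tauhat n j x) x.

Notation infoj j := (info T lam0 (A j) (B j) (lam j)).
Notation ratej j := (rate T lam0 (A j) (B j) (lam j)).
Notation logr1j j := (logr1 T lam0 (A j) (B j) (lam j)).
Notation stepj j := (step T lam0 (A j) (B j) (lam j)).
Notation cumj j := (cumulant T lam0 (A j) (B j) (lam j)).

Lemma rate_model n tau : (forall j, A j <= tau j <= B j) ->
  poisson_model (P n tau) X (fun j t => n%:R * ratej j (tau j) t) T.
Proof.
move=> ht; apply: (poisson_model_ext _ (PX n ht)) => j t tT.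
by rewrite /rate sig0E ?mulrDr//; exact: shift_dom (ht j) tT.
Qed.

Lemma obs_tau n tau j : (forall j, A j <= tau j <= B j) ->
  obs T lam0 (A j) (B j) (lam j) (P n tau) (X j) n (tau j).
Proof.
move=> ht; apply: (poisson_model_obs T0 (m := fun j t => n%:R * ratej j (tau j) t) j _ _
  (rate_model n ht)).
- by move=> i; exact: (continuous_nrate (A0 i) (AB i) (BT i) (@lam_C2 i)).
- move=> i t _; rewrite mulr_ge0// ltW//.
  exact: (rate_gt0 l00 (A0 i) (AB i) (BT i) (@lam_zero i) (@lam_pos i)).
Qed.

Lemma mle_tau n j :
  mle T lam0 (A j) (B j) (lam j) (X j) n (fun w => tauhat n j (X j w)).
Proof.
split=> [|w]; first exact: tauhat_meas.
have [h1 h2] := tauhat_max n j (X j w); split=> // s hs.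
have lE := lik_ell lam0 (A0 j) (AB j) (BT j) (@lam_zero j) (@lam_C2 j) n (X j w).
by have := h2 s hs; rewrite !lE// ler_expR.
Qed.

(** Independence of the detectors enters here, through the joint Laplace functional: the exponents
    add up. *)
Lemma joint_step_mgf n tau (a : 'I_k -> R) : (forall j, A j <= tau j <= B j) ->
  (P n tau).-integrable setT (fun w => (expR (\sum_j a j *
     (Num.sqrt n%:R * stepj j n (tau j) (X j w))))%:E) /\
  \int[P n tau]_w expR (\sum_j a j * (Num.sqrt n%:R * stepj j n (tau j) (X j w))) =
    expR (\sum_j cumj j n (tau j) (a j)).
Proof.
move=> ht; pose m j t := n%:R * ratej j (tau j) t.
pose z j := tilt T lam0 (A j) (B j) (lam j) n (tau j) (a j).
pose f j t := z j * logr1j j (t - tau j).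
have cl j : continuous (fun t => logr1j j (t - tau j)).
  apply: continuous_shift.
  exact: (continuous_logr1 l00 (A0 j) (AB j) (BT j) (@lam_zero j) (@lam_pos j) (@lam_C2 j)).
have cm j : continuous (m j).
  exact: (continuous_nrate (A0 j) (AB j) (BT j) (@lam_C2 j)).
have cf j : continuous (f j) by exact: (continuousZ_fun (c := z j) (cl j)).
have m0 j t : 0 < t <= T -> 0 <= m j t.
  move=> _; rewrite mulr_ge0// ltW//.
  exact: (rate_gt0 l00 (A0 j) (AB j) (BT j) (@lam_zero j) (@lam_pos j)).
have E w : \sum_j a j * (Num.sqrt n%:R * stepj j n (tau j) (X j w)) =
    \sum_j centered T (X j) (m j) (f j) w.
  apply: eq_bigr => j _; rewrite -(centeredZ _ _ _ _ (cl j) (cm j)).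
  exact: (step_centered l00 (A0 j) (AB j) (BT j) (@lam_zero j) (@lam_pos j) (@lam_C2 j)).
have M := joint_centered_mgf T0 cm m0 cf (rate_model n ht).
have I : (P n tau).-integrable setT
    (fun w => (expR (\sum_j centered T (X j) (m j) (f j) w))%:E).
  apply/integrableP; split.
    apply/measurable_EFinP; apply: measurableT_comp => //.
    apply: measurable_sum => j; exact: (measurable_centered (obs_tau n j ht) (cf j)).
  under eq_integral do rewrite gee0_abs ?lee_fin ?expR_ge0//.
  by rewrite M ltry.
split; first by rewrite (_ : (fun w => _) = (fun w =>
  (expR (\sum_j centered T (X j) (m j) (f j) w))%:E)) //; apply/funext => w; rewrite E.
rewrite (_ : (fun w => _) = (fun w => expR (\sum_j centered T (X j) (m j) (f j) w))).
  by rewrite /Rintegral M.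
by apply/funext => w; rewrite E.
Qed.

Section position.
Variables (tau0 : 'I_k -> R) (mgn : R).
Hypothesis mgn0 : 0 < mgn.
Hypothesis tau0_in : forall j, A j + mgn <= tau0 j <= B j - mgn.

Let tau0_adm j : A j <= tau0 j <= B j.
Proof. by have /andP[] := tau0_in j; move: mgn0 => ? ? ?; apply/andP; split; lra. Qed.

Let infoj_gt0 j : 0 < infoj j (tau0 j).
Proof.
have [i0 i00 hi] := info_lb T0 l00 (A0 j) (AB j) (BT j) (@lam_zero j) (@lam_pos j) (@lam_C2 j).
exact: lt_le_trans i00 (hi _ (tau0_adm j)).
Qed.

Let Z n w : 'rV[R]_k := \row_j (Num.sqrt n%:R * (tauhat n j (X j w) - tau0 j)).

Lemma mgf_cvg (a : 'I_k -> R) :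
  (forall n, (P n tau0).-integrable setT (fun w => (expR (lin a (Z n w)))%:E)) /\
  (\int[P n tau0]_w expR (lin a (Z n w))) @[n --> \oo] -->
    expR (\sum_j a j ^+ 2 / (2 * infoj j (tau0 j))).
Proof.
pose S n j w := Num.sqrt n%:R * stepj j n (tau0 j) (X j w).
pose Zj n j w := Num.sqrt n%:R * (tauhat n j (X j w) - tau0 j).
pose b := \sum_j `|B j - A j|.
have linE n w : lin a (Z n w) = \sum_j a j * Zj n j w.
  by rewrite /lin; apply: eq_bigr => j _; rewrite mxE.
have mZ n j : measurable_fun setT (Zj n j).
  by apply: measurable_funM => //; apply: measurable_funB.
have Zb n j w : `|Zj n j w| <= b * Num.sqrt n%:R.
  rewrite normrM (ger0_norm (sqrtr_ge0 _)) mulrC ler_wpM2r ?sqrtr_ge0//.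
  apply: (@le_trans _ _ `|B j - A j|); last by rewrite /b (bigD1 j)//= lerDl sumr_ge0.
  have [/andP[t1 t2] _] := tauhat_max n j (X j w); have /andP[s1 s2] := tau0_adm j.
  apply: le_trans (ler_norm _); rewrite ler_norml; apply/andP; split; lra.
have S_exp j c : (forall n, (P n tau0).-integrable setT (fun w => (expR (c * S n j w))%:E)) /\
    exists N (C : R), forall n, (N <= n)%N -> \int[P n tau0]_w expR (c * S n j w) <= C.
  have sm n := step_mgf l00 (A0 j) (AB j) (BT j) (@lam_zero j) (@lam_pos j) (@lam_C2 j)
    c (obs_tau n j tau0_adm).
  split=> [n|]; first by have [] := sm n.
  have [N [C hC]] := cumulant_ub T0 l00 (A0 j) (AB j) (BT j) (@lam_zero j) (@lam_pos j)
    (@lam_C2 j) c.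
  exists N, (expR C) => n nN; have [_ ->] := sm n.
  by rewrite ler_expR; exact: hC (tau0_adm j).
have S_lin j eps : 0 < eps <= 1 -> exists2 K, 0 <= K & exists2 c, 0 < c &
    forall n, (0 < n)%N -> exists E : set Om, [/\ measurable E,
      (P n tau0 E <= (K * expR (- (c * n%:R)))%:E)%E & forall w, ~ E w ->
        (Zj n j w - S n j w) ^+ 2 <= eps * S n j w ^+ 2].
  move=> he; have [K K0 [c c0 h]] := linearisation T0 l00 (A0 j) (AB j) (BT j)
    (@lam_zero j) (@lam_pos j) (@lam_C2 j) he mgn0 (Om := Om).
  exists K => //; exists c => // n n0.
  have [E [mE PE hE]] := h _ _ _ _ _ n0 (tau0_in j) (obs_tau n j tau0_adm) (mle_tau n j).
  exists E; split=> // w /hE {}hE.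
  rewrite /Zj /S -mulrBr exprMn [X in _ <= _ * X]exprMn [leRHS]mulrCA.
  by rewrite ler_wpM2l// sqr_ge0.
split=> [n|].
  have := @integrable_expR_lin _ _ _ k (fun n => P n tau0) Zj b mZ Zb a n.
  by rewrite (_ : (fun w => _) = (fun w => (expR (lin a (Z n w)))%:E)) //;
    apply/funext => w; rewrite linE.
have := @linear_approximation_mgf _ _ _ k (fun n => P n tau0) S Zj b mZ Zb S_exp S_lin a
  (expR (\sum_j a j ^+ 2 / (2 * infoj j (tau0 j)))).
have -> : (fun n => \int[P n tau0]_w expR (\sum_j a j * Zj n j w)) =
    (fun n => \int[P n tau0]_w expR (lin a (Z n w))).
  by apply/funext => n; apply: eq_Rintegral => w _; rewrite linE.
apply; first by move=> n; have [] := joint_step_mgf n a tau0_adm.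
rewrite (_ : (fun n => _) = (fun n => expR (\sum_j cumj j n (tau0 j) (a j)))); last first.
  by apply/funext => n; have [_ ->] := joint_step_mgf n a tau0_adm.
apply: continuous_cvg; first exact: continuous_expR.
apply: cvg_sumr => j; apply/cvgrPdist_le => e e0.
have [N hN] := cumulant_cvg T0 l00 (A0 j) (AB j) (BT j) (@lam_zero j) (@lam_pos j)
    (@lam_C2 j) (a j) e0.
by exists N => // n /= nN; rewrite distrC; exact: hN (tau0_adm j).
Qed.

Lemma consistent_delays (eps : R) : 0 < eps ->
  (fun n => P n tau0 [set w | eps <
     Num.sqrt (\sum_(j < k) (tauhat n j (X j w) - tau0 j) ^+ 2)]) @ \oo --> 0%E.
Proof.
move=> eps0; pose U n := [set w | eps <
  Num.sqrt (\sum_(j < k) (tauhat n j (X j w) - tau0 j) ^+ 2)].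
have k1 : 0 < k%:R + 1 :> R by rewrite ltr_wpDl.
(* If all coordinates are below [rho], the squared norm is at most [k * rho ^ 2 <= eps ^ 2]. *)
pose rho := eps / (k%:R + 1); have rho0 : 0 < rho by rewrite divr_gt0.
pose E n j := [set w | rho <= `|tauhat n j (X j w) - tau0 j|].
have UE n : U n `<=` \big[setU/set0]_j E n j.
  move=> w; rewrite /U /= => h; rewrite -bigcup_seq.
  apply: contrapT => nE; move: h; apply/negP; rewrite -leNgt.
  rewrite -(ger0_norm (ltW eps0)) -sqrtr_sqr ler_wsqrtr//.
  apply: (@le_trans _ _ (\sum_(j < k) rho ^+ 2)).
    apply: ler_sum => j _; rewrite -(real_normK (num_real (_ - _))).
    rewrite lerXn2r ?nnegrE ?(ltW rho0)// leNgt; apply/negP => /ltW h.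
    by apply: nE; exists j; rewrite //= mem_index_enum.
  rewrite sumr_const card_ord -[_ *+ k]mulr_natr /rho expr_div_n mulrAC.
  rewrite ler_pdivrMr ?exprn_gt0// ler_wpM2l ?sqr_ge0//.
  have := ler0n R k; move: (k%:R) => x x0; rewrite sqrrD; have := sqr_ge0 x; lra.
have mU n : measurable (U n).
  have mS : measurable_fun setT (fun w =>
      Num.sqrt (\sum_(j < k) (tauhat n j (X j w) - tau0 j) ^+ 2)).
    apply: measurableT_comp.
      by apply: continuous_measurable_fun; exact: sqrt_continuous.
    by apply: measurable_sum => j; apply: measurable_funX; apply: measurable_funB.
  rewrite -[U n]setTI; have := mS measurableT `]eps, +oo[%classic.
  have -> : (fun w => Num.sqrt (\sum_(j < k) (tauhat n j (X j w) - tau0 j) ^+ 2))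
      @^-1` `]eps, +oo[%classic = U n.
    by apply/seteqP; split => w /=; rewrite in_itv/= andbT.
  by apply.
have hE (e : R) : 0 < e -> exists N, forall n, (N <= n)%N -> (P n tau0 (U n) <= e%:E)%E.
  move=> e0; have c0 j : exists N, forall n, (N <= n)%N -> measurable (E n j) /\
      (P n tau0 (E n j) <= (e / (k%:R + 1))%:E)%E.
    have [K K0 [c c0 h]] := consistency T0 l00 (A0 j) (AB j) (BT j) (@lam_zero j)
      (@lam_pos j) (@lam_C2 j) rho0 (Om := Om).
    have K1 : 0 < K + 1 by rewrite ltr_wpDl.
    have eK : 0 < e / (k%:R + 1) / (K + 1) by rewrite !divr_gt0.
    have [N hN] := exp_decay 0 c0 eK; exists N => n nN.
    have [mE PE] := h _ _ _ _ _ (tau0_adm j) (obs_tau n j tau0_adm) (mle_tau n j).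
    split=> //; apply: (le_trans PE); rewrite lee_fin.
    have := hN n nN; rewrite mul0r add0r ler_pdivlMr// mulrC => h1.
    by apply: le_trans h1; rewrite ler_wpM2r ?expR_ge0// lerDl.
  have [N hN] := choice c0; exists (\max_j N j)%N => n nN.
  have hn j := hN j n (leq_trans (leq_bigmax j) nN).
  have [m1 m2] := measure_bigsetU_le (index_enum 'I_k) (fun j => (hn j).1) (fun j => (hn j).2).
  apply: (@le_trans _ _ (P n tau0 (\big[setU/set0]_j E n j))).
    by apply: le_measure; rewrite ?inE//; exact: UE.
  apply: (le_trans m2); rewrite lee_fin sumr_const card_ord -[_ *+ k]mulr_natr mulrAC.
  by rewrite ler_pdivrMr// ler_wpM2l ?(ltW e0)// lerDl.
apply/fine_cvgP; split.
  by exists 0%N => // n _; exact: (fin_num_measure (P n tau0) (U n) (mU n)).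
apply/cvgrPdist_le => e e0; have [N hN] := hE e e0; exists N => // n /= nN.
rewrite sub0r normrN ger0_norm ?fine_ge0 ?measure_ge0//.
rewrite -lee_fin fineK; first exact: (hN n nN).
exact: (fin_num_measure (P n tau0) (U n) (mU n)).
Qed.

(** Half of the margin is given up, so that all delays within [mgn / 2] of [tau0] are covered at
    once. *)
Lemma uniform_risk (e : R) : 0 < e -> exists N, forall n tau, (N <= n)%N ->
  (forall j, A j + mgn / 2 <= tau j <= B j - mgn / 2) ->
  (P n tau).-integrable setT
    (fun w => (\sum_(j < k) (tauhat n j (X j w) - tau j) ^+ 2)%:E) /\
  `|n%:R * \int[P n tau]_w (\sum_(j < k) (tauhat n j (X j w) - tau j) ^+ 2) -
    \sum_j (infoj j (tau j))^-1| <= e.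
Proof.
move=> e0; have k1 : 0 < k%:R + 1 :> R by rewrite ltr_wpDl.
have ek : 0 < e / (k%:R + 1) by rewrite divr_gt0.
have m2 : 0 < mgn / 2 by rewrite divr_gt0.
have c0 j := uniform_mse T0 l00 (A0 j) (AB j) (BT j) (@lam_zero j)
      (@lam_pos j) (@lam_C2 j) ek m2 (Om := Om).
have [N hN] := choice c0; exists (\max_j N j)%N => n tau nN ht.
have adm j : A j <= tau j <= B j.
  by have /andP[] := ht j; move: m2 => ? ? ?; apply/andP; split; lra.
have hn j := hN j n _ _ _ _ (leq_trans (leq_bigmax j) nN) (ht j) (obs_tau n j adm)
  (mle_tau n j).
have [i1 ->] := Rintegral_sum (index_enum 'I_k) (fun j => (hn j).1).
split=> //; rewrite mulr_sumr -sumrB (le_trans (ler_norm_sum _ _ _))//.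
apply: (@le_trans _ _ (\sum_(j < k) (e / (k%:R + 1)))).
  by apply: ler_sum => j _; exact: (hn j).2.
rewrite sumr_const card_ord -[_ *+ k]mulr_natr mulrAC.
by rewrite ler_pdivrMr// ler_wpM2l ?(ltW e0)// lerDl.
Qed.

Let D (dl : R) := [set tau : 'I_k -> R | (forall j, A j <= tau j <= B j) /\
  Num.sqrt (\sum_(j < k) (tau j - tau0 j) ^+ 2) <= dl].
(** Trace of the inverse information matrix at [tau], the limit of the normalised squared error. *)
Let risk (tau : 'I_k -> R) := \sum_j (infoj j (tau j))^-1.

Lemma tau0_ball dl : 0 <= dl -> D dl tau0.
Proof.
move=> dl0; split; first exact: tau0_adm.
by rewrite big1 ?sqrtr0// => j _; rewrite subrr expr0n.
Qed.

Lemma ball_coord dl tau j : D dl tau -> `|tau j - tau0 j| <= dl.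
Proof.
move=> [_]; apply: le_trans; rewrite -sqrtr_sqr ler_wsqrtr//.
by rewrite (bigD1 j)//= lerDl sumr_ge0// => i _; exact: sqr_ge0.
Qed.

Lemma risk_bounded dl : has_ubound [set risk tau | tau in D dl].
Proof.
have c0 j := info_lb T0 l00 (A0 j) (AB j) (BT j) (@lam_zero j) (@lam_pos j) (@lam_C2 j).
have /choice[i0 hi] j : exists i0, 0 < i0 /\ forall s, A j <= s <= B j -> i0 <= infoj j s.
  by have [i0 ? ?] := c0 j; exists i0.
exists (\sum_j (i0 j)^-1) => _ [tau [adm _] <-]; apply: ler_sum => j _.
have [p h] := hi j; rewrite lef_pV2 ?posrE ?h//.
exact: lt_le_trans p (h _ (adm j)).
Qed.

Lemma uniform_risk_cvg dl : 0 < dl < mgn / 2 ->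
  (fun n => ereal_sup [set (n%:R%:E * \int[P n tau]_w
      (\sum_(j < k) (tauhat n j (X j w) - tau j) ^+ 2)%:E)%E | tau in D dl])
  @ \oo --> (sup [set risk tau | tau in D dl])%:E.
Proof.
move=> /andP[dl0 dlm]; apply: cvg_ereal_sup.
- by exists tau0; apply: tau0_ball; exact: ltW.
- exact: risk_bounded.
move=> e e0; have [N hN] := uniform_risk e0; exists N => n nN tau Dt.
have ht j : A j + mgn / 2 <= tau j <= B j - mgn / 2.
  have := ball_coord j Dt; rewrite ler_distl => /andP[? ?].
  by have /andP[? ?] := tau0_in j; apply/andP; split; lra.
have [i1 h] := hN n tau nN ht.
exists (n%:R * \int[P n tau]_w (\sum_(j < k) (tauhat n j (X j w) - tau j) ^+ 2)) => //.
by rewrite EFinM /Rintegral fineK// integrable_fin_num.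
Qed.

Lemma risk_continuous : sup [set risk tau | tau in D dl] @[dl --> 0^'+] --> risk tau0.
Proof.
have k1 : 0 < k%:R + 1 :> R by rewrite ltr_wpDl.
apply/cvgrPdist_le => e e0.
have ek : 0 < e / (k%:R + 1) by rewrite divr_gt0.
have c0 j : exists r : R, 0 < r /\ forall s, A j <= s <= B j -> `|s - tau0 j| <= r ->
    (infoj j s)^-1 <= (infoj j (tau0 j))^-1 + e / (k%:R + 1).
  have [i0 i00 hi] := info_lb T0 l00 (A0 j) (AB j) (BT j) (@lam_zero j) (@lam_pos j)
    (@lam_C2 j).
  (* As [1 / x - 1 / y = (y - x) / (x * y)] with [x * y >= i0 ^ 2], this tolerance on the
     information costs at most [e / (k + 1)] on its inverse. *)
  have w0 : 0 < e / (k%:R + 1) * i0 ^+ 2 by rewrite mulr_gt0// exprn_gt0.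
  have [r r0 hr] := info_unif T0 l00 (A0 j) (AB j) (BT j) (@lam_zero j) (@lam_pos j)
    (@lam_C2 j) w0.
  exists r; split=> // s hs sr; have := hr _ _ hs (tau0_adm j) sr.
  have := hi _ hs; have := hi _ (tau0_adm j).
  move: (infoj j s) (infoj j (tau0 j)) => x y y0 x0 hxy.
  have yp : 0 < y := lt_le_trans i00 y0; have xp : 0 < x := lt_le_trans i00 x0.
  rewrite -lerBlDl (_ : x^-1 - y^-1 = (y - x) / (x * y)); last first.
    by field; rewrite !gt_eqF.
  rewrite ler_pdivrMr ?mulr_gt0//.
  apply: (@le_trans _ _ (e / (k%:R + 1) * i0 ^+ 2)).
    by move: hxy; rewrite ler_distl; move: (_ * i0 ^+ 2) => v /andP[? ?]; lra.
  rewrite ler_wpM2l ?(ltW ek)// expr2.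
  by apply: ler_pM => //; exact: ltW.
have [r hr] := choice c0.
pose r0 := \big[Num.min/1]_j r j.
have r00 : 0 < r0 by apply: lt_bigmin => // j _; have [] := hr j.
near=> dl.
have dl0 : 0 < dl by near: dl; exact: nbhs_right_gt.
have dlr : dl < r0 by near: dl; exact: nbhs_right_lt.
have s1 : risk tau0 <= sup [set risk tau | tau in D dl].
  by apply: ub_le_sup; [exact: risk_bounded|exists tau0 => //; apply: tau0_ball; exact: ltW].
have s2 : sup [set risk tau | tau in D dl] <= risk tau0 + e.
  apply: ge_sup; first by exists (risk tau0), tau0 => //; apply: tau0_ball; exact: ltW.
  move=> _ [tau Dt <-]; apply: (@le_trans _ _
      (\sum_j ((infoj j (tau0 j))^-1 + e / (k%:R + 1)))).
    apply: ler_sum => j _; have [_ h] := hr j; apply: h; first exact: (Dt.1 j).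
    apply: (le_trans (ball_coord j Dt)); rewrite ltW// (lt_le_trans dlr)//.
    exact: bigmin_le.
  rewrite big_split /= lerD2l sumr_const card_ord -[_ *+ k]mulr_natr mulrAC.
  by rewrite ler_pdivrMr// ler_wpM2l ?(ltW e0)// lerDl.
by rewrite ler_distl; apply/andP; split; lra.
Unshelve. all: by end_near. Qed.
Section limit_law.
Context {d' : measure_display} {Om' : measurableType d'}.
Variables (Q : probability Om' R) (xi : 'I_k -> Om' -> R).
Hypothesis mxi : forall j, measurable_fun setT (xi j).
Hypothesis xi_law : forall S : 'I_k -> set R, (forall j, measurable (S j)) ->
  Q [set w | forall j, S j (xi j w)] =
  (\prod_(j < k) fine (normal_prob 0
     (Num.sqrt (fisher_tau (lam j) lam0 T (tau0 j))^-1) (S j)))%:E.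

Let xiv w : 'rV[R]_k := \row_j xi j w.

(** Identifies the limit in [mgf_cvg] with the Gaussian moment generating function; afterwards the
    law of [xi] is used only through these expectations. *)
Lemma cvgE_exp_lin (a : 'I_k -> R) :
  cvgE (fun n => P n tau0) Q Z xiv (fun x => expR (lin a x)).
Proof.
pose s j := Num.sqrt (fisher_tau (lam j) lam0 T (tau0 j))^-1.
have fE j : fisher_tau (lam j) lam0 T (tau0 j) = infoj j (tau0 j).
  exact: (fisher_tauE l00 (A0 j) (AB j) (BT j) (@lam_zero j) (@lam_pos j) (@lam_C2 j)
    (tau0_adm j)).
have s0 j : s j != 0 by rewrite gt_eqF// sqrtr_gt0 invr_gt0 fE; exact: infoj_gt0.
have s2 j : s j ^+ 2 = (infoj j (tau0 j))^-1.
  by rewrite /s fE sqr_sqrtr// invr_ge0; exact: ltW (infoj_gt0 j).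
have linE w : lin a (xiv w) = \sum_j a j * xi j w.
  by rewrite /lin; apply: eq_bigr => j _; rewrite mxE.
have G := @gaussian_vector_mgf _ _ _ Q k xi s a s0 mxi xi_law.
have {}G : (\int[Q]_w (expR (lin a (xiv w)))%:E)%E =
    (expR (\sum_j a j ^+ 2 / (2 * infoj j (tau0 j))))%:E.
  rewrite -[RHS](_ : (expR (\sum_j a j ^+ 2 * s j ^+ 2 / 2))%:E = _); last first.
    by congr (expR _)%:E; apply: eq_bigr => j _; rewrite s2; field; exact: lt0r_neq0 (infoj_gt0 j).
  by rewrite -G; apply: eq_integral => w _; rewrite linE.
have [i1 c1] := mgf_cvg a; split=> //; last by rewrite [X in _ --> X]/Rintegral G.
apply/integrableP; split.
  apply/measurable_EFinP; apply: measurableT_comp => //.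
  under eq_fun do rewrite linE.
  by apply: measurable_sum => j; apply: measurable_funM.
under eq_integral do rewrite gee0_abs ?lee_fin ?expR_ge0//.
by rewrite G ltry.
Qed.

(** The Gaussian second moment is not computed: the normalised mean squared errors converge both to
    it, as polynomial expectations, and to [risk tau0] by [uniform_risk], and limits are unique. *)
Lemma risk_limit : \int[Q]_w (\sum_(j < k) (xi j w) ^+ 2) = risk tau0.
Proof.
pose F (x : 'rV[R]_k) : R := \sum_j x ord0 j ^+ 2.
have [_ _ cF] : cvgE (fun n => P n tau0) Q Z xiv F.
  apply: cvgE_sum; first exact: (cvgE_cst cvgE_exp_lin).
  move=> j; apply: cvgE_ext (cvgE_pow cvgE_exp_lin (fun i => (i == j)%:R) 2) => x.
  congr (_ ^+ 2); rewrite /lin (bigD1 j)//= eqxx mul1r big1 ?addr0// => i /negbTE ->.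
  by rewrite mul0r.
have -> : \int[Q]_w (\sum_(j < k) (xi j w) ^+ 2) = \int[Q]_w F (xiv w).
  by apply: eq_Rintegral => w _; apply: eq_bigr => j _; rewrite mxE.
apply: (cvg_unique _ cF) => //; apply/cvgrPdist_le => e e0.
have [N hN] := uniform_risk e0; exists N => // n /= nN.
have ht j : A j + mgn / 2 <= tau0 j <= B j - mgn / 2.
  have /andP[? ?] := tau0_in j; move: mgn0 => ?; apply/andP; split; lra.
have [i1 h] := hN n tau0 nN ht; rewrite distrC /risk.
rewrite (_ : \int[P n tau0]_w F (Z n w) =
  n%:R * \int[P n tau0]_w (\sum_(j < k) (tauhat n j (X j w) - tau0 j) ^+ 2)) //.
rewrite -RintegralZl//; apply: eq_Rintegral => w _.
by rewrite mulr_sumr; apply: eq_bigr => j _; rewrite mxE exprMn sqr_sqrtr.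
Qed.

End limit_law.

End position.
End arrival_times.

Theorem theorem2
  (R : realType) (T nu lam0 : R) (k : nat)
  (det : 'I_k -> R * R) (Th : set (R * R)) (lam : 'I_k -> R -> R)
  (th0 : R * R)
  (d : measure_display) (Om : measurableType d)
  (P : nat -> ('I_k -> R) -> probability Om R)
  (X : 'I_k -> Om -> seq R)
  (tauhat : nat -> 'I_k -> seq R -> R) :
  0 < T -> 0 < nu -> 0 < lam0 -> (3 <= k)%N ->
  open Th -> bounded2 Th -> convex2 Th -> Th th0 ->
  (forall j, 0 < alpha nu Th (det j) /\ beta nu Th (det j) < T) ->
  (* R1 *)
  (forall j t, - beta nu Th (det j) <= t <= 0 -> lam j t = 0) ->
  (forall j t, 0 < t <= T - alpha nu Th (det j) -> 0 < lam j t) ->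
  (* R2 *)
  (forall j t, - beta nu Th (det j) <= t <= T - alpha nu Th (det j) ->
     derivable (lam j) t 1 /\ derivable (derive1 (lam j)) t 1 /\
     {for t, continuous (derive1n 2 (lam j))}) ->
  (* R3 *)
  (exists c : R, 0 < c /\ forall th e, Th th -> e.1 ^+ 2 + e.2 ^+ 2 = 1 ->
     c <= fisher_pos_quad nu lam0 T lam det th e) ->
  (* R4 *)
  (exists i j l : 'I_k, i != j /\ j != l /\ i != l /\
     ((det j).1 - (det i).1) * ((det l).2 - (det i).2)
       - ((det j).2 - (det i).2) * ((det l).1 - (det i).1) != 0) ->
  (* observation model, for every n and every admissible delay vector *)
  (forall n (tau : 'I_k -> R),
     (forall j, alpha nu Th (det j) <= tau j <= beta nu Th (det j)) ->
     poisson_model (P n tau) X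
       (fun j t => n%:R * lam j (t - tau j) + n%:R * lam0) T) ->
  (* the estimators are (measurable) maximum likelihood estimators *)
  (forall n j, measurable_fun setT (fun w => tauhat n j (X j w))) ->
  (forall n j x,
     alpha nu Th (det j) <= tauhat n j x <= beta nu Th (det j) /\
     forall s, alpha nu Th (det j) <= s <= beta nu Th (det j) ->
       lik n (lam j) lam0 T s x <= lik n (lam j) lam0 T (tauhat n j x) x) ->
  let tau0 : 'I_k -> R := fun j => delay nu (det j) th0 in
  let Z : nat -> Om -> 'rV[R]_k := fun n w =>
    \row_j (Num.sqrt n%:R * (tauhat n j (X j w) - tau0 j)) in
  let Ijj : 'I_k -> R := fun j => fisher_tau (lam j) lam0 T (tau0 j) in
  (* consistency *)
  (forall eps : R, 0 < eps ->
     (fun n => P n tau0 [set w | eps <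
        Num.sqrt (\sum_(j < k) (tauhat n j (X j w) - tau0 j) ^+ 2)])
     @ \oo --> 0%E) /\
  (* for every xi ~ N(0, I_tau(theta0)^{-1}) (I_tau diagonal, so the
     components are independent N(0, 1/I_jj)) *)
  (forall (d' : measure_display) (Om' : measurableType d')
          (Q : probability Om' R) (xi : 'I_k -> Om' -> R),
     (forall j, measurable_fun setT (xi j)) ->
     (forall B : 'I_k -> set R, (forall j, measurable (B j)) ->
        Q [set w | forall j, B j (xi j w)] =
        (\prod_(j < k) fine (normal_prob 0 (Num.sqrt (Ijj j)^-1) (B j)))%:E) ->
     let xiv : Om' -> 'rV[R]_k := fun w => \row_j xi j w in
     (* asymptotic normality (convergence in distribution) *)
     (forall f : 'rV[R]_k -> R, continuous f ->
        (exists M : R, forall v, `|f v| <= M) ->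
        (fun n => Rintegral (P n tau0) setT (fun w => f (Z n w)))
        @ \oo --> Rintegral Q setT (fun w => f (xiv w))) /\
     (* convergence of all polynomial moments *)
     (forall p : 'I_k -> nat,
        (fun n => Rintegral (P n tau0) setT
                    (fun w => \prod_(j < k) (Z n w ord0 j) ^+ p j))
        @ \oo --> Rintegral Q setT (fun w => \prod_(j < k) (xi j w) ^+ p j)) /\
     (* asymptotic efficiency:
        lim_{delta->0} lim_n sup_{|tau - tau0| <= delta} n E_tau |tauhat_n - tau|^2
          = E |xi|^2 *)
     (exists (delta0 : R) (l : R -> R), 0 < delta0 /\
        (forall delta, 0 < delta < delta0 ->
           (fun n => ereal_sup
              [set (n%:R%:E * \int[P n tau]_w
                     (\sum_(j < k) (tauhat n j (X j w) - tau j) ^+ 2)%:E)%E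
              | tau in [set tau : 'I_k -> R |
                   (forall j, alpha nu Th (det j) <= tau j <= beta nu Th (det j))
                   /\ Num.sqrt (\sum_(j < k) (tau j - tau0 j) ^+ 2) <= delta]])
           @ \oo --> (l delta)%:E) /\
        l x @[x --> 0^'+] -->
          Rintegral Q setT (fun w => \sum_(j < k) (xi j w) ^+ 2))).

Proof.
move=> T0 nu0 l00 _ oTh bTh _ Thth0 hab lam_zero lam_pos lam_C2 _ _ PX mhat hmax tau0 Z Ijj.
pose A j := alpha nu Th (det j); pose B j := beta nu Th (det j).
have A0 j : 0 < A j := (hab j).1.
have BT j : B j < T := (hab j).2.
have tin j : A j < tau0 j < B j := delay_interior nu0 oTh bTh Thth0 (A0 j).
have AB j : A j < B j by have /andP[h1] := tin j; exact: lt_trans.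
(* A margin common to all detectors; the initial value 1 of the minimum keeps it positive and can
   only lower it. *)
pose mgn := \big[Num.min/1]_j Num.min (tau0 j - A j) (B j - tau0 j).
have mgn0 : 0 < mgn.
  apply: lt_bigmin => // j _; have /andP[? ?] := tin j.
  by rewrite lt_min !subr_gt0; apply/andP.
have mgnj j : A j + mgn <= tau0 j <= B j - mgn.
  have : mgn <= Num.min (tau0 j - A j) (B j - tau0 j) by exact: bigmin_le.
  by rewrite le_min => /andP[? ?]; apply/andP; split; lra.
split.
  exact: (consistent_delays T0 l00 A0 AB BT lam_zero lam_pos lam_C2 PX mhat hmax mgn0 mgnj).
move=> d' Om' Q xi mxi xi_law xiv.
have H := cvgE_exp_lin T0 l00 A0 AB BT lam_zero lam_pos lam_C2 PX mhat hmax mgn0 mgnj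
  mxi xi_law.
split; first by move=> f cf [M fM]; have [] := cvgE_bounded H cf fM.
split.
  move=> p; have cW : cvgE (fun n => P n tau0) Q Z xiv (fun x : 'rV[R]_k =>
      (\prod_j (p j * 2)`!%:R) *
      (1 + \sum_j (expR (k%:R * x ord0 j) + expR (- (k%:R * x ord0 j))))).
    by apply: cvgEZ; exact: (cvgE_coord_weight H).
  have cm := @continuous_coord_monomial R k p (index_enum 'I_k).
  have [_ _] := cvgE_growth H cm cW (@monomial_sqr_le R k p).
  rewrite (_ : (\int[Q]_w (\prod_(j < k) (xi j w) ^+ p j)) =
    \int[Q]_w (\prod_j (xiv w) ord0 j ^+ p j)) //.
  by apply: eq_Rintegral => w _; apply: eq_bigr => j _; rewrite mxE.
have RL := risk_limit T0 l00 A0 AB BT lam_zero lam_pos lam_C2 PX mhat hmax mgn0 mgnj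
  mxi xi_law.
(* The inner limit in [n] is the supremum of the limiting risk over the ball. Radii below [mgn / 2]
   keep every delay of the ball at distance at least [mgn / 2] from the ends of its range. *)
exists (mgn / 2), (fun dl => sup [set \sum_j (info T lam0 (A j) (B j) (lam j) (tau j))^-1 |
  tau in [set tau : 'I_k -> R | (forall j, A j <= tau j <= B j) /\
    Num.sqrt (\sum_(j < k) (tau j - tau0 j) ^+ 2) <= dl]]); split.
  by rewrite divr_gt0.
split.
  move=> dl hdl; exact: (uniform_risk_cvg T0 l00 A0 AB BT lam_zero lam_pos lam_C2 PX
    mhat hmax mgn0 mgnj hdl).
rewrite RL.
exact: (risk_continuous T0 l00 A0 AB BT lam_zero lam_pos lam_C2 mgn0 mgnj).
Qed.
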